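(* Let $\Omega_D\subset\mathbb{H}^n$ be a circular set and let $f\in\mathcal{SR}_h(\Omega_D)$ be a slice function which is slice regular with respect to $x_h$, for some $h=1,\dots,n$. Then $\Delta_h f$ is an axially monogenic function with respect to $x_h$, i.e. $$\Delta_h f\in\ker(\overline{\partial}_{x_h}).$$ In other words, the Fueter map extends to $$\Delta_h:\mathcal{SR}_h(\Omega_D)\to\mathcal{AM}_h(\Omega_D).$$
   Context: $\mathbb{H}$ is the algebra of quaternions with basis $1,i,j,k$, and $\mathbb{S}_{\mathbb{H}}=\{q\in\mathbb{H}: q^2=-1\}$. $n\ge 1$ is an integer and $\mathcal{P}(n)$ is the set of subsets of $\{1,\dots,n\}$. For $K=\{k_1<\dots<k_p\}\in\mathcal{P}(n)$ and quaternions $q_{k_1},\dots,q_{k_p}$, put $q_K=q_{k_1}\cdots q_{k_p}$ ($q_\emptyset=1$), and $[q_K,a]=q_K\,a$ for $a\in\mathbb{H}$. For $z\in\mathbb{C}^n$, $\overline{z}^h$ is $z$ with its $h$-th coordinate conjugated. A set $D\subset\mathbb{C}^n$ is invariant with respect to complex conjugation if $z\in D\iff\overline{z}^h\in D$ for every $h$; $D$ always denotes such a set. Its circularization is $\Omega_D=\{(\alpha_1+J_1\beta_1,\dots,\alpha_n+J_n\beta_n): (\alpha_1+i\beta_1,\dots,\alpha_n+i\beta_n)\in D,\ J_1,\dots,J_n\in\mathbb{S}_{\mathbb{H}}\}\subset\mathbb{H}^n$; sets of this form are called circular. Let $\{e_K\}_{K\in\mathcal{P}(n)}$ be a basis of $\mathbb{R}^{2^n}$.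 A stem function is $F=\sum_{K}e_KF_K:D\to\mathbb{H}\otimes\mathbb{R}^{2^n}$, $F_K:D\to\mathbb{H}$, with $F_K(\overline{z}^h)=(-1)^{|K\cap\{h\}|}F_K(z)$ for all $K,h,z$. It induces the slice function $f=\mathcal{I}(F):\Omega_D\to\mathbb{H}$, $f(x)=\sum_K[J_K,F_K(z)]$ for $x=(\alpha_l+J_l\beta_l)_l$, $z=(\alpha_l+i\beta_l)_l\in D$. $\mathcal{S}(\Omega_D)$ is the set of slice functions $\Omega_D\to\mathbb{H}$, and $\mathcal{S}^1(\Omega_D)$ is the set of slice functions induced by stem functions of class $\mathcal{C}^1$ on $D$. One variable: for $E\subset\mathbb{C}$ conjugation invariant and $\Omega_E=\{\alpha+J\beta:\alpha+i\beta\in E, J\in\mathbb{S}_{\mathbb{H}}\}$, a function $g:\Omega_E\to\mathbb{H}$ is slice if $g(\alpha+J\beta)=G_1(\alpha+i\beta)+J\,G_2(\alpha+i\beta)$ for functions $G_1,G_2:E\to\mathbb{H}$ with $G_1(\overline w)=G_1(w)$, $G_2(\overline w)=-G_2(w)$; it is slice regular if moreover $G_1,G_2$ are $\mathcal{C}^1$ with $\partial_\alpha G_1=\partial_\beta G_2$, $\partial_\beta G_1=-\partial_\alpha G_2$. For $y\in\Omega_D$ let $\Omega_{D,h}(y)=\{x\in\mathbb{H}:(y_1,\dots,y_{h-1},x,y_{h+1},\dots,y_n)\in\Omega_D\}$ (a set of the form $\Omega_E$) and $f^y_h:\Omega_{D,h}(y)\to\mathbb{H}$, $f^y_h(x)=f(y_1,\dots,y_{h-1},x,y_{h+1},\dots,y_n)$.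 $\mathcal{SR}_h(\Omega_D)$ is the set of $f\in\mathcal{S}(\Omega_D)$ such that $f^y_h$ is a one-variable slice regular function for every $y\in\Omega_D$. Writing $x_h=\alpha_h+i\beta_h+j\gamma_h+k\delta_h$ with real components, $\overline{\partial}_{x_h}=\frac{\partial}{\partial\alpha_h}+i\frac{\partial}{\partial\beta_h}+j\frac{\partial}{\partial\gamma_h}+k\frac{\partial}{\partial\delta_h}$ and $\Delta_h=\frac{\partial^2}{\partial\alpha_h^2}+\frac{\partial^2}{\partial\beta_h^2}+\frac{\partial^2}{\partial\gamma_h^2}+\frac{\partial^2}{\partial\delta_h^2}$. $\mathcal{M}_h(\Omega_D)=\{g:\Omega_D\to\mathbb{H}:\overline{\partial}_{x_h}g=0\}$ is the set of monogenic functions with respect to $x_h$, and $\mathcal{AM}_h(\Omega_D)=\mathcal{M}_h(\Omega_D)\cap\mathcal{S}^1(\Omega_D)$ is the set of axially monogenic functions with respect to $x_h$.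
   Formalization: That Δ_h f is in S^1 (hence in AM_h) is claimed only for f in S^1, as it fails otherwise, e.g. x_1^3 c(x_2) with c a step function of Re x_2; for every f in SR_h, Δ_h f is shown to exist, to be slice, to have C^1 slice sections in x_h, and to be monogenic in x_h. *)

(* Defs.v *)
From HB Require Import structures.
From mathcomp Require Import all_boot all_order all_algebra.
From mathcomp Require Import ring.
From mathcomp Require Import all_classical all_reals all_analysis.

Set Implicit Arguments.
Unset Strict Implicit.
Unset Printing Implicit Defensive.

Import Order.TTheory GRing.Theory Num.Theory.
Import numFieldNormedType.Exports.

Local Open Scope classical_set_scope.
Local Open Scope ring_scope.

(* a + b i + c j + d k is the row vector (a, b, c, d), which provides the real
   vector space structure and the topology. *)
Definition quat (R : realType) : Type := 'rV[R]_4.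

HB.instance Definition _ (R : realType) := NormedModule.on (quat R).

Section Quaternions.
Context {R : realType}.
Implicit Types p q r : quat R.

Definition Quat (a b c d : R) : quat R := \row_(m < 4) [:: a; b; c; d]`_m.

Definition re q : R := q 0 (inord 0).
Definition imi q : R := q 0 (inord 1).
Definition imj q : R := q 0 (inord 2).
Definition imk q : R := q 0 (inord 3).

Definition qone : quat R := Quat 1 0 0 0.
Definition qi : quat R := Quat 0 1 0 0.
Definition qj : quat R := Quat 0 0 1 0.
Definition qk : quat R := Quat 0 0 0 1.

Definition qmul p q : quat R :=
  Quat (re p * re q - imi p * imi q - imj p * imj q - imk p * imk q)
       (re p * imi q + imi p * re q + imj p * imk q - imk p * imj q)
       (re p * imj q - imi p * imk q + imj p * re q + imk p * imi q)
       (re p * imk q + imi p * imj q - imj p * imi q + imk p * re q).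

Lemma re_Quat a b c d : re (Quat a b c d) = a.
Proof. by rewrite /re mxE inordK. Qed.

Lemma imi_Quat a b c d : imi (Quat a b c d) = b.
Proof. by rewrite /imi mxE inordK. Qed.

Lemma imj_Quat a b c d : imj (Quat a b c d) = c.
Proof. by rewrite /imj mxE inordK. Qed.

Lemma imk_Quat a b c d : imk (Quat a b c d) = d.
Proof. by rewrite /imk mxE inordK. Qed.

Definition QuatE := (re_Quat, imi_Quat, imj_Quat, imk_Quat).

Lemma quatP p q : re p = re q -> imi p = imi q -> imj p = imj q ->
  imk p = imk q -> p = q.
Proof.
move=> h0 h1 h2 h3; apply/rowP => m; rewrite -(inord_val m).
by case: m => [[|[|[|[|m]]]] hm].
Qed.

Lemma reD p q : re (p + q) = re p + re q. Proof. by rewrite /re mxE. Qed.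
Lemma imiD p q : imi (p + q) = imi p + imi q. Proof. by rewrite /imi mxE. Qed.
Lemma imjD p q : imj (p + q) = imj p + imj q. Proof. by rewrite /imj mxE. Qed.
Lemma imkD p q : imk (p + q) = imk p + imk q. Proof. by rewrite /imk mxE. Qed.

Definition quatDE := (reD, imiD, imjD, imkD).

Lemma qmulA : associative qmul.
Proof. by move=> p q r; apply: quatP; rewrite !QuatE; ring. Qed.

Lemma qmul1 : left_id qone qmul.
Proof. by move=> p; apply: quatP; rewrite !QuatE; ring. Qed.

Lemma qmulq1 : right_id qone qmul.
Proof. by move=> p; apply: quatP; rewrite !QuatE; ring. Qed.

Lemma qmulDl : left_distributive qmul +%R.
Proof. by move=> p q r; apply: quatP; rewrite !quatDE !QuatE !quatDE; ring. Qed.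

Lemma qmulDr : right_distributive qmul +%R.
Proof. by move=> p q r; apply: quatP; rewrite !quatDE !QuatE !quatDE; ring. Qed.

Lemma reZ a p : re (a *: p) = a * re p. Proof. by rewrite /re mxE. Qed.
Lemma imiZ a p : imi (a *: p) = a * imi p. Proof. by rewrite /imi mxE. Qed.
Lemma imjZ a p : imj (a *: p) = a * imj p. Proof. by rewrite /imj mxE. Qed.
Lemma imkZ a p : imk (a *: p) = a * imk p. Proof. by rewrite /imk mxE. Qed.

Definition quatZE := (reZ, imiZ, imjZ, imkZ).

Lemma qscalerAl a p q : a *: qmul p q = qmul (a *: p) q.
Proof. by apply: quatP; rewrite !quatZE !QuatE !quatZE; ring. Qed.

Lemma qscalerAr a p q : a *: qmul p q = qmul p (a *: q).
Proof. by apply: quatP; rewrite !quatZE !QuatE !quatZE; ring. Qed.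

Lemma qone_neq0 : qone != 0.
Proof.
apply/eqP => /(congr1 re); rewrite re_Quat /re mxE.
by apply/eqP; rewrite oner_eq0.
Qed.

End Quaternions.

HB.instance Definition _ (R : realType) :=
  GRing.Zmodule_isNzRing.Build (quat R)
    qmulA qmul1 qmulq1 qmulDl qmulDr qone_neq0.

HB.instance Definition _ (R : realType) :=
  GRing.LSemiModule_isLSemiAlgebra.Build R (quat R) qscalerAl.

HB.instance Definition _ (R : realType) :=
  GRing.LSemiAlgebra_isSemiAlgebra.Build R (quat R) qscalerAr.

Section SliceFunctions.
Context {R : realType}.

Definition imag_unit : set (quat R) := [set q | q * q = - 1].

(* The topologically meaningful case only: being of class C^1 is defined on
   open sets. *)
Definition class_C1 (V : normedModType R) (D : set V) (G : V -> quat R) : Prop :=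
  open D /\
  forall v z, D z -> derivable G z v /\ {for z, continuous ('D_v G)}.

(* In the definitions below a function on a subset of a type T is given by a
   total function on T, whose values outside of the subset are irrelevant. *)

(* One variable; alpha + i beta is represented by the pair (alpha, beta). *)

Definition conj1 (w : R * R) : R * R := (w.1, - w.2).

Definition conj1_invariant (E : set (R * R)) : Prop :=
  forall w, E w <-> E (conj1 w).

Definition qpoint (a b : R) (J : quat R) : quat R := a *: 1 + b *: J.

Definition circ1 (E : set (R * R)) : set (quat R) :=
  [set x | exists w J, [/\ E w, imag_unit J & x = qpoint w.1 w.2 J]].

Definition induces1 (E : set (R * R)) (G1 G2 : R * R -> quat R)
    (g : quat R -> quat R) : Prop :=
  [/\ forall w, E w -> G1 (conj1 w) = G1 w,
      forall w, E w -> G2 (conj1 w) = - G2 w &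
      forall w J, E w -> imag_unit J ->
        g (qpoint w.1 w.2 J) = G1 w + J * G2 w].

Definition slice1_C1 (U : set (quat R)) (g : quat R -> quat R) : Prop :=
  exists E G1 G2,
    [/\ conj1_invariant E, U = circ1 E, induces1 E G1 G2 g,
        class_C1 E G1 & class_C1 E G2].

Definition slice1_regular (U : set (quat R)) (g : quat R -> quat R) : Prop :=
  exists E G1 G2,
    [/\ conj1_invariant E, U = circ1 E, induces1 E G1 G2 g,
        class_C1 E G1 /\ class_C1 E G2 &
        forall w, E w ->
          'D_(1, 0) G1 w = 'D_(0, 1) G2 w /\
          'D_(0, 1) G1 w = - 'D_(1, 0) G2 w].

(* Several variables; (alpha_l + i beta_l)_l in C^n is represented by the pair
   of real vectors (alpha, beta). *)

Section SeveralVariables.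
Context {n : nat}.
Local Notation Cn := ('rV[R]_n * 'rV[R]_n)%type.
Local Notation Hn := ('I_n -> quat R).
Implicit Types (D : set Cn) (z : Cn) (x y : Hn) (h : 'I_n).

Definition conj_at h z : Cn :=
  (z.1, \row_l (if l == h then - z.2 0 l else z.2 0 l)).

Definition conj_invariant D : Prop := forall h z, D z <-> D (conj_at h z).

Definition point z (J : Hn) : Hn := fun l => qpoint (z.1 0 l) (z.2 0 l) (J l).

Definition circ D : set Hn :=
  [set x | exists z J, [/\ D z, forall l, imag_unit (J l) & x = point z J]].

Definition stem D (F : {set 'I_n} -> Cn -> quat R) : Prop :=
  forall K h z, D z -> F K (conj_at h z) = (-1) ^+ #|K :&: [set h]| * F K z.

(* The noncommutative product over K is taken in increasing order of indices. *)
Definition induces D (F : {set 'I_n} -> Cn -> quat R) (f : Hn -> quat R) :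
    Prop :=
  forall z J, D z -> (forall l, imag_unit (J l)) ->
    f (point z J) = \sum_(K : {set 'I_n}) (\prod_(k in K) J k) * F K z.

Definition slice D (f : Hn -> quat R) : Prop :=
  exists F, stem D F /\ induces D F f.

Definition slice_C1 D (f : Hn -> quat R) : Prop :=
  exists F, [/\ stem D F, forall K, class_C1 D (F K) & induces D F f].

Definition put h y (q : quat R) : Hn := [eta y with h |-> q].

Definition section_dom D h y : set (quat R) := [set q | circ D (put h y q)].

Definition section h y (f : Hn -> quat R) : quat R -> quat R :=
  fun q => f (put h y q).

Definition SR D h (f : Hn -> quat R) : Prop :=
  slice D f /\
  forall y, circ D y -> slice1_regular (section_dom D h y) (section h y f).

(* The partial derivatives with respect to the real components of x_h are
   taken along e = 1, qi, qj, qk. *)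
Definition pderivable h (e : quat R) (g : Hn -> quat R) x : Prop :=
  derivable (section h x g) (x h) e.

Definition pderive h (e : quat R) (g : Hn -> quat R) : Hn -> quat R :=
  fun x => 'D_e (section h x g) (x h).

Definition dbar h (g : Hn -> quat R) : Hn -> quat R := fun x =>
  pderive h 1 g x + qi * pderive h qi g x + qj * pderive h qj g x
    + qk * pderive h qk g x.

Definition laplacian h (g : Hn -> quat R) : Hn -> quat R := fun x =>
  pderive h 1 (pderive h 1 g) x + pderive h qi (pderive h qi g) x
    + pderive h qj (pderive h qj g) x + pderive h qk (pderive h qk g) x.

(* [pderive] is total, so the existence of the derivatives is stated apart. *)
Definition has_partials D h (g : Hn -> quat R) : Prop :=
  forall x, circ D x ->
    [/\ pderivable h 1 g x, pderivable h qi g x,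
        pderivable h qj g x & pderivable h qk g x].

Definition has_laplacian D h (g : Hn -> quat R) : Prop :=
  has_partials D h g /\
  forall x, circ D x ->
    [/\ pderivable h 1 (pderive h 1 g) x, pderivable h qi (pderive h qi g) x,
        pderivable h qj (pderive h qj g) x &
        pderivable h qk (pderive h qk g) x].

Definition monogenic D h (g : Hn -> quat R) : Prop :=
  has_partials D h g /\ forall x, circ D x -> dbar h g x = 0.

Definition axially_monogenic D h (g : Hn -> quat R) : Prop :=
  monogenic D h g /\ slice_C1 D g.

End SeveralVariables.
End SliceFunctions.

(* Main.v *)
Require Import Defs.
From mathcomp Require Import all_boot all_order all_algebra.
From mathcomp Require Import ring lra.
From mathcomp Require Import all_classical all_reals all_analysis.

Set Implicit Arguments.
Unset Strict Implicit.
Unset Printing Implicit Defensive.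

Import Order.TTheory GRing.Theory Num.Theory.
Import numFieldNormedType.Exports.

Local Open Scope classical_set_scope.
Local Open Scope ring_scope.

(** Why Fueter's theorem holds in the variable [x_h].

    One variable. Let [g (alpha + J beta) = u + J v], where [u + i v] is
    holomorphic in [w = (alpha, beta)], [u] is even and [v] is odd in [beta].
    Off the real axis [g q = u (polar q) + vec q * (v / beta) (polar q)], and
    the four second derivatives add up to
      [Delta g = 2 (- D_alpha + J D_beta) (v / beta)],
    because [u] and [v] are harmonic in the plane, so that only first order
    terms with a factor [1 / beta] survive. The components of this pair,
    [fueterA] and [fueterB], solve the system [fueter_off], which says that
    the slice function that they induce is annihilated by the
    Cauchy-Riemann-Fueter operator: see [lap1_induces] and [dbar1_lap1].

    Regularity. The pair [(u, v)] is only known to be of class C1, whereas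
    the computation takes three derivatives. Cauchy's formula for the first
    derivative, [mean_value_derive], writes [D_alpha u] as an average of [u]
    and [v] over a circle of fixed radius, and it can be differentiated under
    the integral sign. Hence the derivative of a Cauchy-Riemann pair is a
    Cauchy-Riemann pair, [CR_derive]. The argument takes place in a plane
    inside a space of parameters and yields continuous derivatives in the
    parameters too.

    The real axis. The quotients of [fueterA] and [fueterB] have removable
    singularities at [beta = 0]: as [v] vanishes there, they are averages of
    derivatives of [u] and [v] along the segment that joins the axis to the
    point, [segavg_cos] and [segavg_sincos]. This gives [sphA_C1] and
    [sphB_C1], and the derivatives at the axis. At a real point all
    derivatives of [g] are taken along lines that lie in a plane [R + R J],
    where [g] is given by [u] and [v].

    Several variables. Let [f] be induced by the stem function [F]. The
    section of [f] in [x_h] is regular for every choice of the other units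
    [J_l]; changing the signs of the [J_l] and averaging against the
    characters [chi K] isolates each term [J_K F_K]. It follows that
    [F_(h |: L)] vanishes when [L] has an index smaller than [h]
    ([SR_vanish]), as the units in front of [J_h] do not commute with it, and
    that [(F_L, F_(h |: L))] is a Cauchy-Riemann pair in [z_h]
    ([SR_stem_pair]). So the section is [A + J_h B], where [A] and [B] are
    left linear combinations of such pairs ([stem_sum_split]). The formulas of
    one variable are left linear, and they may be applied to each pair: the
    result [lap_stem] is a stem function of the Laplacian. *)

(** * Integrals with parameters *)

Section Integral.
Context {R : realType}.
Implicit Types (f g F : R -> R) (T : R).

Definition integ T f : R := \int[@lebesgue_measure R]_(t in `[0, T]) f t.

Lemma continuous_integrable T f : continuous f ->
  (@lebesgue_measure R).-integrable `[0, T] (EFin \o f).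
Proof.
move=> cf; apply: continuous_compact_integrable => /=; first exact: segment_compact.
exact: continuous_subspaceT.
Qed.

Lemma integD T f g : continuous f -> continuous g ->
  integ T (fun t => f t + g t) = integ T f + integ T g.
Proof. by move=> cf cg; apply: RintegralD => //; exact: continuous_integrable. Qed.

Lemma integZ T k f : continuous f -> integ T (fun t => k * f t) = k * integ T f.
Proof. by move=> cf; apply: RintegralZl => //; exact: continuous_integrable. Qed.

Lemma integ_cst T k : 0 <= T -> integ T (fun=> k) = k * T.
Proof.
move=> T0; rewrite /integ Rintegral_cst//=.
rewrite lebesgue_measure_itv/= lte_fin.
have [_|T0'] := ltrP 0 T; first by rewrite /= subr0.
by rewrite (le_anti (introT andP (conj T0' T0))).
Qed.

Lemma le_integ_dist T f g e : 0 <= T -> continuous f -> continuous g ->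
  (forall t, 0 <= t <= T -> `|f t - g t| <= e) ->
  `|integ T f - integ T g| <= e * T.
Proof.
move=> T0 cf cg fg.
have cN : continuous (fun t => - g t) by move=> t; apply: continuousN; exact: cg.
have cB : continuous (fun t => f t - g t).
  by move=> t; apply: continuousB; [exact: cf|exact: cg].
have -> : integ T f - integ T g = integ T (fun t => f t - g t).
  by rewrite /integ RintegralB//; exact: continuous_integrable.
rewrite -integ_cst//; apply: le_trans (le_normr_Rintegral _ _) _ => //.
  exact: continuous_integrable.
apply: le_Rintegral => //.
- apply: continuous_integrable => t; apply: (@continuous_comp _ _ _ (fun t => f t - g t) Num.norm); [exact: cB|exact: norm_continuous].
- by apply: continuous_integrable => t; exact: cst_continuous.
Qed.

Lemma integ_FTC T f F : 0 < T -> continuous f ->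
  (forall t : R, is_derive t (1 : R) F (f t)) -> integ T f = F T - F 0.
Proof.
move=> T0 cf dF.
have cF : continuous F.
  move=> t; apply/differentiable_continuous/derivable1_diffP.
  by case: (dF t).
rewrite /integ /Rintegral (@continuous_FTC2 _ f F 0 T)//.
- exact: continuous_subspaceT.
- split.
  + by move=> t _; case: (dF t).
  + by apply: cvg_at_right_filter; exact: cF.
  + by apply: cvg_at_left_filter; exact: cF.
- by move=> t _; rewrite derive1E; case: (dF t).
Qed.

End Integral.

Section Parametric.
Context {R : realType} {V : normedModType R}.
Variable T : R.
Hypothesis T0 : 0 <= T.

(** The tube lemma: continuity at the points of the compact set
    [{z0} x [0, T]] is uniform in [t]. *)
Lemma near_uniform (k : V -> R -> R) (z0 : V) e : 0 < e ->
  (forall t, {for (z0, t), continuous (fun p : V * R => k p.1 p.2)}) ->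
  \forall z \near z0, forall t, 0 <= t <= T -> `|k z t - k z0 t| < e.
Proof.
move=> e0 ck.
have /compact_near_coveringP/(_ V (nbhs z0) (fun z t => `|k z t - k z0 t| < e)) :=
  @segment_compact R 0 T.
have: \forall z \near z0, `[0, T]%classic `<=` (fun t : R => `|k z t - k z0 t| < e) ->
  forall t, 0 <= t <= T -> `|k z t - k z0 t| < e.
  by near=> z => h t tT; apply: h; rewrite /= in_itv.
move=> h1 /(_ _) h2; near=> z.
have : `[0, T]%classic `<=` (fun t : R => `|k z t - k z0 t| < e); last by apply: (near h1 z).
near: z; apply: h2 => t _.
have /cvgrPdist_lt/(_ (e / 2)) := ck t; rewrite divr_gt0// => /(_ isT) ckt.
have [[A B]/= [Az Bt] AB] := ckt.
exists (B, A) => //= -[s z]/= [Bs Az'].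
have h := AB (z, s) (conj Az' Bs).
have h0 := AB (z0, s) (conj (nbhs_singleton Az) Bs).
rewrite /= in h h0.
rewrite -(subrKA (k z0 t)) (splitr e) (le_lt_trans (ler_normD _ _))// ltrD//.
by rewrite distrC.
Unshelve. all: by end_near. Qed.

Lemma integ_continuous (k : V -> R -> R) (z0 : V) :
  (\forall z \near z0, continuous (k z)) ->
  (forall t, {for (z0, t), continuous (fun p : V * R => k p.1 p.2)}) ->
  {for z0, continuous (fun z => integ T (k z))}.
Proof.
move=> ckz ck; apply/cvgrPdist_le => e e0.
have T1 : 0 < T + 1 by rewrite ltr_wpDl.
near=> z; rewrite distrC.
apply: (@le_trans _ _ (e / (T + 1) * T)).
  apply: le_integ_dist => //; first by near: z.
    exact: (nbhs_singleton ckz).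
  move=> t tT; apply: ltW; move: t tT; near: z.
  by apply: near_uniform => //; rewrite divr_gt0.
by rewrite mulrAC ler_pdivrMr// ler_wpM2l ?lerDl// ltW.
Unshelve. all: by end_near. Qed.

End Parametric.

Section Lines.
Context {R : realType} {V W : normedModType R}.
Implicit Types (f : V -> W) (z d : V).

Lemma is_derive_line f z d (t : R) df :
  is_derive (t *: d + z) d f df -> is_derive t (1 : R) (fun s : R => f (s *: d + z)) df.
Proof.
have E : (fun h : R => h^-1 *: (f ((h *: (1 : R) + t) *: d + z) - f (t *: d + z)))
       = (fun h : R => h^-1 *: (f (h *: d + (t *: d + z)) - f (t *: d + z))).
  by apply/funext => h; rewrite [h *: 1]mulr1 scalerDl addrA.
move=> [d1 d2]; split; first by rewrite /derivable E.
by rewrite -d2 /derive E.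
Qed.

Lemma is_derive_of_line f z d df :
  is_derive (0 : R) (1 : R) (fun s : R => f (s *: d + z)) df -> is_derive z d f df.
Proof.
have E : (fun h : R => h^-1 *: (f ((h *: (1 : R) + 0) *: d + z) - f ((0 : R) *: d + z)))
       = (fun h : R => h^-1 *: (f (h *: d + z) - f z)).
  by apply/funext => h; rewrite [h *: 1]mulr1 addr0 scale0r add0r.
move=> [d1 d2]; split; first by rewrite /derivable -E.
by rewrite -d2 /derive -E.
Qed.

End Lines.

Section MVT0.
Context {R : realType}.

(** A form of the mean value theorem that allows increments of either sign. *)
Lemma MVT0 (f df : R -> R) (h : R) :
  (forall s, `|s| <= `|h| -> is_derive s (1 : R) f (df s)) ->
  exists2 s, `|s| <= `|h| & f h - f 0 = df s * h.
Proof.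
move=> D.
have cf s : `|s| <= `|h| -> {for s, continuous f}.
  by move=> /D [ds _]; apply/differentiable_continuous/derivable1_diffP.
have [h0|h0] := leP 0 h.
  have [||s] := @MVT_segment R f df 0 h h0.
  - move=> s; rewrite in_itv/= => /andP[s0 sh]; apply: D.
    by rewrite !ger0_norm// ltW.
  - apply: continuous_in_subspaceT => s; rewrite inE/= in_itv/= => /andP[s0 sh].
    by apply: cf; rewrite !ger0_norm.
  - rewrite in_itv/= => /andP[s0 sh]; rewrite subr0 => ->.
    by exists s => //; rewrite !ger0_norm.
have [||s] := @MVT_segment R f df h 0 (ltW h0).
- move=> s; rewrite in_itv/= => /andP[s0 sh]; apply: D.
  by rewrite !ler0_norm ?lerN2// ltW.
- apply: continuous_in_subspaceT => s; rewrite inE/= in_itv/= => /andP[s0 sh].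
  by apply: cf; rewrite !ler0_norm ?lerN2// ltW.
- rewrite in_itv/= => /andP[s0 sh]; rewrite sub0r => E.
  exists s; last by rewrite -opprB E mulrN opprK.
  by rewrite !ler0_norm ?lerN2// ltW.
Qed.

End MVT0.

Section Parametric.
Context {R : realType} {V : normedModType R}.
Variable T : R.
Hypothesis T0 : 0 <= T.

(** By the mean value theorem the difference quotient of [k] at [t] is a value
    of [k'] at an intermediate point, and by compactness these values tend to
    [k' z0 t] uniformly in [t]. *)
Lemma integ_is_derive (k k' : V -> R -> R) (z0 d : V) :
  (\forall z \near z0, forall t, is_derive z d (k^~ t) (k' z t)) ->
  (\forall z \near z0, continuous (k z)) ->
  (\forall z \near z0, continuous (k' z)) ->
  (forall t, {for (z0, t), continuous (fun p : V * R => k' p.1 p.2)}) ->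
  is_derive z0 d (fun z => integ T (k z)) (integ T (k' z0)).
Proof.
move=> Dk ck ck' cck'.
suff H : (fun h : R => h^-1 *: (integ T (k (h *: d + z0)) - integ T (k z0)))
    @ 0^' --> integ T (k' z0).
  split; first by apply/cvg_ex; exists (integ T (k' z0)).
  exact: cvg_lim H.
apply/cvgrPdist_le => e e0.
have T1 : 0 < T + 1 by rewrite ltr_wpDl.
have e1 : 0 < e / (T + 1) by rewrite divr_gt0.
have [r /= r0 rP] := (nbhs_ballP _ _).1 (filterI Dk (filterI ck (near_uniform T e1 cck'))).
have inr (h : R) : `|h| * (`|d| + 1) < r -> ball z0 r (h *: d + z0).
  move=> hr; rewrite -ball_normE/= opprD addrCA subrr addr0 normrN normrZ.
  by apply: le_lt_trans hr; rewrite ler_wpM2l// lerDl.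
near=> h.
have hn0 : h != 0 by near: h; exact: nbhs_dnbhs_neq.
have hr : `|h| * (`|d| + 1) < r.
  rewrite -ltr_pdivlMr ?ltr_wpDl//.
  by near: h; apply: dnbhs0_lt; rewrite divr_gt0// ltr_wpDl.
have [_ [ckh _]] := rP _ (inr _ hr).
have ck0 := nbhs_singleton ck.
have cN : continuous (fun t => - k z0 t) by move=> t; apply: continuousN; exact: ck0.
have cB : continuous (fun t => k (h *: d + z0) t + - k z0 t).
  by move=> t; exact: (cvgD (ckh t) (cN t)).
have -> : h^-1 *: (integ T (k (h *: d + z0)) - integ T (k z0)) =
    integ T (fun t => h^-1 * (k (h *: d + z0) t + - k z0 t)).
  rewrite integZ// integD//; congr (_ * (_ + _)).
  by rewrite -mulN1r -integZ//; congr integ; apply/funext => t; rewrite mulN1r.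
apply: (@le_trans _ _ (e / (T + 1) * T)); last first.
  by rewrite mulrAC ler_pdivrMr// ler_wpM2l ?lerDl// ltW.
rewrite distrC.
apply: le_integ_dist => //.
- by move=> t; exact: (cvgM (cvg_cst _) (cB t)).
- exact: (nbhs_singleton ck').
move=> t tT.
have bs s : `|s| <= `|h| -> ball z0 r (s *: d + z0).
  by move=> sh; apply: inr; apply: le_lt_trans hr; rewrite ler_wpM2r// addr_ge0.
have [|s sh] := @MVT0 _ (fun s => k (s *: d + z0) t) (fun s => k' (s *: d + z0) t) h.
  move=> s /bs /rP [D _].
  exact: (@is_derive_line _ _ _ (k^~ t)).
rewrite scale0r add0r => ->; rewrite mulrC mulfK//.
by have [_ [_ +]] := rP _ (bs s sh); move=> /(_ _ tT)/ltW.
Unshelve. all: by end_near. Qed.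

End Parametric.

(** * A chain rule along curves in a plane *)

Section PlaneChain.
Context {R : realType} {V : normedModType R}.

(** Directional derivatives give no total differential to compose with.
    Instead, [p] is left first along [b] and then along [a]: each step is a
    mean value theorem, and the intermediate points converge to [p], where the
    two derivatives are continuous. *)
Lemma plane_is_derive (u : V -> R) (p a b : V) (x y : R -> R) (t0 x' y' : R) :
  (\forall z \near p, derivable u z a /\ derivable u z b) ->
  {for p, continuous ('D_a u)} -> {for p, continuous ('D_b u)} ->
  x t0 = 0 -> y t0 = 0 ->
  is_derive t0 (1 : R) x x' -> is_derive t0 (1 : R) y y' ->
  is_derive t0 (1 : R) (fun t : R => u (x t *: a + (y t *: b + p)))
    (x' * 'D_a u p + y' * 'D_b u p).
Proof.
move=> Du cA cB x0 y0 Dx Dy.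
set A := 'D_a u p; set B := 'D_b u p.
pose X (h : R) := h^-1 * x (h + t0).
pose Y (h : R) := h^-1 * y (h + t0).
have quot (z : R -> R) (z' : R) : z t0 = 0 -> is_derive t0 (1 : R) z z' ->
    (fun h : R => h^-1 * z (h + t0)) @ 0^' --> z'.
  move=> z0 [/cvg_ex[l cl] zl].
  rewrite /derive (cvg_lim _ cl)// in zl.
  move: cl; rewrite zl; apply: cvg_trans; apply: near_eq_cvg.
  by near=> h; rewrite z0 subr0 [h *: 1]mulr1.
have cX : X h @[h --> 0^'] --> x' := quot _ _ x0 Dx.
have cY : Y h @[h --> 0^'] --> y' := quot _ _ y0 Dy.
have cxy (z : R -> R) (z' : R) : z t0 = 0 -> is_derive t0 (1 : R) z z' ->
    z (h + t0) @[h --> 0^'] --> (0 : R).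
  move=> z0 Dz.
  suff : z (h + t0) @[h --> 0^'] --> 0 * z' by rewrite mul0r.
  have -> : (fun h : R => z (h + t0)) =
            (fun h : R => h * (if h == 0 then 0 else h^-1 * z (h + t0))).
    apply/funext => h; case: eqVneq => [->|h0]; first by rewrite add0r z0 mul0r.
    by rewrite mulrA mulfV// mul1r.
  apply: cvgM; first exact: nbhs_dnbhs.
  apply: cvg_trans (quot _ _ z0 Dz); apply: near_eq_cvg; near=> h.
  by rewrite ifN//; near: h; exact: nbhs_dnbhs_neq.
suff H : (fun h : R => h^-1 *: (u (x (h *: 1 + t0) *: a + (y (h *: 1 + t0) *: b + p))
     - u (x t0 *: a + (y t0 *: b + p)))) @ 0^' --> x' * A + y' * B.
  split; first by apply/cvg_ex; eexists; exact: H.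
  exact: cvg_lim H.
have E0 : (X h * A + Y h * B) @[h --> 0^'] --> x' * A + y' * B.
  exact: (cvgD (cvgM cX (cvg_cst A)) (cvgM cY (cvg_cst B))).
apply: cvg_sub0 E0.
apply/cvgrPdist_le => e e0.
pose c := `|x'| + `|y'| + 2.
have c0 : 0 < c by rewrite /c ltr_wpDl// addr_ge0.
have ec : 0 < e / c by rewrite divr_gt0.
have NA : \forall z \near p, `|A - 'D_a u z| < e / c.
  exact: (cvgrPdist_lt _ _).1 cA _ ec.
have NB : \forall z \near p, `|B - 'D_b u z| < e / c.
  exact: (cvgrPdist_lt _ _).1 cB _ ec.
have [r /= r0 rP] := (nbhs_ballP _ _).1 (filterI Du (filterI NA NB)).
have inr (s t : R) : `|s| * (`|a| + 1) < r / 2 -> `|t| * (`|b| + 1) < r / 2 ->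
    ball p r (s *: a + (t *: b + p)).
  move=> sr tr; rewrite -ball_normE/= distrC addrA addrK (splitr r).
  apply: le_lt_trans (ler_normD _ _) _; rewrite !normrZ.
  by apply: ltrD; [apply: le_lt_trans sr|apply: le_lt_trans tr]; rewrite ler_wpM2l// lerDl.
near=> h.
have hn0 : h != 0 by near: h; exact: nbhs_dnbhs_neq.
have hx : `|x (h + t0)| * (`|a| + 1) < r / 2.
  rewrite -ltr_pdivlMr ?ltr_wpDl//; near: h.
  apply: (cvgr0_norm_lt _ (cxy _ _ x0 Dx)).
  by rewrite !divr_gt0// ltr_wpDl.
have hy : `|y (h + t0)| * (`|b| + 1) < r / 2.
  rewrite -ltr_pdivlMr ?ltr_wpDl//; near: h.
  apply: (cvgr0_norm_lt _ (cxy _ _ y0 Dy)).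
  by rewrite !divr_gt0// ltr_wpDl.
have hX : `|X h| <= `|x'| + 1.
  rewrite -lerBlDl; apply: le_trans (lerB_dist _ _) _; rewrite distrC.
  by near: h; exact: (cvgrPdist_le _ _).1 cX _ ltr01.
have hY : `|Y h| <= `|y'| + 1.
  rewrite -lerBlDl; apply: le_trans (lerB_dist _ _) _; rewrite distrC.
  by near: h; exact: (cvgrPdist_le _ _).1 cY _ ltr01.
have [s sx Es] : exists2 s, `|s| <= `|x (h + t0)| &
    u (x (h + t0) *: a + (y (h + t0) *: b + p)) - u (y (h + t0) *: b + p)
    = 'D_a u (s *: a + (y (h + t0) *: b + p)) * x (h + t0).
  have [|s sh] := @MVT0 _ (fun s => u (s *: a + (y (h + t0) *: b + p)))
     (fun s => 'D_a u (s *: a + (y (h + t0) *: b + p))) (x (h + t0)).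
    move=> s sh; apply: (@is_derive_line _ _ _ u); apply: derivableP.
    have /rP[[]//] := inr s (y (h + t0)) (le_lt_trans (ler_wpM2r (addr_ge0 (normr_ge0 a) ler01) sh) hx) hy.
  by rewrite scale0r add0r; exists s.
have [t ty Et] : exists2 t, `|t| <= `|y (h + t0)| &
    u (y (h + t0) *: b + p) - u p = 'D_b u (t *: b + p) * y (h + t0).
  have [|t th] := @MVT0 _ (fun t => u (t *: b + p))
     (fun t => 'D_b u (t *: b + p)) (y (h + t0)).
    move=> t th; apply: (@is_derive_line _ _ _ u); apply: derivableP.
    have := inr 0 t _ (le_lt_trans (ler_wpM2r (addr_ge0 (normr_ge0 b) ler01) th) hy).
    by rewrite scale0r add0r normr0 mul0r => /(_ (divr_gt0 r0 (ltr0n _ 2)))/rP[[_ db] _]; exact: db.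
  by rewrite scale0r add0r; exists t.
have /rP[_ [+ _]] := inr s (y (h + t0)) (le_lt_trans (ler_wpM2r (addr_ge0 (normr_ge0 a) ler01) sx) hx) hy.
have := inr 0 t _ (le_lt_trans (ler_wpM2r (addr_ge0 (normr_ge0 b) ler01) ty) hy).
rewrite scale0r add0r normr0 mul0r divr_gt0// => /(_ isT)/rP[_ [_]].
set Bt := 'D_b u _ in Et *; set As := 'D_a u _ in Es * => BBt AAs.
rewrite sub0r normrN.
rewrite -[X in `|X|]/(h^-1 *: (u (x (h *: 1 + t0) *: a + (y (h *: 1 + t0) *: b + p))
  - u (x t0 *: a + (y t0 *: b + p))) - (X h * A + Y h * B)).
rewrite ![h *: 1]mulr1 x0 y0 !scale0r !add0r.
rewrite -(subrKA (u (y (h + t0) *: b + p)) (u (x (h + t0) *: a + _))) Es Et.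
have -> : h^-1 *: (As * x (h + t0) + Bt * y (h + t0)) - (X h * A + Y h * B) =
  - (A - As) * X h - (B - Bt) * Y h.
  by rewrite /X /Y [_ *: _](_ : _ = h^-1 * (As * x (h + t0) + Bt * y (h + t0)))//; ring.
apply: le_trans (ler_normB _ _) _.
rewrite (normrM _ (X h)) (normrM _ (Y h)) normrN.
apply: (@le_trans _ _ (e / c * (`|x'| + 1) + e / c * (`|y'| + 1))).
  apply: lerD; apply: ler_pM => //.
    exact: ltW AAs.
  exact: ltW BBt.
rewrite -mulrDr addrACA -[1 + 1]/(2%R : R) -/c.
by rewrite mulfVK ?gt_eqF.
Unshelve. all: by end_near. Qed.

End PlaneChain.

Lemma scale_real (R : realType) (k x : R) : k *: x = k * x.
Proof. by []. Qed.
Lemma cont_id (U : topologicalType) (x : U) : {for x, continuous (fun y : U => y)}.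
Proof. by move=> A hA; exact: hA. Qed.
Lemma cont_cst (U W : topologicalType) (c : W) (x : U) : {for x, continuous (fun _ : U => c)}.
Proof. exact: (@cst_continuous _ _ c x). Qed.
Lemma cont_fst (U W : topologicalType) (x : U * W) : {for x, continuous (@fst U W)}.
Proof. exact: cvg_fst. Qed.
Lemma cont_snd (U W : topologicalType) (x : U * W) : {for x, continuous (@snd U W)}.
Proof. exact: cvg_snd. Qed.

(** * The mean value formula for Cauchy-Riemann pairs *)

Section CauchyRiemann.
Context {R : realType} {V : normedModType R}.
Implicit Types (D : set V) (u v : V -> R) (a b d z : V).

(** Continuity is a separate condition: in infinite dimension it does not
    follow from the continuity of all directional derivatives. *)
Definition C1 D u : Prop :=
  [/\ open D, forall z, D z -> {for z, continuous u} &
      forall d z, D z -> derivable u z d /\ {for z, continuous ('D_d u)}].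

(** Holomorphy of [u + i v] in the real direction [a] and the imaginary
    direction [b]; the other directions of [V] are parameters. *)
Definition CR a b D u v : Prop :=
  [/\ C1 D u, C1 D v, forall z, D z -> 'D_a u z = 'D_b v z &
      forall z, D z -> 'D_b u z = - 'D_a v z].

Lemma C1_chain D u a b p (x y : R -> R) (t0 x' y' : R) : C1 D u -> D p ->
  x t0 = 0 -> y t0 = 0 ->
  is_derive t0 (1 : R) x x' -> is_derive t0 (1 : R) y y' ->
  is_derive t0 (1 : R) (fun t : R => u (x t *: a + (y t *: b + p)))
    (x' * 'D_a u p + y' * 'D_b u p).
Proof.
move=> [oD cu Du] Dp; apply: plane_is_derive.
- near=> z; have Dz : D z by near: z; exact: open_nbhs_nbhs.
  by split; [exact: (Du a z Dz).1|exact: (Du b z Dz).1].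
- exact: (Du a p Dp).2.
- exact: (Du b p Dp).2.
Unshelve. all: by end_near. Qed.

Lemma near_open D z : open D -> D z -> \forall y \near z, D y.
Proof. by move=> oD Dz; exact: open_nbhs_nbhs. Qed.

Lemma continuous_for_eq (U W : topologicalType) (f g : U -> W) x :
  (\forall y \near x, f y = g y) -> {for x, continuous f} -> {for x, continuous g}.
Proof.
move=> fg cf; rewrite /prop_for /continuous_at -(nbhs_singleton fg).
by apply: cvg_trans cf; exact: near_eq_cvg.
Qed.

Lemma eq_C1 D u v : (forall z, D z -> u z = v z) -> C1 D u -> C1 D v.
Proof.
move=> uv [oD cu Du].
have nuv z : D z -> \forall y \near z, u y = v y.
  by move=> /(near_open oD); apply: filterS => y; exact: uv.
split; [exact: oD| |] => [z Dz|d z Dz].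
  exact: continuous_for_eq (nuv z Dz) (cu z Dz).
have [d1 c1] := Du d z Dz; split; first exact: near_eq_derivable (nuv z Dz) d1.
apply: continuous_for_eq c1.
by near=> y; apply: near_eq_derive; apply: nuv; near: y; exact: near_open.
Unshelve. all: by end_near. Qed.

Lemma C1N D u : C1 D u -> C1 D (fun z => - u z).
Proof.
move=> [oD cu Du]; split; [exact: oD| |] => [z Dz|d z Dz].
  exact: cvgN (cu z Dz).
have [d1 c1] := Du d z Dz; split; first exact: derivableN.
apply: (@continuous_for_eq _ _ (fun z => - 'D_d u z)); last exact: cvgN c1.
near=> y; apply/esym; apply: (deriveN (f := u)).
by apply: (Du d y _).1; near: y; exact: near_open.
Unshelve. all: by end_near. Qed.

(** Multiplication of [u + i v] by [- i]; thus each property of the first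
    component of a pair gives one of the second. *)
Lemma CR_rot a b D u v : CR a b D u v -> CR a b D v (fun z => - u z).
Proof.
move=> [Cu Cv e1 e2]; split; [exact: Cv|exact: C1N| |] => z Dz.
  rewrite (deriveN (f := u)); first by rewrite e2 ?opprK.
  by case: Cu => _ _ /(_ b z Dz)[].
rewrite (deriveN (f := u)); first by rewrite -e1 ?opprK.
by case: Cu => _ _ /(_ a z Dz)[].
Qed.

Definition circle_at a b (r t : R) z : V := (r * cos t) *: a + ((r * sin t) *: b + z).

Lemma circ_continuous (U : topologicalType) a b (r t : U -> R) (z : U -> V) x :
  {for x, continuous r} -> {for x, continuous t} -> {for x, continuous z} ->
  {for x, continuous (fun y => circle_at a b (r y) (t y) (z y))}.
Proof.
move=> cr ct cz; apply: cvgD; last apply: cvgD => //.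
  apply: cvgZr_tmp; apply: cvgM => //.
  by apply: (continuous_comp (g := @cos R)) => //; exact: continuous_cos.
apply: cvgZr_tmp; apply: cvgM => //.
by apply: (continuous_comp (g := @sin R)) => //; exact: continuous_sin.
Qed.

Lemma circ_comp_continuous (U W : topologicalType) a b (w : V -> W)
    (r t : U -> R) (z : U -> V) x :
  {for x, continuous r} -> {for x, continuous t} -> {for x, continuous z} ->
  {for circle_at a b (r x) (t x) (z x), continuous w} ->
  {for x, continuous (fun y => w (circle_at a b (r y) (t y) (z y)))}.
Proof.
move=> cr ct cz cw.
apply: (@continuous_comp _ _ _ (fun y => circle_at a b (r y) (t y) (z y)) w) => //.
exact: circ_continuous.
Qed.

Section Circle.
Variables (a b : V) (D : set V) (u v : V -> R) (z : V) (r0 : R).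
Hypothesis CRuv : CR a b D u v.
Hypothesis Dcirc : forall r t, `|r| < r0 -> D (circle_at a b r t z).

Lemma circ_is_derive_radius (w : V -> R) (r t : R) : C1 D w -> `|r| < r0 ->
  is_derive r (1 : R) (fun s => w (circle_at a b s t z))
    (cos t * 'D_a w (circle_at a b r t z) + sin t * 'D_b w (circle_at a b r t z)).
Proof.
move=> Cw rr.
have -> : (fun s => w (circle_at a b s t z)) = (fun s => w (((s - r) * cos t) *: a
     + (((s - r) * sin t) *: b + circle_at a b r t z))).
  apply/funext => s; congr w; rewrite /circle_at !mulrBl !scalerBl.
  by rewrite [X in _ = _ + X]addrCA !subrKA.
apply: (@C1_chain D w a b _ (fun s => (s - r) * cos t) (fun s => (s - r) * sin t) r _ _ Cw (Dcirc t rr)); rewrite ?subrr ?mul0r//.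
- by apply: is_derive_eq; rewrite scaler0 add0r subr0 [_ *: _]mulr1.
- by apply: is_derive_eq; rewrite scaler0 add0r subr0 [_ *: _]mulr1.
Qed.

Lemma circ_is_derive_angle (w : V -> R) (r t : R) : C1 D w -> `|r| < r0 ->
  is_derive t (1 : R) (fun s => w (circle_at a b r s z))
    (- (r * sin t) * 'D_a w (circle_at a b r t z)
     + (r * cos t) * 'D_b w (circle_at a b r t z)).
Proof.
move=> Cw rr.
have -> : (fun s => w (circle_at a b r s z)) = (fun s => w ((r * (cos s - cos t)) *: a
     + ((r * (sin s - sin t)) *: b + circle_at a b r t z))).
  apply/funext => s; congr w; rewrite /circle_at !mulrBr !scalerBl.
  by rewrite [X in _ = _ + X]addrCA !subrKA.
apply: (@C1_chain D w a b _ (fun s => r * (cos s - cos t)) (fun s => r * (sin s - sin t)) t _ _ Cw (Dcirc t rr)); rewrite ?subrr ?mulr0//.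
- by apply: is_derive_eq; rewrite subr0 [_ *: _]mulrN.
- by apply: is_derive_eq; rewrite subr0.
Qed.

(* With [G = u + i v], these are the integrals over the circle of radius [r]
   of the real parts of [G e^(- i t)] and of the complex derivative of [G]. *)
Let N (r : R) := integ (pi *+ 2) (fun t =>
  u (circle_at a b r t z) * cos t + v (circle_at a b r t z) * sin t).
Let P (r : R) := integ (pi *+ 2) (fun t => 'D_a u (circle_at a b r t z)).

Lemma pi2_gt0 : 0 < pi *+ 2 :> R.
Proof. by rewrite pmulrn_lgt0// pi_gt0. Qed.

Lemma circ_path_continuous (w : V -> R) (r t : R) :
  {for circle_at a b r t z, continuous w} -> {for t, continuous (fun t => w (circle_at a b r t z))}.
Proof.
move=> cw; apply: (@circ_comp_continuous _ _ a b w (fun=> r) id (fun=> z) t) => //.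
- exact: cont_cst.
- exact: cont_cst.
Qed.

Lemma circ_integrand_continuous (w1 w2 : V -> R) (r : R) :
  (forall z, D z -> {for z, continuous w1}) -> (forall z, D z -> {for z, continuous w2}) ->
  `|r| < r0 ->
  continuous (fun t => w1 (circle_at a b r t z) * cos t + w2 (circle_at a b r t z) * sin t).
Proof.
move=> c1 c2 rr t; apply: cvgD; apply: cvgM.
- by apply: circ_path_continuous; exact: c1 (Dcirc _ _).
- exact: continuous_cos.
- by apply: circ_path_continuous; exact: c2 (Dcirc _ _).
- exact: continuous_sin.
Qed.

Lemma near_radius (r : R) : `|r| < r0 -> \forall s \near r, `|s| < r0.
Proof.
move=> rr; have /cvgr_lt := @norm_continuous _ _ r.
exact.
Qed.

Lemma circ_P_continuous (r : R) : `|r| < r0 -> {for r, continuous P}.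
Proof.
have [[oD cu Du] _ _ _] := CRuv.
move=> rr; apply: (@integ_continuous _ _ _ (ltW pi2_gt0) (fun r t => 'D_a u (circle_at a b r t z))).
- near=> s => t; apply: (@circ_path_continuous ('D_a u)); apply: (Du a _ _).2.
  by apply: Dcirc; near: s; exact: near_radius.
- move=> t; apply: (@circ_comp_continuous _ _ a b ('D_a u) fst snd (fun=> z)).
  + exact: cont_fst.
  + exact: cont_snd.
  + exact: cont_cst.
  + by apply: (Du a _ _).2; exact: Dcirc.
Unshelve. all: by end_near. Qed.

(** Along a radius, [G e^(- i t)] has the derivative [G'], where
    [G = u + i v]. *)
Lemma circ_N_derive (r : R) : `|r| < r0 -> is_derive r (1 : R) N (P r).
Proof.
have [[oD cu Du] [_ cv Dv] e1 e2] := CRuv.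
move=> rr; apply: (@integ_is_derive _ _ _ (ltW pi2_gt0) (fun r t =>
   u (circle_at a b r t z) * cos t + v (circle_at a b r t z) * sin t)
   (fun r t => 'D_a u (circle_at a b r t z))).
- near=> s => t; have ss : `|s| < r0 by near: s; exact: near_radius.
  have [Cu Cv _ _] := CRuv.
  have Hu := circ_is_derive_radius t Cu ss.
  have Hv := circ_is_derive_radius t Cv ss.
  apply: is_derive_eq.
  have Ds := Dcirc t ss.
  rewrite !scale_real (e2 _ Ds) -(e1 _ Ds).
  rewrite -[RHS]mul1r -(cos2Dsin2 t); ring.
- near=> s; apply: circ_integrand_continuous => //.
  by near: s; exact: near_radius.
- near=> s => t; apply: (@circ_path_continuous ('D_a u)); apply: (Du a _ _).2.
  by apply: Dcirc; near: s; exact: near_radius.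
- move=> t; apply: (@circ_comp_continuous _ _ a b ('D_a u) fst snd (fun=> z)).
  + exact: cont_fst.
  + exact: cont_snd.
  + exact: cont_cst.
  + by apply: (Du a _ _).2; exact: Dcirc.
Unshelve. all: by end_near. Qed.

(** The integrands of [N r] and [r * P r] differ by the angular derivative of
    the periodic function [- Im (G e^(- i t))], where [G = u + i v]. *)
Lemma circ_N_eq (r : R) : `|r| < r0 -> N r = r * P r.
Proof.
have [[oD cu Du] [_ cv Dv] e1 e2] := CRuv.
have [Cu Cv _ _] := CRuv.
move=> rr.
pose Q t := u (circle_at a b r t z) * sin t - v (circle_at a b r t z) * cos t.
have cP : continuous (fun t => 'D_a u (circle_at a b r t z)).
  by move=> t; apply: (@circ_path_continuous ('D_a u)); apply: (Du a _ _).2; exact: Dcirc.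
have cN := circ_integrand_continuous cu cv rr.
have cP' : continuous (fun t => - r * 'D_a u (circle_at a b r t z)).
  by move=> t; apply: cvgM; [exact: cvg_cst|exact: cP].
have : integ (pi *+ 2) (fun t => u (circle_at a b r t z) * cos t + v (circle_at a b r t z) * sin t
    + - r * 'D_a u (circle_at a b r t z)) = Q (pi *+ 2) - Q 0.
  apply: integ_FTC.
  - exact: pi2_gt0.
  - by move=> t; apply: cvgD; [exact: cN|exact: cP'].
  move=> t.
  have Hu := circ_is_derive_angle t Cu rr.
  have Hv := circ_is_derive_angle t Cv rr.
  apply: is_derive_eq.
  have Ds := Dcirc t rr.
  rewrite !scale_real (e2 _ Ds) -(e1 _ Ds).
  rewrite -[X in _ = _ + X]mul1r -(cos2Dsin2 t); ring.
rewrite integD// integZ// -/(N r) -/(P r) /Q cos2pi sin2pi cos0 sin0 /circle_at.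
rewrite cos2pi sin2pi cos0 sin0 subrr => /eqP.
by rewrite addr_eq0 mulNr opprK => /eqP.
Qed.

(** Since [N' = P] and [N r = r * P r], the quotient [N r / r = P r] is
    constant, and its limit at [0] is the value of [D_a u] at the center times
    [2 pi]. *)
Lemma mean_value_derive (r : R) : 0 < r < r0 ->
  integ (pi *+ 2) (fun t => u (circle_at a b r t z) * cos t + v (circle_at a b r t z) * sin t)
  = r * (pi *+ 2) * 'D_a u z.
Proof.
move=> /andP[r_gt0 rr].
have ltr_norm s : 0 < s <= r -> `|s| < r0.
  by move=> /andP[s0 sr]; rewrite gtr0_norm//; exact: le_lt_trans rr.
have P0 : P 0 = 'D_a u z * (pi *+ 2).
  rewrite -(integ_cst _ (ltW pi2_gt0)) /P; congr integ; apply/funext => t.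
  by rewrite /circle_at !mul0r !scale0r !add0r.
have r00 : `|0 : R| < r0 by rewrite normr0 (lt_trans r_gt0 rr).
have nr : `|r| < r0 by apply: ltr_norm; rewrite r_gt0 lexx.
suff Pr : P 0 = P r.
  by rewrite -/(N r) (circ_N_eq nr) -Pr P0 mulrA mulrAC.
have Pconst s : 0 < s < r -> P s = P r.
  move=> /andP[s0 sr].
  have dP x : 0 < x <= r -> is_derive x (1 : R) (fun x => x^-1 * N x) 0.
    move=> /andP[x0 xr].
    have HN : is_derive x (1 : R) N (P x) by apply: circ_N_derive; rewrite ltr_norm// x0.
    have xn0 : x != 0 by rewrite gt_eqF.
    have HV : is_derive x (1 : R) (fun x : R => x^-1) (- x ^- 2).
      split; first exact: derivableV.
      by rewrite (deriveV (f := id))// derive_id [_ *: _]mulr1.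
    apply: is_derive_eq.
    have nx : `|x| < r0 by apply: ltr_norm; rewrite x0 xr.
    rewrite !scale_real (circ_N_eq nx).
    by field.
  have [x|x xsr|c _] := @MVT R (fun x => x^-1 * N x) (fun=> 0) s r sr.
  - rewrite in_itv/= => /andP[sx xr]; apply: dP.
    by rewrite (lt_trans s0 sx) ltW.
  - move: x xsr; apply: continuous_in_subspaceT => x; rewrite inE/= in_itv/= => /andP[sx xr].
    have [|d _] := dP x; first by rewrite (lt_le_trans s0 sx).
    exact/differentiable_continuous/derivable1_diffP.
  rewrite mul0r => /eqP; rewrite subr_eq0 => /eqP.
  have ns : `|s| < r0 by apply: ltr_norm; rewrite s0 ltW.
  rewrite (circ_N_eq nr) (circ_N_eq ns) !mulKf.
  - by move=> ->.
  - by rewrite gt_eqF.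
  - by rewrite gt_eqF.
have cvP : P s @[s --> 0^'+] --> P 0.
  by apply: cvg_at_right_filter; exact: circ_P_continuous.
have cvP2 : P s @[s --> 0^'+] --> P r.
  apply: cvg_near_cst; near=> s; apply: Pconst.
  by apply/andP; split; near: s; [exact: nbhs_right_gt|exact: nbhs_right_lt].
exact: (cvg_unique _ cvP cvP2).
Unshelve. all: by end_near. Qed.

End Circle.

End CauchyRiemann.

(** * Derivatives of Cauchy-Riemann pairs *)

Section CauchyRiemannLift.
Context {R : realType} {V : normedModType R}.
Implicit Types (D : set V) (u v : V -> R) (a b d z : V).

Lemma is_derive_translate (w : V -> R) (c z d : V) dw :
  is_derive (c + z) d w dw -> is_derive z d (fun y => w (c + y)) dw.
Proof.
have E : (fun h : R => h^-1 *: (w (c + (h *: d + z)) - w (c + z)))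
       = (fun h : R => h^-1 *: (w (h *: d + (c + z)) - w (c + z))).
  by apply/funext => h; rewrite addrCA.
move=> [d1 d2]; split; first by rewrite /derivable E.
by rewrite -d2 /derive E.
Qed.

Lemma circ_is_derive_center (w : V -> R) a b r t z d : derivable w (circle_at a b r t z) d ->
  is_derive z d (fun y => w (circle_at a b r t y)) ('D_d w (circle_at a b r t z)).
Proof.
move=> dw; rewrite /circle_at.
have -> : (fun y => w ((r * cos t) *: a + ((r * sin t) *: b + y))) =
  (fun y => w (((r * cos t) *: a + (r * sin t) *: b) + y)).
  by apply/funext => y; rewrite addrA.
rewrite [X in 'D_d w X]addrA; apply: is_derive_translate; apply: derivableP.
by rewrite -addrA.
Qed.

Lemma circ_nbhs D a b z0 : open D -> D z0 ->
  exists2 r0 : R, 0 < r0 & \forall z \near z0, forall r t, `|r| < r0 -> D (circle_at a b r t z).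
Proof.
move=> oD Dz0.
have [e /= e0 eD] := (nbhs_ballP _ _).1 (near_open oD Dz0).
have c0 : 0 < `|a| + `|b| + 1 by rewrite ltr_wpDl// addr_ge0.
exists (e / 2 / (`|a| + `|b| + 1)); first by rewrite !divr_gt0.
near=> z => r t; rewrite ltr_pdivlMr// => rr.
apply: eD; rewrite -ball_normE/= distrC /circle_at.
have -> : (r * cos t) *: a + ((r * sin t) *: b + z) - z0 =
    ((r * cos t) *: a + (r * sin t) *: b) + (z - z0) by rewrite !addrA.
rewrite (splitr e); apply: le_lt_trans (ler_normD _ _) _.
apply: ltrD; last first.
  rewrite distrC; near: z.
  have : \forall y \near z0, ball z0 (e / 2) y by apply: nbhsx_ballx; rewrite divr_gt0.
  by apply: filterS => y; rewrite -ball_normE.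
apply: le_lt_trans (ler_normD _ _) _; apply: le_lt_trans rr.
rewrite !normrZ -addrA !mulrDr; apply: lerD.
  by rewrite ler_wpM2r// ler_piMr// ler_norml cos_geN1 cos_le1.
apply: ler_wpDr; first by rewrite mulr1.
by rewrite ler_wpM2r// ler_piMr// ler_norml sin_geN1 sin_le1.
Unshelve. all: by end_near. Qed.

Section Local.
Variables (a b : V) (D : set V) (z0 : V) (r0 r : R).
Hypothesis Dcirc : \forall z \near z0, forall s t, `|s| < r0 -> D (circle_at a b s t z).
Hypothesis normr_lt : `|r| < r0.

Definition circ_avg (w1 w2 : V -> R) z := integ (pi *+ 2) (fun t =>
   w1 (circle_at a b r t z) * cos t + w2 (circle_at a b r t z) * sin t).

Lemma circ_avg_joint (w : V -> R) (f : R -> R) t : continuous f -> (forall z, D z -> {for z, continuous w}) ->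
  {for (z0, t), continuous (fun p : V * R => w (circle_at a b r p.2 p.1) * f p.2)}.
Proof.
move=> cf cw; apply: cvgM; last first.
  by apply: (@continuous_comp _ _ _ snd f); [exact: cont_snd|exact: cf].
apply: (@circ_comp_continuous _ _ _ _ a b w (fun=> r) snd fst).
- exact: cont_cst.
- exact: cont_snd.
- exact: cont_fst.
- apply: cw; exact: (nbhs_singleton Dcirc _ t normr_lt).
Qed.

Lemma circ_avg_continuous w1 w2 :
  (forall z, D z -> {for z, continuous w1}) -> (forall z, D z -> {for z, continuous w2}) ->
  {for z0, continuous (circ_avg w1 w2)}.
Proof.
move=> c1 c2.
apply: (@integ_continuous _ _ _ (ltW pi2_gt0) (fun z t =>
   w1 (circle_at a b r t z) * cos t + w2 (circle_at a b r t z) * sin t)).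
- apply: filterS Dcirc => z Dz.
  exact: (@circ_integrand_continuous _ _ a b D z r0 Dz w1 w2 r c1 c2 normr_lt).
- move=> t; apply: cvgD.
    by apply: circ_avg_joint c1; exact: continuous_cos.
  by apply: circ_avg_joint c2; exact: continuous_sin.
Qed.

Lemma circ_avg_derive w1 w2 d : C1 D w1 -> C1 D w2 ->
  is_derive z0 d (circ_avg w1 w2) (circ_avg ('D_d w1) ('D_d w2) z0).
Proof.
move=> [_ c1 d1] [_ c2 d2].
have c1' z : D z -> {for z, continuous ('D_d w1)} by move=> Dz; exact: (d1 d z Dz).2.
have c2' z : D z -> {for z, continuous ('D_d w2)} by move=> Dz; exact: (d2 d z Dz).2.
apply: (@integ_is_derive _ _ _ (ltW pi2_gt0) (fun z t =>
   w1 (circle_at a b r t z) * cos t + w2 (circle_at a b r t z) * sin t) (fun z t =>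
   'D_d w1 (circle_at a b r t z) * cos t + 'D_d w2 (circle_at a b r t z) * sin t)).
- apply: filterS Dcirc => z Dz t.
  have H1 := circ_is_derive_center (d1 d _ (Dz _ t normr_lt)).1.
  have H2 := circ_is_derive_center (d2 d _ (Dz _ t normr_lt)).1.
  apply: is_derive_eq.
  by rewrite !scale_real; ring.
- apply: filterS Dcirc => z Dz.
  exact: (@circ_integrand_continuous _ _ a b D z r0 Dz w1 w2 r c1 c2 normr_lt).
- apply: filterS Dcirc => z Dz.
  exact: (@circ_integrand_continuous _ _ a b D z r0 Dz _ _ r c1' c2' normr_lt).
- move=> t; apply: cvgD.
    by apply: circ_avg_joint c1'; exact: continuous_cos.
  by apply: circ_avg_joint c2'; exact: continuous_sin.
Qed.

End Local.

(** Near [z0] the mean value formula holds with the same radius at all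
    centers, and then the center can be moved in any direction [d] under the
    integral sign. *)
Lemma CR_derive_at a b D z0 : open D -> D z0 ->
  exists c r : R, (forall t, D (circle_at a b r t z0)) /\ forall u v, CR a b D u v -> forall d,
    (\forall z \near z0, is_derive z d ('D_a u) (c * circ_avg a b r ('D_d u) ('D_d v) z)) /\
    {for z0, continuous (fun z => c * circ_avg a b r ('D_d u) ('D_d v) z)}.
Proof.
move=> oD Dz0.
have [r0 r0_gt0 Dcirc] := circ_nbhs a b oD Dz0.
pose r := r0 / 2.
have r_gt0 : 0 < r by rewrite divr_gt0.
have rr0 : r < r0 by rewrite gtr_pMr// invf_lt1// ltr1n.
have nr : `|r| < r0 by rewrite gtr0_norm.
have cn0 : r * (pi *+ 2) != 0 by rewrite mulf_neq0// gt_eqF//; exact: pi2_gt0.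
exists (r * (pi *+ 2))^-1, r; split.
  by move=> t; exact: (nbhs_singleton Dcirc _ t nr).
move=> u v CRuv d.
have [Cu Cv e1 e2] := CRuv.
have [_ cu du] := Cu; have [_ cv dv] := Cv.
have Eu : \forall z \near z0, (r * (pi *+ 2))^-1 * circ_avg a b r u v z = 'D_a u z.
  apply: filterS Dcirc => z Dz.
  rewrite /circ_avg (@mean_value_derive _ _ a b D u v z r0 CRuv Dz r).
    by rewrite mulKf.
  by rewrite r_gt0.
split.
  have NE := near_join Eu; have ND := near_join Dcirc.
  apply: filterS2 NE ND => z NE ND.
  apply: near_eq_is_derive NE _.
  have H := @circ_avg_derive a b D z r0 r ND nr u v d Cu Cv.
  by apply: is_deriveZ.
apply: cvgM; first exact: cont_cst.
apply: (@circ_avg_continuous a b D z0 r0 r Dcirc nr).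
  by move=> y Dy; exact: (du d y Dy).2.
by move=> y Dy; exact: (dv d y Dy).2.
Qed.

Lemma CR_C1_derive a b D u v : CR a b D u v -> C1 D ('D_a u).
Proof.
move=> CRuv; have [[oD cu du] _ _ _] := CRuv.
split; [exact: oD| |] => [z Dz|d z Dz]; first exact: (du a z Dz).2.
have [c [r [_ H]]] := CR_derive_at a b oD Dz.
have [dz cz] := H _ _ CRuv d.
split; first by case: (nbhs_singleton dz).
apply: continuous_for_eq cz.
by apply: filterS dz => y [_ ->].
Qed.

(** No exchange of second derivatives is involved: both sides are averages
    over the same circle, and the integrands agree by the Cauchy-Riemann
    equations. *)
Lemma CR_derive_eq a b D u v z : CR a b D u v -> D z ->
  'D_a ('D_a u) z = 'D_b ('D_a v) z.
Proof.
move=> CRuv Dz; have [[oD cu du] [_ cv dv] e1 e2] := CRuv.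
have [c [r [Dt H]]] := CR_derive_at a b oD Dz.
have [_ ->] := nbhs_singleton (H _ _ CRuv a).1.
have [_ ->] := nbhs_singleton (H _ _ (CR_rot CRuv) b).1.
congr (_ * integ _ _); apply/funext => t.
rewrite (deriveN (f := u)); last exact: (du b _ (Dt t)).1.
by rewrite (e1 _ (Dt t)) (e2 _ (Dt t)) opprK.
Qed.

(** As [D_a u + i D_a v] is the complex derivative of [u + i v], this iterates:
    [u] and [v] have derivatives of all orders along [a], each of class C1 in
    all directions of [V]. *)
Lemma CR_derive a b D u v : CR a b D u v -> CR a b D ('D_a u) ('D_a v).
Proof.
move=> CRuv; have [[oD cu du] [_ cv dv] e1 e2] := CRuv.
split.
- exact: CR_C1_derive CRuv.
- exact: CR_C1_derive (CR_rot CRuv).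
- by move=> z Dz; exact: CR_derive_eq CRuv Dz.
- move=> z Dz; rewrite (CR_derive_eq (CR_rot CRuv) Dz).
  have E : \forall y \near z, 'D_a (fun x => - u x) y = - 'D_a u y.
    apply: filterS (near_open oD Dz) => y Dy.
    by apply: (deriveN (f := u)); exact: (du a y Dy).1.
  rewrite (near_eq_derive _ E) (deriveN (f := 'D_a u)) ?opprK//.
  by have [_ _ /(_ b z Dz)[]] := CR_C1_derive CRuv.
Qed.

End CauchyRiemannLift.

(** * Functions of class C1 *)

Section C1Theory.
Context {R : realType} {V : normedModType R}.
Implicit Types (D : set V) (u v : V -> R) (a b d z : V).

Lemma C1_local D u : (forall z, D z -> exists2 D' : set V, D' z & C1 D' u) ->
  open D -> C1 D u.
Proof.
move=> H oD; split; first exact: oD.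
  by move=> z /H[D' D'z [_ c _]]; exact: c.
by move=> d z /H[D' D'z [_ _ c]]; exact: c.
Qed.

Lemma C1_sub D D' u : open D' -> D' `<=` D -> C1 D u -> C1 D' u.
Proof.
move=> oD' s [_ c d]; split; [exact: oD'| |] => [z /s|e z /s]; [exact: c|exact: d].
Qed.

Lemma C1_is_derive D u d z : C1 D u -> D z -> is_derive z d u ('D_d u z).
Proof. by move=> [_ _ H] Dz; apply: derivableP; exact: (H d z Dz).1. Qed.

Lemma C1_build D u (du : V -> V -> R) : open D ->
  (forall z, D z -> {for z, continuous u}) ->
  (forall d z, D z -> is_derive z d u (du d z)) ->
  (forall d z, D z -> {for z, continuous (du d)}) -> C1 D u.
Proof.
move=> oD cu dd cd; split; [exact: oD|exact: cu|] => d z Dz.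
split; first by case: (dd d z Dz).
apply: continuous_for_eq (cd d z Dz).
by apply: filterS (near_open oD Dz) => y Dy; case: (dd d y Dy).
Qed.

Lemma C1M D u v : C1 D u -> C1 D v -> C1 D (fun z => u z * v z).
Proof.
move=> Cu Cv; have [oD cu du] := Cu; have [_ cv dv] := Cv.
apply: (@C1_build D _ (fun d z => u z * 'D_d v z + v z * 'D_d u z) oD).
- by move=> z Dz; exact: (cvgM (cu z Dz) (cv z Dz)).
- move=> d z Dz.
  have Hu := C1_is_derive d Cu Dz; have Hv := C1_is_derive d Cv Dz.
  by apply: is_derive_eq; rewrite !scale_real.
- move=> d z Dz; have [_ c1] := du d z Dz; have [_ c2] := dv d z Dz.
  exact: (cvgD (cvgM (cu z Dz) c2) (cvgM (cv z Dz) c1)).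
Qed.

Lemma C1D D u v : C1 D u -> C1 D v -> C1 D (fun z => u z + v z).
Proof.
move=> Cu Cv; have [oD cu du] := Cu; have [_ cv dv] := Cv.
apply: (@C1_build D _ (fun d z => 'D_d u z + 'D_d v z) oD).
- by move=> z Dz; exact: (cvgD (cu z Dz) (cv z Dz)).
- move=> d z Dz.
  have Hu := C1_is_derive d Cu Dz; have Hv := C1_is_derive d Cv Dz.
  exact: is_derive_eq.
- move=> d z Dz; have [_ c1] := du d z Dz; have [_ c2] := dv d z Dz.
  exact: (cvgD c1 c2).
Qed.

End C1Theory.

(** * Averages over segments from the axis *)

(** The linear form [l] is the height above the axis [l = 0]; among the real
    and imaginary directions, [a] is horizontal and [b] is vertical. *)
Section Height.
Context {R : realType} {V : normedModType R}.
Variables (l : V -> R) (a b : V).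
Hypothesis lD : forall (s : R) d z, l (s *: d + z) = s * l d + l z.
Hypothesis cl : continuous l.
Hypothesis la : l a = 0.
Hypothesis lb : l b = 1.
Implicit Types (D : set V) (u v w : V -> R) (d z : V).

Lemma l_is_derive z d : is_derive z d l (l d).
Proof.
apply: is_derive_of_line.
have -> : (fun s : R => l (s *: d + z)) = (fun s : R => s * l d + l z).
  by apply/funext => s; rewrite lD.
by apply: is_derive_eq; rewrite scaler0 add0r addr0 scale_real mulr1.
Qed.

Lemma off_axis_open D : open D -> open (D `&` [set z | l z != 0]).
Proof.
move=> oD; apply: openI => //.
by apply: (open_comp (f := l) (D := [set x | x != 0])) => [z _|]; [exact: cl|exact: open_neq].
Qed.

(** The vertical segment from the axis to [z], at the height [sin t * l z] for
    [t] between [0] and [pi / 2]. The sine is bounded on the whole line, which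
    lets [t] be any real number in what follows. *)
Definition seg (t : R) z : V := ((sin t - 1) * l z) *: b + z.

Lemma l_seg t z : l (seg t z) = sin t * l z.
Proof. by rewrite /seg lD lb mulr1 mulrBl mul1r subrK. Qed.

Definition seg_dom D : set V := interior [set z | forall t, D (seg t z)].

Lemma seg_dom_open D : open (seg_dom D).
Proof. exact: open_interior. Qed.

Lemma seg_domP D z t : seg_dom D z -> D (seg t z).
Proof. by move=> /interior_subset; apply. Qed.

Lemma seg_axis t z : l z = 0 -> seg t z = z.
Proof. by move=> lz; rewrite /seg lz mulr0 scale0r add0r. Qed.

Lemma seg_dom_axis D z : open D -> D z -> l z = 0 -> seg_dom D z.
Proof.
move=> oD Dz lz; rewrite /seg_dom /interior /=.
have [e /= e0 eD] := (nbhs_ballP _ _).1 (near_open oD Dz).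
have b0 : 0 < `|b| + 1 by rewrite ltr_wpDl.
near=> y => t; apply: eD; rewrite -ball_normE/= distrC /seg -addrA.
rewrite (splitr e); apply: le_lt_trans (ler_normD _ _) _.
apply: ltrD; last first.
  rewrite distrC; near: y.
  have : \forall y \near z, ball z (e / 2) y by apply: nbhsx_ballx; rewrite divr_gt0.
  by apply: filterS => y; rewrite -ball_normE.
have ly : `|l y| < e / 4 / (`|b| + 1).
  near: y.
  have cz : l y @[y --> z] --> l z by exact: cl.
  have e4 : 0 < e / 4 / (`|b| + 1) by rewrite !divr_gt0.
  apply: filterS ((cvgrPdist_lt _ _).1 cz _ e4) => y.
  by rewrite lz sub0r normrN.
rewrite normrZ normrM.
have s2 : `|sin t - 1| <= 2.
  by rewrite distrC ger0_norm ?subr_ge0 ?sin_le1// lerBlDr -lerBlDl (le_trans _ (sin_geN1 t))//; lra.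
rewrite ltr_pdivlMr// in ly.
apply: (@le_lt_trans _ _ (2 * (`|l y| * (`|b| + 1)))).
  rewrite -mulrA; apply: ler_pM; [exact: normr_ge0|exact: mulr_ge0|exact: s2|].
  by rewrite ler_wpM2l// lerDl.
by rewrite (_ : e / 2 = 2 * (e / 4)) ?ltr_pM2l//; field.
Unshelve. all: by end_near. Qed.

Definition segavg (om : R -> R) w z := integ (pi / 2) (fun t => w (seg t z) * om t).

Lemma pihalf_gt0 : 0 < pi / 2 :> R.
Proof. by rewrite divr_gt0// pi_gt0. Qed.

Section SegAvg.
Variable D : set V.

Lemma seg_comp_continuous (U W : topologicalType) (w : V -> W) (t : U -> R) (z : U -> V) x :
  {for x, continuous t} -> {for x, continuous z} ->
  {for seg (t x) (z x), continuous w} ->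
  {for x, continuous (fun y => w (seg (t y) (z y)))}.
Proof.
move=> ct cz cw.
apply: (@continuous_comp _ _ _ (fun y => seg (t y) (z y)) w); last exact: cw.
apply: cvgD; last exact: cz.
apply: cvgZr_tmp; apply: cvgM.
  apply: cvgB; last exact: cvg_cst.
  by apply: (@continuous_comp _ _ _ t sin); [exact: ct|exact: continuous_sin].
by apply: (@continuous_comp _ _ _ z l); [exact: cz|exact: cl].
Qed.

(** [seg t] is affine, and its linear part sends [d] to
    [d + ((sin t - 1) * l d) *: b]. *)
Lemma seg_is_derive w t z d : C1 D w -> D (seg t z) ->
  is_derive z d (fun z => w (seg t z)) ('D_d w (seg t z) + (sin t - 1) * l d * 'D_b w (seg t z)).
Proof.
move=> Cw Dt; apply: is_derive_of_line.
have -> : (fun s : R => w (seg t (s *: d + z))) =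
   (fun s : R => w (s *: d + ((s * ((sin t - 1) * l d)) *: b + seg t z))).
  apply/funext => s; congr w; rewrite /seg lD mulrDr scalerDl.
  rewrite [RHS]addrCA -!addrA; congr (_ *: _ + _); last by rewrite addrCA.
  by rewrite mulrCA.
have := @C1_chain _ _ D w d b (seg t z) id (fun s => s * ((sin t - 1) * l d)) 0 1 ((sin t - 1) * l d) Cw Dt erefl (mul0r _).
rewrite mul1r; apply.
by apply: is_derive_eq; rewrite scaler0 add0r scale_real mulr1.
Qed.

Lemma segavg_integrand_continuous om w z : continuous om -> (forall z, D z -> {for z, continuous w}) ->
  seg_dom D z -> continuous (fun t => w (seg t z) * om t).
Proof.
move=> co cw Dz t; apply: cvgM; last exact: co.
apply: (@seg_comp_continuous _ _ w id (fun=> z)).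
- exact: cont_id.
- exact: cont_cst.
- by apply: cw; exact: seg_domP.
Qed.

Lemma segavg_joint om w z t : continuous om -> (forall z, D z -> {for z, continuous w}) ->
  seg_dom D z -> {for (z, t), continuous (fun p : V * R => w (seg p.2 p.1) * om p.2)}.
Proof.
move=> co cw Dz; apply: cvgM; last first.
  by apply: (@continuous_comp _ _ _ snd om); [exact: cont_snd|exact: co].
apply: (@seg_comp_continuous _ _ w snd fst).
- exact: cont_snd.
- exact: cont_fst.
- by apply: cw; exact: seg_domP.
Qed.

Lemma segavg_continuous om w z : continuous om -> (forall z, D z -> {for z, continuous w}) ->
  seg_dom D z -> {for z, continuous (segavg om w)}.
Proof.
move=> co cw Dz.
apply: (@integ_continuous _ _ _ (ltW pihalf_gt0) (fun z t => w (seg t z) * om t)).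
- apply: filterS (near_open (@seg_dom_open D) Dz) => y.
  exact: segavg_integrand_continuous.
- by move=> t; exact: segavg_joint.
Qed.

Lemma segavg_is_derive om w z d : continuous om -> C1 D w -> seg_dom D z ->
  is_derive z d (segavg om w) (segavg om ('D_d w) z
     + l d * segavg (fun t => (sin t - 1) * om t) ('D_b w) z).
Proof.
move=> co Cw Dz; have [_ cw dw] := Cw.
have cd e y : D y -> {for y, continuous ('D_e w)} by move=> Dy; exact: (dw e y Dy).2.
have co' : continuous (fun t => (sin t - 1) * om t).
  move=> t; apply: cvgM; last exact: co.
  by apply: cvgB; [exact: continuous_sin|exact: cvg_cst].
have -> : segavg om ('D_d w) z + l d * segavg (fun t => (sin t - 1) * om t) ('D_b w) z =
  integ (pi / 2) (fun t => 'D_d w (seg t z) * om t + l d * ('D_b w (seg t z) * ((sin t - 1) * om t))).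
  rewrite integD; first rewrite integZ//.
  - exact: segavg_integrand_continuous (cd b) Dz.
  - exact: segavg_integrand_continuous (cd d) Dz.
  - move=> t; apply: cvgM; first exact: cvg_cst.
    exact: (segavg_integrand_continuous co' (cd b) Dz).
have nD := near_open (@seg_dom_open D) Dz.
apply: (@integ_is_derive _ _ _ (ltW pihalf_gt0) (fun z t => w (seg t z) * om t)
 (fun z t => 'D_d w (seg t z) * om t + l d * ('D_b w (seg t z) * ((sin t - 1) * om t)))).
- apply: filterS nD => y Dy t.
  have H := seg_is_derive d Cw (seg_domP t Dy).
  by apply: is_derive_eq; rewrite !scale_real; ring.
- by apply: filterS nD => y Dy; exact: segavg_integrand_continuous.
- apply: filterS nD => y Dy t; apply: cvgD.
    exact: (segavg_integrand_continuous co (cd d) Dy).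
  apply: cvgM; first exact: cvg_cst.
  exact: (segavg_integrand_continuous co' (cd b) Dy).
- move=> t; have j1 := segavg_joint (t := t) co (cd d) Dz.
  have j2 := segavg_joint (t := t) co' (cd b) Dz.
  apply: cvgD; first exact: j1.
  apply: cvgM; first exact: cvg_cst.
  exact: j2.
Qed.

Lemma segavg_C1 om w : continuous om -> C1 D w -> C1 (seg_dom D) (segavg om w).
Proof.
move=> co Cw; have [_ cw dw] := Cw.
have cd e y : D y -> {for y, continuous ('D_e w)} by move=> Dy; exact: (dw e y Dy).2.
have co' : continuous (fun t => (sin t - 1) * om t).
  move=> t; apply: cvgM; last exact: co.
  by apply: cvgB; [exact: continuous_sin|exact: cvg_cst].
apply: (C1_build (@seg_dom_open D) _ (fun d z => segavg_is_derive d co Cw)).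
- by move=> z Dz; exact: segavg_continuous.
- move=> d z Dz; apply: cvgD; first exact: (segavg_continuous co (cd d) Dz).
  apply: cvgM; first exact: cvg_cst.
  exact: (segavg_continuous co' (cd b) Dz).
Qed.

Lemma segavg_derive_a om w z : continuous om -> C1 D w -> seg_dom D z ->
  is_derive z a (segavg om w) (segavg om ('D_a w) z).
Proof.
by move=> co Cw Dz; have := segavg_is_derive a co Cw Dz; rewrite la mul0r addr0.
Qed.

Lemma segavg_derive_b om w z : continuous om -> C1 D w -> seg_dom D z ->
  is_derive z b (segavg om w) (segavg (fun t => sin t * om t) ('D_b w) z).
Proof.
move=> co Cw Dz; have := segavg_is_derive b co Cw Dz; rewrite lb mul1r.
have [_ cw dw] := Cw.
have cd e y : D y -> {for y, continuous ('D_e w)} by move=> Dy; exact: (dw e y Dy).2.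
have co' : continuous (fun t => (sin t - 1) * om t).
  move=> t; apply: cvgM; last exact: co.
  by apply: cvgB; [exact: continuous_sin|exact: cvg_cst].
rewrite /segavg -integD.
- by congr (is_derive _ _ _ (integ _ _)); apply/funext => t; ring.
- exact: (segavg_integrand_continuous co (cd b) Dz).
- exact: (segavg_integrand_continuous co' (cd b) Dz).
Qed.

End SegAvg.

End Height.

(** * Division by the height *)

Section Quotient.
Context {R : realType} {V W : normedModType R}.

(** For a holomorphic [u + i v] with [v = 0] on the axis, this is the
    derivative of [v / l] along [a], as [l a = 0]; on the axis [va] vanishes
    and the limit of [va / l] is [D_b va = uaa]. *)
Definition sphA (l : V -> R) (va uaa : V -> W) z : W :=
  if l z == 0 then uaa z else (l z)^-1 *: va z.

(** The derivative of [v / l] along [b], because [l b = 1] and [D_b v = ua]; it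
    tends to [0] at the axis. *)
Definition sphB (l : V -> R) (v ua : V -> W) z : W :=
  if l z == 0 then 0 else (l z)^-1 *: (ua z - (l z)^-1 *: v z).

End Quotient.

Section Spherical.
Context {R : realType} {V : normedModType R}.
Variables (l : V -> R) (a b : V).
Hypothesis lD : forall (s : R) d z, l (s *: d + z) = s * l d + l z.
Hypothesis cl : continuous l.
Hypothesis la : l a = 0.
Hypothesis lb : l b = 1.
Variables (D : set V).
Implicit Types (u v w : V -> R) (d z : V).

(** [u + i v] is holomorphic with the derivative [u' + i v']. *)
Definition Hol u v u' v' := [/\ C1 D u, C1 D v,
  forall z, D z -> is_derive z a u (u' z) /\ is_derive z b u (- v' z) &
  forall z, D z -> is_derive z a v (v' z) /\ is_derive z b v (u' z)].

Local Notation off := (D `&` [set z | l z != 0]).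

Lemma continuous_sincos : continuous (fun t : R => sin t * cos t).
Proof. by move=> t; apply: cvgM; [exact: continuous_sin|exact: continuous_cos]. Qed.

Lemma continuous_sin2cos : continuous (fun t : R => sin t * (sin t * cos t)).
Proof. by move=> t; apply: cvgM; [exact: continuous_sin|exact: continuous_sincos]. Qed.

Lemma seg_dom_sub z : seg_dom l b D z -> D z.
Proof.
by move=> /(seg_domP (pi / 2)); rewrite /seg sin_pihalf subrr mul0r scale0r add0r.
Qed.

Lemma integ_cos : integ (pi / 2) (@cos R) = 1.
Proof.
rewrite (integ_FTC pihalf_gt0 (F := @sin R)).
- by rewrite sin_pihalf sin0 subr0.
- exact: continuous_cos.
Qed.

Lemma integ_sin2cos : integ (pi / 2) (fun t : R => sin t * (sin t * cos t)) = 3^-1.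
Proof.
have dF (t : R) : is_derive t (1 : R) (fun t => 3^-1 * (sin t * (sin t * sin t)))
    (sin t * (sin t * cos t)).
  by apply: is_derive_eq; rewrite !scale_real; field.
by rewrite (integ_FTC pihalf_gt0 continuous_sin2cos dF) sin_pihalf sin0 !mulr1 !mulr0 subr0.
Qed.

Lemma segavg_axis om w z : continuous om -> l z = 0 ->
  segavg l b om w z = w z * integ (pi / 2) om.
Proof.
move=> co lz; rewrite /segavg -integZ//; congr integ; apply/funext => t.
by rewrite seg_axis.
Qed.

Lemma seg_is_derive_angle w (dw : R) t z : C1 D w -> D (seg l b t z) ->
  is_derive (seg l b t z) b w dw ->
  is_derive t (1 : R) (fun t => w (seg l b t z)) (cos t * l z * dw).
Proof.
move=> Cw Dt [_ <-].
have -> : (fun t => w (seg l b t z)) =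
   (fun s => w (((sin s - sin t) * l z) *: b + ((0 : R) *: b + seg l b t z))).
  apply/funext => s; congr w; rewrite scale0r add0r /seg addrA -scalerDl.
  by congr (_ *: _ + _); ring.
have H := @C1_chain _ _ D w b b _ (fun s => (sin s - sin t) * l z) (fun=> 0) t
  (cos t * l z) 0 Cw Dt.
rewrite mul0r addr0 in H.
apply: H; rewrite ?subrr ?mul0r//.
by apply: is_derive_eq; rewrite scaler0 add0r subr0 scale_real mulrC.
Qed.

(** The derivative of [v] along the segment is [l z * cos t] times
    [D_b v = u'], and [v] vanishes at its starting point. So [v / l] is an
    average of [u'], which has no singularity at the axis. *)
Lemma segavg_cos u v u' v' z : Hol u v u' v' -> C1 D u' ->
  (forall z, D z -> l z = 0 -> v z = 0) -> seg_dom l b D z ->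
  l z * segavg l b cos u' z = v z.
Proof.
move=> [Cu Cv du dv] Cu' v0 Dz.
have cu' : forall y, D y -> {for y, continuous u'} by case: Cu'.
have ci := segavg_integrand_continuous cl (@continuous_cos R) cu' Dz.
have ci' : continuous (fun t => l z * (u' (seg l b t z) * cos t)).
  by move=> t; apply: cvgM; [exact: cvg_cst|exact: ci].
have dF (t : R) : is_derive t (1 : R) (fun t => v (seg l b t z))
    (l z * (u' (seg l b t z) * cos t)).
  rewrite (_ : l z * _ = cos t * l z * u' (seg l b t z)); last by ring.
  have Dt := seg_domP t Dz.
  exact: seg_is_derive_angle Cv Dt (dv _ Dt).2.
rewrite /segavg -integZ// (integ_FTC pihalf_gt0 ci' dF).
have -> : v (seg l b 0 z) = 0.
  by apply: v0; [exact: seg_domP|rewrite l_seg// sin0 mul0r].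
by rewrite /seg sin_pihalf subrr mul0r scale0r add0r subr0.
Qed.

(** Here the function to differentiate along the segment is
    [sin t * u' - (l z)^-1 * v]: the two terms [cos t * u'] of its derivative
    cancel because [D_b v = u'], and a multiple of [D_b u' = - v''] remains. *)
Lemma segavg_sincos u v u' v' u'' v'' z : Hol u v u' v' -> Hol u' v' u'' v'' -> C1 D v'' ->
  (forall z, D z -> l z = 0 -> v z = 0) -> seg_dom l b D z -> l z != 0 ->
  l z * segavg l b (fun t => sin t * cos t) (fun z => - v'' z) z = u' z - (l z)^-1 * v z.
Proof.
move=> [Cu Cv du dv] [Cu' Cv' du' dv'] Cv'' v0 Dz lz.
have cv'' : forall y, D y -> {for y, continuous (fun y => - v'' y)}.
  by case: Cv'' => _ c _ y Dy; apply: cvgN; exact: c.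
have ci := segavg_integrand_continuous cl continuous_sincos cv'' Dz.
have ci' : continuous (fun t => l z * (- v'' (seg l b t z) * (sin t * cos t))).
  by move=> t; apply: cvgM; [exact: cvg_cst|exact: ci].
have dF (t : R) : is_derive t (1 : R)
    (fun t => sin t * u' (seg l b t z) - (l z)^-1 * v (seg l b t z))
    (l z * (- v'' (seg l b t z) * (sin t * cos t))).
  have Dt := seg_domP t Dz.
  have H1 := seg_is_derive_angle Cv Dt (dv _ Dt).2.
  have H2 := seg_is_derive_angle Cu' Dt (du' _ Dt).2.
  by apply: is_derive_eq; rewrite !scale_real; field.
rewrite /segavg -integZ// (integ_FTC pihalf_gt0 ci' dF).
have -> : v (seg l b 0 z) = 0.
  by apply: v0; [exact: seg_domP|rewrite l_seg// sin0 mul0r].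
rewrite sin0 mul0r mulr0 subr0 subr0.
by rewrite /seg sin_pihalf mul1r subrr mul0r scale0r add0r.
Qed.

Lemma invl_is_derive z d : l z != 0 ->
  is_derive z d (fun z => (l z)^-1) (- (l z) ^- 2 * l d).
Proof.
move=> lz; have [d1 d2] := l_is_derive lD z d.
split; first exact: derivableV.
by rewrite deriveV// d2 scale_real.
Qed.

Lemma invl_continuous z : l z != 0 -> {for z, continuous (fun z => (l z)^-1)}.
Proof. by move=> lz; apply: cvgV => //; exact: cl. Qed.

Lemma invl_C1 : open D -> C1 off (fun z => (l z)^-1).
Proof.
move=> oD.
apply: (C1_build (off_axis_open cl oD) _ (fun d z Dz => invl_is_derive d Dz.2)) => [z [_ lz]|d z [_ lz]].
  exact: invl_continuous.
apply: cvgM; last exact: cvg_cst.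
apply: cvgN; apply: cvgV; first by rewrite expf_neq0.
by apply: cvgM; exact: cl.
Qed.

(** The direction [a] is tangent to the axis. *)
Lemma axis_derive_a w (dw : R) z : (forall z, D z -> l z = 0 -> w z = 0) -> open D ->
  D z -> l z = 0 -> is_derive z a w dw -> dw = 0.
Proof.
move=> w0 oD Dz lz [_ <-]; suff [] : is_derive z a w 0 by [].
apply: is_derive_of_line.
apply: (@near_eq_is_derive _ _ _ (fun _ : R => 0 : R)).
have cs : {for (0 : R), continuous (fun s : R => s *: a + z)}.
  by apply: cvgD; [apply: cvgZr_tmp; exact: cvg_id|exact: cvg_cst].
have : \forall s \near (0 : R), D (s *: a + z).
  apply: cs; rewrite scale0r add0r; exact: near_open.
apply: filterS => s Ds; apply/esym; apply: w0 => //.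
by rewrite lD la lz mulr0 addr0.
Qed.

Lemma axis_or_off z : open D -> D z -> (l z = 0 /\ seg_dom l b D z) \/ off z.
Proof.
move=> oD Dz; have [lz|lz] := eqVneq (l z) 0; last by right.
by left; split => //; exact: seg_dom_axis.
Qed.

Variables (u v ua va uaa vaa uaaa vaaa : V -> R).
Hypothesis H0 : Hol u v ua va.
Hypothesis H1 : Hol ua va uaa vaa.
Hypothesis H2 : Hol uaa vaa uaaa vaaa.
Hypothesis v0 : forall z, D z -> l z = 0 -> v z = 0.

Let oD : open D. Proof. by have [[]] := H0. Qed.
Let o_off : open off. Proof. exact: off_axis_open. Qed.
Let va0 z : D z -> l z = 0 -> va z = 0.
Proof. by move=> Dz lz; have [_ _ _ /(_ z Dz)[d _]] := H0; exact: axis_derive_a d. Qed.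
Let vaa0 z : D z -> l z = 0 -> vaa z = 0.
Proof. by move=> Dz lz; have [_ _ _ /(_ z Dz)[d _]] := H1; exact: axis_derive_a d. Qed.
Let vaaa0 z : D z -> l z = 0 -> vaaa z = 0.
Proof. by move=> Dz lz; have [_ _ _ /(_ z Dz)[d _]] := H2; exact: axis_derive_a d. Qed.

Lemma sphA_seg z : seg_dom l b D z -> segavg l b cos uaa z = sphA l va uaa z.
Proof.
move=> Dz; rewrite /sphA; case: eqP => [lz|/eqP lz].
  by rewrite (segavg_axis _ (@continuous_cos R) lz) integ_cos mulr1.
have [C _ _ _] := H2.
by rewrite -(segavg_cos H1 C va0 Dz) scale_real mulKf.
Qed.

Lemma sphB_seg z : seg_dom l b D z ->
  segavg l b (fun t => sin t * cos t) (fun z => - vaa z) z = sphB l v ua z.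
Proof.
move=> Dz; rewrite /sphB; case: eqP => [lz|/eqP lz].
  by rewrite (segavg_axis _ continuous_sincos lz) vaa0 ?oppr0 ?mul0r//; exact: seg_dom_sub.
have [_ C _ _] := H2.
by rewrite !scale_real -(segavg_sincos H0 H1 C v0 Dz lz) mulKf.
Qed.

Let near_segA z : seg_dom l b D z -> \forall y \near z, segavg l b cos uaa y = sphA l va uaa y.
Proof.
by move=> /(near_open (@seg_dom_open _ _ l b D)); apply: filterS => y /sphA_seg.
Qed.

Let near_segB z : seg_dom l b D z -> \forall y \near z,
  segavg l b (fun t => sin t * cos t) (fun z => - vaa z) y = sphB l v ua y.
Proof.
by move=> /(near_open (@seg_dom_open _ _ l b D)); apply: filterS => y /sphB_seg.
Qed.

Lemma sphA_off z : off z -> (l z)^-1 * va z = sphA l va uaa z.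
Proof. by move=> [_ /= lz]; rewrite /sphA (negbTE lz). Qed.

Lemma sphB_off z : off z -> (l z)^-1 * (ua z + - ((l z)^-1 * v z)) = sphB l v ua z.
Proof. by move=> [_ /= lz]; rewrite /sphB (negbTE lz). Qed.

Let near_offA z : off z -> \forall y \near z, (l y)^-1 * va y = sphA l va uaa y.
Proof. by move=> /(near_open o_off); apply: filterS => y /sphA_off. Qed.

Let near_offB z : off z ->
  \forall y \near z, (l y)^-1 * (ua y + - ((l y)^-1 * v y)) = sphB l v ua y.
Proof. by move=> /(near_open o_off); apply: filterS => y /sphB_off. Qed.

Lemma off_sub : off `<=` D. Proof. by move=> z []. Qed.

(** Near the axis the quotient is an average over segments; elsewhere the
    height is invertible. *)
Lemma sphA_C1 : C1 D (sphA l va uaa).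
Proof.
have [Cuaa _ _ _] := H2; have [_ Cva _ _] := H1.
apply: C1_local oD => z /(axis_or_off oD)[[lz sz]|oz].
  exists (seg_dom l b D) => //; apply: eq_C1 sphA_seg _.
  exact: (segavg_C1 b lD cl (@continuous_cos R) Cuaa).
exists off => //; apply: eq_C1 sphA_off _.
by apply: C1M; [exact: invl_C1|exact: C1_sub o_off off_sub Cva].
Qed.

Lemma sphB_C1 : C1 D (sphB l v ua).
Proof.
have [_ Cvaa _ _] := H2; have [Cua _ _ _] := H1; have [_ Cv _ _] := H0.
apply: C1_local oD => z /(axis_or_off oD)[[lz sz]|oz].
  exists (seg_dom l b D) => //; apply: eq_C1 sphB_seg _.
  exact: (segavg_C1 b lD cl continuous_sincos (C1N Cvaa)).
exists off => //; apply: eq_C1 sphB_off _.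
apply: C1M; first exact: invl_C1.
apply: C1D; first exact: C1_sub o_off off_sub Cua.
by apply: C1N; apply: C1M; [exact: invl_C1|exact: C1_sub o_off off_sub Cv].
Qed.

Lemma sphA_axis_derive z : D z -> l z = 0 ->
  is_derive z a (sphA l va uaa) (uaaa z) /\ is_derive z b (sphA l va uaa) 0.
Proof.
move=> Dz lz; have sz := seg_dom_axis b cl oD Dz lz.
have cc := @continuous_cos R.
have [Cuaa _ /(_ z Dz)[[_ da] [_ db]] _] := H2.
split; apply: near_eq_is_derive (near_segA sz) _.
  have := segavg_derive_a lD cl la cc Cuaa sz.
  by rewrite (segavg_axis _ cc lz) integ_cos mulr1 da.
have := segavg_derive_b lD cl lb cc Cuaa sz.
by rewrite (segavg_axis _ continuous_sincos lz) db vaaa0// oppr0 mul0r.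
Qed.

(** The constant is the integral of [sin t ^ 2 * cos t]: one factor [sin t]
    belongs to the weight of [sphB], the other is the height gained by the
    point [seg t z] when [z] moves along [b]. *)
Lemma sphB_axis_derive z : D z -> l z = 0 ->
  is_derive z a (sphB l v ua) 0 /\ is_derive z b (sphB l v ua) (- (3^-1 * uaaa z)).
Proof.
move=> Dz lz; have sz := seg_dom_axis b cl oD Dz lz.
have cc := continuous_sincos.
have [_ Cvaa _ /(_ z Dz)[da db]] := H2.
have da' : is_derive z a (fun z => - vaa z) (- vaaa z) by exact: is_deriveN.
have db' : is_derive z b (fun z => - vaa z) (- uaaa z) by exact: is_deriveN.
split; apply: near_eq_is_derive (near_segB sz) _.
  have := segavg_derive_a lD cl la cc (C1N Cvaa) sz.
  by have [_ e] := da'; rewrite (segavg_axis _ cc lz) e vaaa0// oppr0 mul0r.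
have := segavg_derive_b lD cl lb cc (C1N Cvaa) sz.
have [_ e] := db'; rewrite (segavg_axis _ continuous_sin2cos lz) e integ_sin2cos.
by rewrite mulNr mulrC.
Qed.

Lemma sphA_off_derive z : D z -> l z != 0 ->
  is_derive z a (sphA l va uaa) ((l z)^-1 * vaa z) /\
  is_derive z b (sphA l va uaa) ((l z)^-1 * uaa z - (l z)^-1 ^+ 2 * va z).
Proof.
move=> Dz lz.
have [_ _ _ /(_ z Dz)[da db]] := H1.
have ia := invl_is_derive a lz; have ib := invl_is_derive b lz.
split; apply: near_eq_is_derive (near_offA (conj Dz lz)) _; apply: is_derive_eq.
  by rewrite !scale_real la mulr0 mulr0 addr0.
by rewrite !scale_real lb; field.
Qed.

Lemma sphB_off_derive z : D z -> l z != 0 ->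
  is_derive z a (sphB l v ua) ((l z)^-1 * uaa z - (l z)^-1 ^+ 2 * va z) /\
  is_derive z b (sphB l v ua)
    (- (l z)^-1 * vaa z - 2 * (l z)^-1 * ((l z)^-1 * (ua z - (l z)^-1 * v z))).
Proof.
move=> Dz lz.
have [_ _ /(_ z Dz)[da db] _] := H1.
have [_ _ _ /(_ z Dz)[dva dvb]] := H0.
have ia := invl_is_derive a lz; have ib := invl_is_derive b lz.
split; apply: near_eq_is_derive (near_offB (conj Dz lz)) _; apply: is_derive_eq.
  by rewrite !scale_real la; field.
by rewrite !scale_real lb; field.
Qed.

End Spherical.

Section HolomorphicTower.
Context {R : realType} {V : normedModType R}.
Variables (a b : V).

Lemma CR_Hol (D : set V) u v : CR a b D u v -> Hol a b D u v ('D_a u) ('D_a v).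
Proof.
move=> [Cu Cv e1 e2]; split; [exact: Cu|exact: Cv| |] => z Dz; split.
- exact: C1_is_derive Cu Dz.
- by rewrite -e2//; exact: C1_is_derive Cu Dz.
- exact: C1_is_derive Cv Dz.
- by rewrite e1//; exact: C1_is_derive Cv Dz.
Qed.

End HolomorphicTower.

(** * Quaternion-valued functions *)

Section FiniteDim.
Context {R : realType} {V : normedModType R}.
Implicit Types (D : set V) (u : V -> R).

Definition fin_dim (W : normedModType R) : Prop :=
  exists (I : Type) (r : seq I) (e : I -> W) (c : I -> W -> R),
    [/\ forall i, continuous (c i), forall i, c i 0 = 0 &
        forall y, y = \sum_(i <- r) c i y *: e i].

(** The increment along [e] is bounded by the coordinate [c x], which tends to
    [0], times a local bound of [D_e u]. *)
Lemma continuous_push u e (c : V -> R) (q : V -> V) x0 :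
  (\forall y \near q x0, derivable u y e) -> {for q x0, continuous ('D_e u)} ->
  {for x0, continuous c} -> c x0 = 0 -> {for x0, continuous q} ->
  {for x0, continuous (fun x => u (q x))} ->
  {for x0, continuous (fun x => u (c x *: e + q x))}.
Proof.
move=> Du cDu cc c0 cq cuq.
pose d x := u (c x *: e + q x) - u (q x).
suff cd : d x @[x --> x0] --> (0 : R).
  have -> : (fun x => u (c x *: e + q x)) = (fun x => u (q x) + d x).
    by apply/funext => x; rewrite /d addrCA subrr addr0.
  rewrite /prop_for /continuous_at.
  rewrite [X in _ --> X](_ : _ = u (q x0) + 0).
    exact: cvgD cuq cd.
  by rewrite /d c0 scale0r add0r subrr.
apply/cvgr0Pnorm_le => eps e0.
pose M := `|'D_e u (q x0)| + 1.
have M0 : 0 < M by rewrite ltr_wpDl.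
have NM : \forall y \near q x0, `|'D_e u (q x0) - 'D_e u y| < 1.
  exact: (cvgrPdist_lt _ _).1 cDu _ ltr01.
have [r /= r0 rP] := (nbhs_ballP _ _).1 (filterI Du NM).
have ec : 0 < `|e| + 1 by rewrite ltr_wpDl.
have Nq : \forall x \near x0, `|q x0 - q x| < r / 2.
  by apply: (cvgrPdist_lt _ _).1 cq _ _; rewrite divr_gt0.
have Nc (k : R) : 0 < k -> \forall x \near x0, `|c x| < k.
  move=> k0; have H : \forall x \near x0, `|c x0 - c x| < k by exact: (cvgrPdist_lt _ _).1 cc _ k0.
  by apply: filterS H => x; rewrite c0 sub0r normrN.
near=> x.
have cx1 : `|c x| * (`|e| + 1) < r / 2.
  by rewrite -ltr_pdivlMr//; near: x; apply: Nc; rewrite !divr_gt0.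
have cx2 : `|c x| < eps / M by near: x; apply: Nc; rewrite divr_gt0.
have qx : `|q x0 - q x| < r / 2 by near: x.
have inr s : `|s| <= `|c x| -> ball (q x0) r (s *: e + q x).
  move=> sc; rewrite -ball_normE/= opprD addrCA (splitr r).
  apply: le_lt_trans (ler_normD _ _) _; apply: ltrD => //.
  rewrite normrN normrZ; apply: le_lt_trans cx1.
  by apply: ler_pM => //; rewrite lerDl.
have [s sc|s sc] := @MVT0 _ (fun s => u (s *: e + q x)) (fun s => 'D_e u (s *: e + q x)) (c x).
  by apply: (@is_derive_line _ _ _ u); apply: derivableP; have [] := rP _ (inr _ sc).
rewrite scale0r add0r => E; rewrite /d E normrM.
have [_ /= B] := rP _ (inr _ sc).
have DM : `|'D_e u (s *: e + q x)| <= M.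
  rewrite /M -lerBlDl; apply: le_trans (lerB_dist _ _) _.
  by rewrite distrC; exact: ltW.
apply: (@le_trans _ _ (M * (eps / M))); last by rewrite mulrC divfK// gt_eqF.
by apply: ler_pM => //; exact: ltW.
Unshelve. all: by end_near. Qed.

(** A point is joined to [z] by finitely many segments in coordinate
    directions, which are treated one after the other. *)
Lemma C1_continuous D u z : fin_dim V -> open D ->
  (forall d z, D z -> derivable u z d /\ {for z, continuous ('D_d u)}) ->
  D z -> {for z, continuous u}.
Proof.
move=> [I [r [e [c [cc c0 cE]]]]] oD Du Dz.
pose q (s : seq I) y := \sum_(i <- s) c i (y - z) *: e i + z.
have cy i : {for z, continuous (fun y => c i (y - z))}.
  apply: (@continuous_comp _ _ _ (fun y => y - z) (c i)); last exact: cc.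
  by apply: cvgB; [exact: cvg_id|exact: cvg_cst].
have qz s : q s z = z.
  rewrite /q big1 ?add0r// => i _.
  by rewrite subrr c0 scale0r.
have cq s : {for z, continuous (q s)}.
  elim: s => [|i s IH].
    have -> : q [::] = (fun y => z) by apply/funext => y; rewrite /q big_nil add0r.
    exact: cont_cst.
  have -> : q (i :: s) = (fun y => c i (y - z) *: e i + q s y).
    by apply/funext => y; rewrite /q big_cons addrA.
  by apply: cvgD; [apply: cvgZr_tmp; exact: cy|exact: IH].
suff H s : {for z, continuous (fun y => u (q s y))}.
  have <- : (fun y => u (q r y)) = u by apply/funext => y; rewrite /q -cE subrK.
  exact: H.
elim: s => [|i s IH].
  have -> : (fun y => u (q [::] y)) = (fun=> u z); last exact: cont_cst.
  by apply/funext => y; rewrite /q big_nil add0r.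
have -> : (fun y => u (q (i :: s) y)) = (fun y => u (c i (y - z) *: e i + q s y)).
  by apply/funext => y; rewrite /q big_cons addrA.
apply: continuous_push.
- rewrite qz; apply: filterS (near_open oD Dz) => y Dy; exact: (Du (e i) y Dy).1.
- by rewrite qz; exact: (Du (e i) z Dz).2.
- exact: cy.
- by rewrite subrr c0.
- exact: cq.
- exact: IH.
Qed.

End FiniteDim.

Section Components.
Context {R : realType} {V : normedModType R}.
Implicit Types (D : set V) (G : V -> quat R).

Definition qcomp (m : 'I_4) G : V -> R := fun z => G z 0 m.

Lemma qderivable_comp G z d : derivable G z d <-> forall m, derivable (qcomp m G) z d.
Proof.
split => [H m|H]; first exact: ((@derivable_mxP R V 1 4 G z d).1 H 0 m).
by apply/(@derivable_mxP R V 1 4 G z d) => i j; rewrite ord1; exact: H.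
Qed.

Lemma qderive_comp G z d m : derivable G z d -> 'D_d (qcomp m G) z = ('D_d G z) 0 m.
Proof.
by move=> H; rewrite (@derive_mx R V 1 4 G z d H) mxE.
Qed.

Lemma qis_derive_comp G z d (dG : quat R) :
  is_derive z d G dG <-> forall m, is_derive z d (qcomp m G) (dG 0 m).
Proof.
split => [[H <-] m|H].
  by split; [exact: (qderivable_comp G z d).1 H m|exact: qderive_comp].
have dd : derivable G z d by apply/qderivable_comp => m; have [] := H m.
split => //; apply/rowP => m.
by rewrite -(qderive_comp m dd); have [_ ->] := H m.
Qed.

Lemma qcontinuous_comp (U : topologicalType) (G : U -> quat R) z :
  {for z, continuous G} <-> forall m, {for z, continuous (fun y => G y 0 m)}.
Proof.
split => [H m|H].
  apply: (@continuous_comp _ _ _ G (fun M : 'rV[R]_4 => M 0 m)); first exact: H.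
  exact: coord_continuous.
apply/cvgrPdist_le => e e0; near=> y.
rewrite /Num.Def.normr/= mx_normrE (bigmax_le _ (ltW e0))//= => i _.
rewrite !mxE/=.
move: i; near: y; apply: filter_forall => -[i j] /=.
rewrite (ord1 i); exact: ((cvgrPdist_le _ _).1 (H j)).
Unshelve. all: by end_near. Qed.

Lemma class_C1_comp D G : fin_dim V -> class_C1 D G <-> open D /\ forall m, C1 D (qcomp m G).
Proof.
move=> fV; split => [[oD dG]|[oD CG]]; split => //.
  move=> m.
  have H d z : D z -> derivable (qcomp m G) z d /\ {for z, continuous ('D_d (qcomp m G))}.
    move=> Dz; have [d1 c1] := dG d z Dz; split; first exact: (qderivable_comp _ _ _).1 d1 m.
    apply: (@continuous_for_eq _ _ (fun y => 'D_d G y 0 m)).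
      apply: filterS (near_open oD Dz) => y Dy.
      by rewrite (qderive_comp m (dG d y Dy).1).
    exact: (qcontinuous_comp _ _).1 c1 m.
  split; [exact: oD| |exact: H] => z Dz.
  exact: C1_continuous fV oD H Dz.
move=> d z Dz.
have dd y : D y -> derivable G y d.
  by move=> Dy; apply/qderivable_comp => m; have [_ _ /(_ d y Dy)[]] := CG m.
split; first exact: dd.
apply/qcontinuous_comp => m.
have [_ _ /(_ d z Dz)[_ c1]] := CG m.
apply: continuous_for_eq c1.
by apply: filterS (near_open oD Dz) => y Dy; rewrite (qderive_comp m (dd y Dy)).
Qed.

End Components.

Section QuatCR.
Context {R : realType} {V : normedModType R}.
Hypothesis fV : fin_dim V.
Variables (a b : V) (D : set V).
Implicit Types (u v : V -> quat R).

Definition QCR u v := [/\ class_C1 D u, class_C1 D v,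
  forall z, D z -> 'D_a u z = 'D_b v z & forall z, D z -> 'D_b u z = - 'D_a v z].

Definition QHol u v u' v' := forall m, Hol a b D (qcomp m u) (qcomp m v) (qcomp m u') (qcomp m v').

Lemma eq_CR (u v u' v' : V -> R) : (forall z, D z -> u z = u' z) -> (forall z, D z -> v z = v' z) ->
  CR a b D u v -> CR a b D u' v'.
Proof.
move=> eu ev [Cu Cv e1 e2]; have [oD _ _] := Cu.
have nu z : D z -> \forall y \near z, u y = u' y.
  by move=> /(near_open oD); apply: filterS => y; exact: eu.
have nv z : D z -> \forall y \near z, v y = v' y.
  by move=> /(near_open oD); apply: filterS => y; exact: ev.
split; [exact: eq_C1 eu Cu|exact: eq_C1 ev Cv| |] => z Dz.
  by rewrite -(near_eq_derive _ (nu z Dz)) -(near_eq_derive _ (nv z Dz)) e1.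
by rewrite -(near_eq_derive _ (nu z Dz)) -(near_eq_derive _ (nv z Dz)) e2.
Qed.

Lemma class_C1_derivable u d z : class_C1 D u -> D z -> derivable u z d.
Proof. by move=> [_ H] /(H d)[]. Qed.

Lemma QCR_comp u v : QCR u v <-> forall m, CR a b D (qcomp m u) (qcomp m v).
Proof.
split=> [[Cu Cv e1 e2] m|H].
  have [oD /(_ m) Cum] := (class_C1_comp D u fV).1 Cu.
  have [_ /(_ m) Cvm] := (class_C1_comp D v fV).1 Cv.
  have du d z Dz := qderive_comp m (@class_C1_derivable u d z Cu Dz).
  have dv d z Dz := qderive_comp m (@class_C1_derivable v d z Cv Dz).
  split; [exact: Cum|exact: Cvm| |] => z Dz.
    by rewrite (du a z Dz) (dv b z Dz) e1.
  by rewrite (du b z Dz) (dv a z Dz) e2// mxE.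
have oD : open D by have [[]] := H 0.
have Cu : class_C1 D u.
  by apply/(class_C1_comp D u fV); split => // m; have [] := H m.
have Cv : class_C1 D v.
  by apply/(class_C1_comp D v fV); split => // m; have [] := H m.
have du d z m Dz := qderive_comp m (@class_C1_derivable u d z Cu Dz).
have dv d z m Dz := qderive_comp m (@class_C1_derivable v d z Cv Dz).
split; [exact: Cu|exact: Cv| |] => z Dz; apply/rowP => m.
  by rewrite -(du a z m Dz) -(dv b z m Dz); have [_ _ + _] := H m; exact.
by rewrite mxE -(du b z m Dz) -(dv a z m Dz); have [_ _ _] := H m; exact.
Qed.

Lemma comp_derive u d m z : class_C1 D u -> D z -> 'D_d (qcomp m u) z = qcomp m ('D_d u) z.
Proof. by move=> Cu Dz; rewrite (qderive_comp m (@class_C1_derivable u d z Cu Dz)). Qed.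

Lemma QCR_derive u v : QCR u v -> QCR ('D_a u) ('D_a v).
Proof.
move=> H; have [Cu Cv _ _] := H.
apply/QCR_comp => m.
apply: eq_CR (CR_derive ((QCR_comp u v).1 H m)) => z Dz.
  exact: comp_derive.
exact: comp_derive.
Qed.

Lemma QCR_QHol u v : QCR u v -> QHol u v ('D_a u) ('D_a v).
Proof.
move=> H m; have [Cu Cv _ _] := H.
have [C1u C1v du dv] := CR_Hol ((QCR_comp u v).1 H m).
split; [exact: C1u|exact: C1v| |] => z Dz.
  by rewrite -(comp_derive a m Cu Dz) -(comp_derive a m Cv Dz); exact: du.
by rewrite -(comp_derive a m Cu Dz) -(comp_derive a m Cv Dz); exact: dv.
Qed.

Lemma QHol_is_derive u v u' v' z : QHol u v u' v' -> D z ->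
  [/\ is_derive z a u (u' z), is_derive z b u (- v' z),
      is_derive z a v (v' z) & is_derive z b v (u' z)].
Proof.
move=> H Dz; split; apply/qis_derive_comp => m; have [_ _ /(_ z Dz)[d1 d2] /(_ z Dz)[d3 d4]] := H m.
- exact: d1.
- by rewrite mxE; exact: d2.
- exact: d3.
- exact: d4.
Qed.

Lemma QHol_C1 u v u' v' : QHol u v u' v' -> class_C1 D u /\ class_C1 D v.
Proof.
move=> H; have oD : open D by have [[]] := H 0.
split; apply/(class_C1_comp D _ fV); split; [exact: oD| |exact: oD|] => m.
  by have [] := H m.
by have [] := H m.
Qed.

(** Three derivatives are followed: the pair that induces the Laplacian takes
    two, and its own derivatives at the axis a third. *)
Record tower u v ua va uaa vaa uaaa vaaa : Prop := Tower {
  tower0 : QHol u v ua va;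
  tower1 : QHol ua va uaa vaa;
  tower2 : QHol uaa vaa uaaa vaaa }.

Variable (l : V -> R).
Hypothesis lD : forall (s : R) d z, l (s *: d + z) = s * l d + l z.
Hypothesis cl : continuous l.
Hypothesis la : l a = 0.
Hypothesis lb : l b = 1.
Variables (u v ua va uaa vaa uaaa vaaa : V -> quat R).
Hypothesis T : tower u v ua va uaa vaa uaaa vaaa.
Hypothesis v0 : forall z, D z -> l z = 0 -> v z = 0.

Lemma comp_sphA m : qcomp m (sphA l va uaa) = sphA l (qcomp m va) (qcomp m uaa).
Proof. by apply/funext => z; rewrite /qcomp /sphA; case: ifP => // _; rewrite mxE. Qed.

Lemma comp_sphB m : qcomp m (sphB l v ua) = sphB l (qcomp m v) (qcomp m ua).
Proof. by apply/funext => z; rewrite /qcomp /sphB; case: ifP => // _; rewrite !mxE. Qed.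

Let v0m m z : D z -> l z = 0 -> qcomp m v z = 0.
Proof. by move=> Dz lz; rewrite /qcomp v0// mxE. Qed.

Lemma qsph_C1 : class_C1 D (sphA l va uaa) /\ class_C1 D (sphB l v ua).
Proof.
have [H0 H1 H2] := T.
have oD : open D by have [[]] := H0 0.
split; apply/(class_C1_comp D _ fV); split; [exact: oD| |exact: oD|] => m.
  rewrite comp_sphA; exact: (sphA_C1 lD cl la lb (H0 m) (H1 m) (H2 m) (@v0m m)).
rewrite comp_sphB; exact: (sphB_C1 lD cl la lb (H0 m) (H1 m) (H2 m) (@v0m m)).
Qed.

Lemma qsph_axis z : D z -> l z = 0 ->
  [/\ is_derive z a (sphA l va uaa) (uaaa z), is_derive z b (sphA l va uaa) 0,
      is_derive z a (sphB l v ua) 0 & is_derive z b (sphB l v ua) (- (3^-1 *: uaaa z))].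
Proof.
move=> Dz lz; have [H0 H1 H2] := T.
have A m := sphA_axis_derive lD cl la lb (H0 m) (H1 m) (H2 m) (@v0m m) Dz lz.
have B m := sphB_axis_derive lD cl la lb (H0 m) (H1 m) (H2 m) (@v0m m) Dz lz.
split; apply/qis_derive_comp => m; rewrite ?comp_sphA ?comp_sphB ?mxE.
- exact: (A m).1.
- exact: (A m).2.
- exact: (B m).1.
- exact: (B m).2.
Qed.

Lemma qsph_off z : D z -> l z != 0 ->
  [/\ is_derive z a (sphA l va uaa) ((l z)^-1 *: vaa z),
      is_derive z b (sphA l va uaa) ((l z)^-1 *: uaa z - (l z)^-1 ^+ 2 *: va z),
      is_derive z a (sphB l v ua) ((l z)^-1 *: uaa z - (l z)^-1 ^+ 2 *: va z) &
      is_derive z b (sphB l v ua)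
        (- (l z)^-1 *: vaa z - (2 * (l z)^-1) *: ((l z)^-1 *: (ua z - (l z)^-1 *: v z)))].
Proof.
move=> Dz lz; have [H0 H1 H2] := T.
have A m := sphA_off_derive lD cl la lb (H0 m) (H1 m) Dz lz.
have B m := sphB_off_derive lD cl la lb (H0 m) (H1 m) Dz lz.
split; apply/qis_derive_comp => m; rewrite ?comp_sphA ?comp_sphB ?mxE.
- exact: (A m).1.
- exact: (A m).2.
- exact: (B m).1.
- exact: (B m).2.
Qed.

End QuatCR.

(** * Geometry and calculus of quaternions *)

Section QuatGeometry.
Context {R : realType}.
Implicit Types (p q e J : quat R).

Definition dot p q : R := imi p * imi q + imj p * imj q + imk p * imk q.
Definition vec q : quat R := Quat 0 (imi q) (imj q) (imk q).
Definition im_norm q : R := Num.sqrt (dot q q).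
(** Of the conjugate points [(alpha, beta)] and [(alpha, - beta)] that both
    represent [q], the one in the upper half plane. *)
Definition polar q : R * R := (re q, im_norm q).

Lemma reN q : re (- q) = - re q. Proof. by rewrite /re mxE. Qed.
Lemma imiN q : imi (- q) = - imi q. Proof. by rewrite /imi mxE. Qed.
Lemma imjN q : imj (- q) = - imj q. Proof. by rewrite /imj mxE. Qed.
Lemma imkN q : imk (- q) = - imk q. Proof. by rewrite /imk mxE. Qed.
Lemma re0 : re (0 : quat R) = 0. Proof. by rewrite /re mxE. Qed.
Lemma imi0 : imi (0 : quat R) = 0. Proof. by rewrite /imi mxE. Qed.
Lemma imj0 : imj (0 : quat R) = 0. Proof. by rewrite /imj mxE. Qed.
Lemma imk0 : imk (0 : quat R) = 0. Proof. by rewrite /imk mxE. Qed.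
Lemma re1 : re (1 : quat R) = 1. Proof. exact: re_Quat. Qed.
Lemma imi1 : imi (1 : quat R) = 0. Proof. exact: imi_Quat. Qed.
Lemma imj1 : imj (1 : quat R) = 0. Proof. exact: imj_Quat. Qed.
Lemma imk1 : imk (1 : quat R) = 0. Proof. exact: imk_Quat. Qed.
Lemma reM p q : re (p * q) =
  re p * re q - imi p * imi q - imj p * imj q - imk p * imk q.
Proof. exact: re_Quat. Qed.
Lemma imiM p q : imi (p * q) =
  re p * imi q + imi p * re q + imj p * imk q - imk p * imj q.
Proof. exact: imi_Quat. Qed.
Lemma imjM p q : imj (p * q) =
  re p * imj q - imi p * imk q + imj p * re q + imk p * imi q.
Proof. exact: imj_Quat. Qed.
Lemma imkM p q : imk (p * q) =
  re p * imk q + imi p * imj q - imj p * imi q + imk p * re q.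
Proof. exact: imk_Quat. Qed.

Definition qcoordE := (reN, imiN, imjN, imkN, re0, imi0, imj0, imk0, re1, imi1, imj1,
  imk1, reM, imiM, imjM, imkM, @quatDE R, @quatZE R, @QuatE R).

Lemma dot_ge0 q : 0 <= dot q q.
Proof. by rewrite /dot -!expr2 !addr_ge0 ?sqr_ge0. Qed.

Lemma im_norm_sqr q : im_norm q ^+ 2 = dot q q.
Proof. exact: sqr_sqrtr (dot_ge0 q). Qed.

Lemma imag_unitP J : imag_unit J <-> re J = 0 /\ dot J J = 1.
Proof.
rewrite /imag_unit /=; split => [H|[r0 d1]].
  have /= r := congr1 re H; have /= i := congr1 imi H.
  have /= j := congr1 imj H; have /= k := congr1 imk H.
  rewrite !qcoordE in r i j k.
  suff r0 : re J = 0.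
    by split=> //; move: r; rewrite r0 /dot; lra.
  apply/eqP/negPn/negP => rn0.
  have c0 x : re J * x + x * re J = 0 -> x = 0.
    move=> h; have /eqP : re J * x = 0 by lra.
    by rewrite mulf_eq0 (negbTE rn0)/= => /eqP.
  have i0 : imi J = 0 by apply: c0; rewrite -[RHS]oppr0 -i; ring.
  have j0 : imj J = 0 by apply: c0; rewrite -[RHS]oppr0 -j; ring.
  have k0 : imk J = 0 by apply: c0; rewrite -[RHS]oppr0 -k; ring.
  move: r; rewrite i0 j0 k0 !mulr0 !subr0 => r.
  have : 0 <= re J * re J by rewrite -expr2 sqr_ge0.
  by rewrite r; lra.
move: d1; rewrite /dot => d1.
by apply: quatP; rewrite !qcoordE r0; lra.
Qed.

Lemma imag_unitN J : imag_unit J -> imag_unit (- J).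
Proof. by rewrite /imag_unit/= mulrNN. Qed.

Lemma qi_imag_unit : imag_unit (qi : quat R).
Proof. by apply/imag_unitP; rewrite /dot !qcoordE; split; ring. Qed.
Lemma qj_imag_unit : imag_unit (qj : quat R).
Proof. by apply/imag_unitP; rewrite /dot !qcoordE; split; ring. Qed.
Lemma qk_imag_unit : imag_unit (qk : quat R).
Proof. by apply/imag_unitP; rewrite /dot !qcoordE; split; ring. Qed.

Lemma polar_qpoint a b J : imag_unit J -> polar (qpoint a b J) = (a, `|b|).
Proof.
move=> /imag_unitP[r0 d1]; congr pair.
  by rewrite /qpoint !qcoordE r0; ring.
rewrite /im_norm -sqrtr_sqr; congr Num.sqrt.
rewrite -[RHS]mulr1 -d1 /dot /qpoint !qcoordE; ring.
Qed.

Lemma polar_surj q : exists2 J, imag_unit J & q = qpoint (re q) (im_norm q) J.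
Proof.
have [n0|n0] := eqVneq (im_norm q) 0.
  exists qi; first exact: qi_imag_unit.
  have := im_norm_sqr q; rewrite n0 expr0n /= /dot => d0.
  have i2 := sqr_ge0 (imi q); have j2 := sqr_ge0 (imj q); have k2 := sqr_ge0 (imk q).
  have sq0 x : x ^+ 2 = 0 -> x = 0 :> R by move=> /eqP; rewrite sqrf_eq0 => /eqP.
  have i0 : imi q = 0 by apply: sq0; lra.
  have j0 : imj q = 0 by apply: sq0; lra.
  have k0 : imk q = 0 by apply: sq0; lra.
  by apply: quatP; rewrite /qpoint !qcoordE ?i0 ?j0 ?k0; ring.
exists ((im_norm q)^-1 *: vec q).
  apply/imag_unitP; split; first by rewrite /vec !qcoordE mulr0.
  have := im_norm_sqr q; rewrite /dot /vec !qcoordE => d.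
  transitivity ((im_norm q)^-1 ^+ 2 * (imi q * imi q + imj q * imj q + imk q * imk q)); first by ring.
  by rewrite -d -exprMn mulVf ?expr1n.
by apply: quatP; rewrite /qpoint /vec !qcoordE; field.
Qed.

Lemma circ1P (E : set (R * R)) q : conj1_invariant E -> circ1 E q <-> E (polar q).
Proof.
move=> cE; split=> [[w [J [Ew uJ ->]]]|Eq].
  rewrite (polar_qpoint _ _ uJ); case: (ger0P w.2) => _; first by case: w Ew.
  exact: (cE w).1 Ew.
have [J uJ qE] := polar_surj q.
by exists (polar q), J.
Qed.

Lemma qpoint_re q J : im_norm q = 0 -> q = qpoint (re q) 0 J.
Proof.
move=> n0; have [J' _ ->] := polar_surj q; rewrite n0.
by apply: quatP; rewrite /qpoint !qcoordE; ring.
Qed.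

Lemma qpoint_vec q : im_norm q != 0 -> imag_unit ((im_norm q)^-1 *: vec q) /\
  q = qpoint (re q) (im_norm q) ((im_norm q)^-1 *: vec q).
Proof.
move=> n0; split; last by apply: quatP; rewrite /qpoint /vec !qcoordE; field.
apply/imag_unitP; split; first by rewrite /vec !qcoordE mulr0.
have := im_norm_sqr q; rewrite /dot /vec !qcoordE => d.
transitivity ((im_norm q)^-1 ^+ 2 * (imi q * imi q + imj q * imj q + imk q * imk q)); first by ring.
by rewrite -d -exprMn mulVf ?expr1n.
Qed.

End QuatGeometry.

Section QuatDerivatives.
Context {R : realType}.

Section Generic.
Context {V : normedModType R}.
Implicit Types (z d : V).

Lemma qis_derive4 (G : V -> quat R) z d dG :
  is_derive z d G dG <->
  [/\ is_derive z d (fun y => re (G y)) (re dG), is_derive z d (fun y => imi (G y)) (imi dG),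
      is_derive z d (fun y => imj (G y)) (imj dG) & is_derive z d (fun y => imk (G y)) (imk dG)].
Proof.
split=> [/qis_derive_comp H|[h0 h1 h2 h3]].
  by split; apply: H.
apply/qis_derive_comp => m; rewrite -(inord_val m).
by case: m => [[|[|[|[|m]]]] hm].
Qed.

Lemma qis_deriveM (p r : V -> quat R) z d dp dr :
  is_derive z d p dp -> is_derive z d r dr ->
  is_derive z d (fun y => p y * r y) (dp * r z + p z * dr).
Proof.
move=> /qis_derive4[p0 p1 p2 p3] /qis_derive4[r0 r1 r2 r3].
apply/qis_derive4; split.
- under eq_fun do rewrite !qcoordE.
  by apply: is_derive_eq; rewrite !qcoordE !scale_real; ring.
- under eq_fun do rewrite !qcoordE.
  by apply: is_derive_eq; rewrite !qcoordE !scale_real; ring.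
- under eq_fun do rewrite !qcoordE.
  by apply: is_derive_eq; rewrite !qcoordE !scale_real; ring.
- under eq_fun do rewrite !qcoordE.
  by apply: is_derive_eq; rewrite !qcoordE !scale_real; ring.
Qed.

Lemma qis_deriveZ (s : V -> R) (r : V -> quat R) z d (ds : R) dr :
  is_derive z d s ds -> is_derive z d r dr ->
  is_derive z d (fun y => s y *: r y) (ds *: r z + s z *: dr).
Proof.
move=> hs /qis_derive4[r0 r1 r2 r3].
apply/qis_derive4; split.
- under eq_fun do rewrite !qcoordE.
  by apply: is_derive_eq; rewrite !qcoordE !scale_real; ring.
- under eq_fun do rewrite !qcoordE.
  by apply: is_derive_eq; rewrite !qcoordE !scale_real; ring.
- under eq_fun do rewrite !qcoordE.
  by apply: is_derive_eq; rewrite !qcoordE !scale_real; ring.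
- under eq_fun do rewrite !qcoordE.
  by apply: is_derive_eq; rewrite !qcoordE !scale_real; ring.
Qed.

End Generic.

Implicit Types (q e : quat R).

Lemma linear_is_derive (W : normedModType R) (L : quat R -> W) q e :
  (forall s x y, L (s *: x + y) = s *: L x + L y) -> is_derive q e L (L e).
Proof.
move=> LD; apply: is_derive_of_line.
have -> : (fun s : R => L (s *: e + q)) = (fun s : R => s *: L e + L q).
  by apply/funext => s; rewrite LD.
split.
  apply: derivableD; last exact: derivable_cst.
  exact/derivable1_diffP.
rewrite deriveD; last exact: derivable_cst.
  rewrite derive_cst addr0 deriveE//.
  by rewrite diff_val scale1r.
exact/derivable1_diffP.
Qed.

Lemma imi_is_derive q e : is_derive q e (@imi R) (imi e).
Proof. by apply: linear_is_derive => s x y; rewrite !qcoordE. Qed.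
Lemma imj_is_derive q e : is_derive q e (@imj R) (imj e).
Proof. by apply: linear_is_derive => s x y; rewrite !qcoordE. Qed.
Lemma imk_is_derive q e : is_derive q e (@imk R) (imk e).
Proof. by apply: linear_is_derive => s x y; rewrite !qcoordE. Qed.

Lemma vec_is_derive q e : is_derive q e (@vec R) (vec e).
Proof.
apply: linear_is_derive => s x y.
by apply: quatP; rewrite /vec !qcoordE; ring.
Qed.

Lemma dot_is_derive q e p : is_derive q e (dot^~ p) (dot e p).
Proof. by apply: linear_is_derive => s x y; rewrite /dot !qcoordE scale_real; ring. Qed.

Lemma im_norm_is_derive q e : im_norm q != 0 -> is_derive q e (@im_norm R) (dot q e / im_norm q).
Proof.
move=> n0; apply: is_derive_of_line.
have d0 : 0 < dot q q by rewrite lt0r dot_ge0 andbT -im_norm_sqr expf_neq0.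
have i := imi_is_derive q e; have j := imj_is_derive q e; have k := imk_is_derive q e.
have D : is_derive (0 : R) (1 : R) (fun s : R => dot (s *: e + q) (s *: e + q)) (2 * dot q e).
  have -> : (fun s : R => dot (s *: e + q) (s *: e + q)) =
     (fun s : R => s * (s * dot e e) + s * (2 * dot q e) + dot q q).
    by apply/funext => s; rewrite /dot !qcoordE; ring.
  by apply: is_derive_eq; rewrite !scale_real; ring.
have S : is_derive ((fun s : R => dot (s *: e + q) (s *: e + q)) 0) (1 : R) Num.sqrt (2 * im_norm q)^-1.
  by rewrite scale0r add0r; exact: is_derive1_sqrt.
have := @is_derive1_comp R Num.sqrt (fun s : R => dot (s *: e + q) (s *: e + q)) 0 _ _ S D.
by rewrite (_ : _ * _ = dot q e / im_norm q)//; field.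
Qed.

Lemma re_continuous : continuous (@re R).
Proof. by move=> q; exact: coord_continuous. Qed.
Lemma imi_continuous : continuous (@imi R).
Proof. by move=> q; exact: coord_continuous. Qed.
Lemma imj_continuous : continuous (@imj R).
Proof. by move=> q; exact: coord_continuous. Qed.
Lemma imk_continuous : continuous (@imk R).
Proof. by move=> q; exact: coord_continuous. Qed.

Lemma dot_continuous : continuous (fun q : quat R => dot q q).
Proof.
move=> q; have ci := @imi_continuous q; have cj := @imj_continuous q; have ck := @imk_continuous q.
exact: (cvgD (cvgD (cvgM ci ci) (cvgM cj cj)) (cvgM ck ck)).
Qed.

Lemma im_norm_continuous : continuous (@im_norm R).
Proof.
move=> q; apply: (@continuous_comp _ _ _ (fun q => dot q q) Num.sqrt); last exact: sqrt_continuous.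
exact: dot_continuous.
Qed.

Lemma polar_continuous : continuous (@polar R).
Proof.
move=> q; have cr := @re_continuous q; have cn := @im_norm_continuous q.
exact: (cvg_pair cr cn).
Qed.

End QuatDerivatives.

(** * Slice functions of one variable in polar form *)

Section PolarCalculus.
Context {R : realType}.
Implicit Types (q e J : quat R) (w : R * R).

Definition ax : R * R := (1, 0).
Definition ay : R * R := (0, 1).

Lemma fin_dim_plane : @fin_dim R (R * R)%type.
Proof.
exists bool, [:: true; false], (fun i : bool => if i then ax else ay), (fun (i : bool) (w : R * R) => if i then w.1 else w.2).
split.
- by case=> w; [exact: cont_fst|exact: cont_snd].
- by case.
- move=> [x y]; rewrite !big_cons big_nil addr0 /=.
  by congr pair; rewrite /= ?scale_real /=; ring.
Qed.

Lemma polar_chain (E : set (R * R)) (F : R * R -> quat R) q e Fa Fb :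
  class_C1 E F -> E (polar q) -> im_norm q != 0 ->
  is_derive (polar q) ax F Fa -> is_derive (polar q) ay F Fb ->
  is_derive q e (fun p => F (polar p)) (re e *: Fa + (dot q e / im_norm q) *: Fb).
Proof.
move=> CF Eq n0 dFa dFb.
have [oE CFm] := (class_C1_comp E F fin_dim_plane).1 CF.
apply/qis_derive_comp => m; apply: is_derive_of_line.
have -> : (fun s : R => qcomp m (fun p => F (polar p)) (s *: e + q)) =
  (fun s : R => qcomp m F ((s * re e) *: ax + ((im_norm (s *: e + q) - im_norm q) *: ay + polar q))).
  apply/funext => s; rewrite /qcomp; congr (F _ 0 m).
  rewrite /polar /ax /ay; congr pair; rewrite /= ?scale_real ?qcoordE; ring.
have [_ da] := (qis_derive_comp F (polar q) ax Fa).1 dFa m.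
have [_ db] := (qis_derive_comp F (polar q) ay Fb).1 dFb m.
rewrite !mxE -da -db.
apply: (@C1_chain _ _ E (qcomp m F) ax ay (polar q) (fun s => s * re e)
  (fun s => im_norm (s *: e + q) - im_norm q) 0 _ _ (CFm m) Eq).
- by rewrite mul0r.
- by rewrite scale0r add0r subrr.
- by apply: is_derive_eq; rewrite scaler0 add0r scale_real mulr1.
- have H : is_derive (0 : R) (1 : R) (fun s : R => im_norm (s *: e + q)) (dot q e / im_norm q).
    by apply: is_derive_line; rewrite scale0r add0r; exact: im_norm_is_derive.
  by apply: is_derive_eq; rewrite subr0.
Qed.

Definition inv_y (F : R * R -> quat R) w : quat R := (w.2)^-1 *: F w.

Local Notation off E := (E `&` [set w : R * R | w.2 != 0]).

Lemma snd_lin (s : R) (d z : R * R) : (s *: d + z).2 = s * d.2 + z.2.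
Proof. by []. Qed.

Lemma snd_cont : continuous (@snd R R).
Proof. by move=> w; exact: cont_snd. Qed.

Lemma inv_y_C1 (E : set (R * R)) F : class_C1 E F -> class_C1 (off E) (inv_y F).
Proof.
move=> /(class_C1_comp E F fin_dim_plane)[oE CF].
have oo := off_axis_open snd_cont oE.
apply/(class_C1_comp _ _ fin_dim_plane); split; first exact: oo.
move=> m; have -> : qcomp m (inv_y F) = (fun w => (w.2)^-1 * qcomp m F w).
  by apply/funext => w; rewrite /qcomp /inv_y mxE.
apply: C1M; first exact: (invl_C1 snd_lin snd_cont oE).
by apply: C1_sub (CF m) => // w [].
Qed.

Lemma inv_y_derive F w Fa Fb : w.2 != 0 -> is_derive w ax F Fa -> is_derive w ay F Fb ->
  is_derive w ax (inv_y F) ((w.2)^-1 *: Fa) /\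
  is_derive w ay (inv_y F) ((w.2)^-1 *: Fb - (w.2)^-1 ^+ 2 *: F w).
Proof.
move=> w0 da db.
have ia := invl_is_derive snd_lin ax w0; have ib := invl_is_derive snd_lin ay w0.
split.
  have := qis_deriveZ ia da; rewrite /= mulr0 scale0r add0r; exact.
have := qis_deriveZ ib db; rewrite /= mulr1 scaleNr addrC exprVn; exact.
Qed.

(** At a real point [polar] is not differentiable. The derivative along [e]
    only depends on the restriction to a line, and there the unit [c] of a
    slice function is constant. *)
Lemma line_derive (E : set (R * R)) (P Q : R * R -> quat R) (Phi : quat R -> quat R)
    (d : R * R) q e c w Pd Qd : open E ->
  is_derive w d P Pd -> is_derive w d Q Qd ->
  (forall s : R, E (s *: d + w) -> Phi (s *: e + q) = P (s *: d + w) + c * Q (s *: d + w)) ->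
  E w -> is_derive q e Phi (Pd + c * Qd).
Proof.
move=> oE hP hQ H Ew; apply: is_derive_of_line.
apply: (@near_eq_is_derive _ _ _ (fun s : R => P (s *: d + w) + c * Q (s *: d + w))).
  have cs : {for (0 : R), continuous (fun s : R => s *: d + w)}.
    by apply: cvgD; [apply: cvgZr_tmp; exact: cvg_id|exact: cvg_cst].
  have : \forall s \near (0 : R), E (s *: d + w).
    apply: cs; rewrite scale0r add0r; exact: (near_open oE Ew).
  by apply: filterS => s Es; rewrite H.
have lP : is_derive (0 : R) (1 : R) (fun s : R => P (s *: d + w)) Pd.
  by apply: is_derive_line; rewrite scale0r add0r.
have lQ : is_derive (0 : R) (1 : R) (fun s : R => Q (s *: d + w)) Qd.
  by apply: is_derive_line; rewrite scale0r add0r.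
have lc := qis_deriveM (is_derive_cst c (0 : R) (1 : R)) lQ.
rewrite mul0r add0r in lc.
exact: is_deriveD lP lc.
Qed.

Section Induced.
Variables (E : set (R * R)) (P Q Pa Pb Qa Qb : R * R -> quat R) (Phi : quat R -> quat R).
Hypothesis cE : conj1_invariant E.
Hypothesis CP : class_C1 E P.
Hypothesis CQ : class_C1 E Q.
Hypothesis dP : forall w, E w -> is_derive w ax P (Pa w) /\ is_derive w ay P (Pb w).
Hypothesis dQ : forall w, E w -> is_derive w ax Q (Qa w) /\ is_derive w ay Q (Qb w).
Hypothesis ind : induces1 E P Q Phi.

Let oE : open E. Proof. by have [] := CP. Qed.

Lemma induced_derive1 w J : E w -> imag_unit J ->
  is_derive (qpoint w.1 w.2 J) 1 Phi (Pa w + J * Qa w).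
Proof.
move=> Ew uJ; have [_ _ H] := ind.
apply: (line_derive oE (dP Ew).1 (dQ Ew).1 _ Ew) => s Es.
rewrite -H//; congr Phi.
by apply: quatP; rewrite /qpoint /= ?scale_real !qcoordE; ring.
Qed.

Lemma induced_derive_unit w J : E w -> imag_unit J ->
  is_derive (qpoint w.1 w.2 J) J Phi (Pb w + J * Qb w).
Proof.
move=> Ew uJ; have [_ _ H] := ind.
apply: (line_derive oE (dP Ew).2 (dQ Ew).2 _ Ew) => s Es.
rewrite -H//; congr Phi.
by apply: quatP; rewrite /qpoint /= ?scale_real !qcoordE; ring.
Qed.

(** Off the real axis the unit is [vec q / im_norm q], which depends on [q]:
    the quotient is put with [Q], and the factor [vec q] is linear. *)
Lemma induced_off q : E (polar q) -> im_norm q != 0 ->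
  Phi q = P (polar q) + vec q * inv_y Q (polar q).
Proof.
move=> Eq n0; have [uJ qE] := qpoint_vec n0; have [_ _ H] := ind.
rewrite {1}qE (H (polar q) _ Eq uJ) /inv_y /=; congr (_ + _).
by apply: quatP; rewrite !qcoordE; ring.
Qed.

Lemma near_off q : E (polar q) -> im_norm q != 0 ->
  \forall p \near q, E (polar p) /\ im_norm p != 0.
Proof.
move=> Eq n0.
have oo := off_axis_open snd_cont oE.
have : \forall w \near polar q, off E w by apply: near_open.
by move=> h; exact: (@polar_continuous R q _ h).
Qed.

Lemma induced_derive_off q e : E (polar q) -> im_norm q != 0 -> re e = 0 ->
  is_derive q e Phi (dot q e *: ((im_norm q)^-1 *: Pb (polar q)) +
    (e * ((im_norm q)^-1 *: Q (polar q)) + vec q * (dot q e *: ((im_norm q)^-1 *: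
      ((im_norm q)^-1 *: Qb (polar q) - (im_norm q)^-1 ^+ 2 *: Q (polar q)))))).
Proof.
move=> Eq n0 re0.
apply: (@near_eq_is_derive _ _ _ (fun p => P (polar p) + vec p * inv_y Q (polar p))).
  by apply: filterS (near_off Eq n0) => p [Ep p0]; rewrite induced_off.
have [da db] := dP Eq.
have [ea eb] := @inv_y_derive Q (polar q) _ _ n0 (dQ Eq).1 (dQ Eq).2.
have h1 := @polar_chain E P q e _ _ CP Eq n0 da db.
have h2 := @polar_chain (off E) (inv_y Q) q e _ _ (inv_y_C1 CQ) (conj Eq n0) n0 ea eb.
have h3 := qis_deriveM (vec_is_derive q e) h2.
have := is_deriveD h1 h3.
rewrite re0 !scale0r !add0r !scalerA.
have -> : vec e = e by apply: quatP; rewrite /vec !qcoordE.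
exact.
Qed.

End Induced.
End PolarCalculus.

(** * The Fueter map in one variable *)

Section FueterOneVariable.
Context {R : realType}.
Implicit Types (q e J : quat R) (w : R * R).

Definition lap1 (g : quat R -> quat R) q : quat R :=
  'D_1 ('D_1 g) q + 'D_qi ('D_qi g) q + 'D_qj ('D_qj g) q + 'D_qk ('D_qk g) q.

Definition dbar1 (g : quat R -> quat R) q : quat R :=
  'D_1 g q + qi * 'D_qi g q + qj * 'D_qj g q + qk * 'D_qk g q.

Lemma parity_derive (E : set (R * R)) (F : R * R -> quat R) (c : R) w Fa Fa' : open E ->
  (forall w, E w -> F (conj1 w) = c *: F w) -> E w ->
  is_derive w ax F Fa -> is_derive (conj1 w) ax F Fa' -> Fa' = c *: Fa.
Proof.
move=> oE HF Ew hF [_ <-].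
suff [] : is_derive (conj1 w) ax F (c *: Fa) by [].
apply: is_derive_of_line.
apply: (@near_eq_is_derive _ _ _ (fun s : R => c *: F (s *: ax + w))).
  have cs : {for (0 : R), continuous (fun s : R => s *: ax + w)}.
    by apply: cvgD; [apply: cvgZr_tmp; exact: cvg_id|exact: cvg_cst].
  have : \forall s \near (0 : R), E (s *: ax + w).
    apply: cs; rewrite scale0r add0r; exact: (near_open oE Ew).
  apply: filterS => s Es; rewrite -HF//; congr F.
  by rewrite /conj1 /ax; congr pair; rewrite /= ?scale_real; ring.
have lF : is_derive (0 : R) (1 : R) (fun s : R => F (s *: ax + w)) Fa.
  by apply: is_derive_line; rewrite scale0r add0r.
have := qis_deriveZ (is_derive_cst c (0 : R) (1 : R)) lF.
rewrite scale0r add0r; exact.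
Qed.

Ltac gen_coords q := move: (re q) (imi q) (imj q) (imk q) => ? ? ? ?.

(** The terms are the second derivatives of a slice function along the three
    imaginary units, up to a common summand; their sum depends on the
    direction of [vec q] through a left factor [vec q] only. *)
Lemma sum_directions q (r : R) (F1 F2 F3 F4 : quat R) :
  (imi q *: ((r * imi q) *: F1 + qi * F2 + vec q * ((r * imi q) *: F3)) + qi * ((r * imi q) *: F4))
  + (imj q *: ((r * imj q) *: F1 + qj * F2 + vec q * ((r * imj q) *: F3)) + qj * ((r * imj q) *: F4))
  + (imk q *: ((r * imk q) *: F1 + qk * F2 + vec q * ((r * imk q) *: F3)) + qk * ((r * imk q) *: F4))
  = (r * dot q q) *: F1 + vec q * (F2 + (r * dot q q) *: F3 + r *: F4).
Proof.
by apply: quatP; rewrite /vec /dot /qi /qj /qk !qcoordE;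
  gen_coords q; gen_coords F1; gen_coords F2; gen_coords F3; gen_coords F4; ring.
Qed.

Lemma vecE q : vec q = imi q *: qi + imj q *: qj + imk q *: qk.
Proof. by apply: quatP; rewrite /vec /qi /qj /qk !qcoordE; ring. Qed.

Lemma vec_sqr q : vec q * vec q = - (dot q q *: 1).
Proof. by apply: quatP; rewrite /vec /dot !qcoordE; ring. Qed.

Lemma mul_direction e x (c : R) (F1 F2 F3 : quat R) : imag_unit e ->
  e * (c *: F1 + (e * F2 + x * (c *: F3))) = (c *: e) * F1 - F2 + (c *: e) * x * F3.
Proof.
move=> ue; rewrite !mulrDr (mulrA e e) [e * e]ue mulN1r addrA; congr (_ - _ + _).
  by rewrite -scalerAl -scalerAr.
by rewrite -!scalerAl -!scalerAr mulrA.
Qed.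

(** The same for the first derivatives, each multiplied by its unit; the
    summand [3 *: F2] comes from the squares of the three units. *)
Lemma sum_directions1 q (F1 F2 F3 : quat R) :
  qi * (imi q *: F1 + (qi * F2 + vec q * (imi q *: F3)))
  + qj * (imj q *: F1 + (qj * F2 + vec q * (imj q *: F3)))
  + qk * (imk q *: F1 + (qk * F2 + vec q * (imk q *: F3)))
  = vec q * F1 - 3 *: F2 - dot q q *: F3.
Proof.
rewrite !mul_direction; [|exact: qk_imag_unit|exact: qj_imag_unit|exact: qi_imag_unit].
have -> : vec q * F1 - 3 *: F2 - dot q q *: F3 =
    vec q * F1 - (F2 + F2 + F2) + vec q * vec q * F3.
  rewrite vec_sqr mulNr -scalerAl mul1r; congr (_ - _ - _).
  by apply/rowP => m; rewrite !mxE; ring.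
move: (vec q) (vecE q) => x ->; rewrite !mulrDl.
by apply/rowP => m; rewrite !mxE; ring.
Qed.

Lemma dot_qi q : dot q qi = imi q. Proof. by rewrite /dot /qi !qcoordE; ring. Qed.
Lemma dot_qj q : dot q qj = imj q. Proof. by rewrite /dot /qj !qcoordE; ring. Qed.
Lemma dot_qk q : dot q qk = imk q. Proof. by rewrite /dot /qk !qcoordE; ring. Qed.

Variables (E : set (R * R)) (u v ua va uaa vaa uaaa vaaa : R * R -> quat R) (g : quat R -> quat R).
Hypothesis cE : conj1_invariant E.
Hypothesis T : tower ax ay E u v ua va uaa vaa uaaa vaaa.
Hypothesis u_even : forall w, E w -> u (conj1 w) = u w.
Hypothesis v_odd : forall w, E w -> v (conj1 w) = - v w.
Hypothesis ind : induces1 E u v g.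

Let fP := @fin_dim_plane R.
Let C1_0 := QHol_C1 fP (tower0 T).
Let C1_1 := QHol_C1 fP (tower1 T).

Let oE : open E. Proof. by have [[]] := C1_0. Qed.

Let d0 w : E w -> (is_derive w ax u (ua w) /\ is_derive w ay u (- va w)) /\
  (is_derive w ax v (va w) /\ is_derive w ay v (ua w)).
Proof. by move=> /(QHol_is_derive (tower0 T))[]. Qed.
Let d1 w : E w -> (is_derive w ax ua (uaa w) /\ is_derive w ay ua (- vaa w)) /\
  (is_derive w ax va (vaa w) /\ is_derive w ay va (uaa w)).
Proof. by move=> /(QHol_is_derive (tower1 T))[]. Qed.

Let odd_axis (F : R * R -> quat R) : (forall w, E w -> F (conj1 w) = - F w) ->
  forall w, E w -> w.2 = 0 -> F w = 0.
Proof.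
move=> HF [x y] Ew /= y0; have := HF _ Ew; rewrite /conj1 /= y0 oppr0 => /eqP.
by rewrite -addr_eq0 -mulr2n -scaler_nat scaler_eq0 pnatr_eq0/= => /eqP.
Qed.

Let conjE w : E w -> E (conj1 w). Proof. exact: (cE w).1. Qed.

Lemma ua_even w : E w -> ua (conj1 w) = ua w.
Proof.
move=> Ew; rewrite -[RHS]scale1r.
apply: (parity_derive oE _ Ew (d0 Ew).1.1 (d0 (conjE Ew)).1.1).
by move=> y Ey; rewrite scale1r u_even.
Qed.

Lemma va_odd w : E w -> va (conj1 w) = - va w.
Proof.
move=> Ew; rewrite -scaleN1r.
apply: (parity_derive oE _ Ew (d0 Ew).2.1 (d0 (conjE Ew)).2.1).
by move=> y Ey; rewrite scaleN1r v_odd.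
Qed.

Lemma vaa_odd w : E w -> vaa (conj1 w) = - vaa w.
Proof.
move=> Ew; rewrite -scaleN1r.
apply: (parity_derive oE _ Ew (d1 Ew).2.1 (d1 (conjE Ew)).2.1).
by move=> y Ey; rewrite scaleN1r va_odd.
Qed.

(** The components of [2 (- D_alpha + J D_beta) (v / beta)], with their limits
    on the real axis. *)
Definition fueterA w : quat R := (-2) *: sphA snd va uaa w.
Definition fueterB w : quat R := 2 *: sphB snd v ua w.

Let v_axis := odd_axis v_odd.

Lemma fueterA_even w : E w -> fueterA (conj1 w) = fueterA w.
Proof.
move=> Ew; rewrite /fueterA /sphA /= oppr_eq0; congr (_ *: _); case: eqP => [w0|_].
  by case: w w0 Ew => x y /= -> _; rewrite /conj1 oppr0.
by rewrite va_odd// invrN scaleNr scalerN opprK.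
Qed.

Lemma fueterB_odd w : E w -> fueterB (conj1 w) = - fueterB w.
Proof.
move=> Ew; rewrite /fueterB /sphB /= oppr_eq0 -[RHS]scalerN; congr (_ *: _); case: eqP => [w0|_].
  by rewrite oppr0.
by rewrite ua_even// v_odd// invrN !scaleNr scalerN opprK.
Qed.

Let CAB := qsph_C1 fP snd_lin snd_cont (erefl : ax.2 = 0) (erefl : ay.2 = 1) T v_axis.

Let class_C1Z (k : R) (F : R * R -> quat R) : class_C1 E F -> class_C1 E (fun w => k *: F w).
Proof.
move=> [oE' H]; split; [exact: oE'|] => d w Ew; have [dF cF] := H d w Ew.
split; first exact: derivableZ.
apply: (@continuous_for_eq _ _ (fun y => k *: 'D_d F y)).
  apply: filterS (near_open oE' Ew) => y Ey.
  by apply/esym; apply: deriveZ; exact: (H d y Ey).1.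
exact: cvgZl_tmp cF.
Qed.

Lemma fueterA_C1 : class_C1 E fueterA. Proof. exact: class_C1Z CAB.1. Qed.
Lemma fueterB_C1 : class_C1 E fueterB. Proof. exact: class_C1Z CAB.2. Qed.

(* The derivative of a slice regular function along [1] is the slice function
   of the derivative of its pair, so that it can be iterated. *)
Let ind1 : induces1 E ua va ('D_1 g).
Proof.
split; [exact: ua_even|exact: va_odd|] => w J Ew uJ.
have [_ ->] := induced_derive1 C1_0.1 (fun w Ew => (d0 Ew).1) (fun w Ew => (d0 Ew).2) ind Ew uJ.
by [].
Qed.

Lemma g_derivable1 w J : E w -> imag_unit J -> derivable g (qpoint w.1 w.2 J) 1.
Proof.
move=> Ew uJ.
by have [] := induced_derive1 C1_0.1 (fun w Ew => (d0 Ew).1) (fun w Ew => (d0 Ew).2) ind Ew uJ.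
Qed.

Lemma g_derive11 w J : E w -> imag_unit J ->
  is_derive (qpoint w.1 w.2 J) 1 ('D_1 g) (uaa w + J * vaa w).
Proof.
move=> Ew uJ.
exact: (induced_derive1 C1_1.1 (fun w Ew => (d1 Ew).1) (fun w Ew => (d1 Ew).2) ind1 Ew uJ).
Qed.

(** The direction [J] lies in the plane [R + R J] of the point. A real point is
    in all these planes, and there every imaginary direction is covered. *)
Lemma g_derive_line w J : E w -> imag_unit J ->
  is_derive (qpoint w.1 w.2 J) J g (- va w + J * ua w).
Proof.
move=> Ew uJ.
exact: (induced_derive_unit C1_0.1 (fun w Ew => (d0 Ew).1) (fun w Ew => (d0 Ew).2) ind Ew uJ).
Qed.

Lemma g_derive_line2 w J : E w -> imag_unit J -> w.2 = 0 ->
  is_derive (qpoint w.1 w.2 J) J ('D_J g) (- uaa w).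
Proof.
move=> Ew uJ w0.
have vaa0 : vaa w = 0 by exact: (odd_axis vaa_odd).
have := @line_derive R E (fun w => - va w) ua ('D_J g) ay (qpoint w.1 w.2 J) J J w
  (- uaa w) (- vaa w) oE _ (d1 Ew).1.2.
rewrite vaa0 oppr0 mulr0 addr0; apply; [exact: is_deriveN (d1 Ew).2.2| |exact: Ew].
move=> s Es.
have := g_derive_line Es uJ.
rewrite (_ : qpoint (s *: ay + w).1 (s *: ay + w).2 J = s *: J + qpoint w.1 w.2 J); first by case.
by apply: quatP; rewrite /qpoint /= ?scale_real !qcoordE; ring.
Qed.

(** The result is arranged as a combination of functions of [polar q] with
    coefficients polynomial in [q], ready to be differentiated once more. *)
Lemma g_derive_off q e : E (polar q) -> im_norm q != 0 -> re e = 0 ->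
  is_derive q e g (dot q e *: (- inv_y va (polar q) + vec q * inv_y (sphB snd v ua) (polar q))
    + e * inv_y v (polar q)).
Proof.
move=> Eq n0 re0.
have := induced_derive_off C1_0.1 C1_0.2 (fun w Ew => (d0 Ew).1) (fun w Ew => (d0 Ew).2) ind Eq n0 re0.
rewrite (_ : _ + (_ + _) = dot q e *: (- inv_y va (polar q) + vec q * inv_y (sphB snd v ua) (polar q))
    + e * inv_y v (polar q))//.
rewrite /inv_y /sphB /= (negbTE n0).
by apply: quatP; rewrite !qcoordE; ring.
Qed.

Local Notation sB := (sphB snd v ua).

Let sph_off w : E w -> w.2 != 0 ->
  (is_derive w ax (sphA snd va uaa) ((w.2)^-1 *: vaa w) /\
   is_derive w ay (sphA snd va uaa) ((w.2)^-1 *: uaa w - (w.2)^-1 ^+ 2 *: va w)) /\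
  (is_derive w ax sB ((w.2)^-1 *: uaa w - (w.2)^-1 ^+ 2 *: va w) /\
   is_derive w ay sB (- (w.2)^-1 *: vaa w - (2 * (w.2)^-1) *: sB w)).
Proof.
move=> Ew w0; have [h1 h2 h3 h4] := qsph_off snd_lin snd_cont (erefl : ax.2 = 0) (erefl : ay.2 = 1) T Ew w0.
by split; split => //; rewrite /sphB (negbTE w0).
Qed.

Let sB_off w : w.2 != 0 -> (w.2)^-1 *: ua w - (w.2)^-1 ^+ 2 *: v w = sB w.
Proof. by move=> w0; rewrite /sphB (negbTE w0) scalerBr scalerA. Qed.

Let sph_axis w : E w -> w.2 = 0 ->
  (is_derive w ax (sphA snd va uaa) (uaaa w) /\ is_derive w ay (sphA snd va uaa) 0) /\
  (is_derive w ax sB 0 /\ is_derive w ay sB (- (3^-1 *: uaaa w))).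
Proof.
move=> Ew w0; have [h1 h2 h3 h4] := qsph_axis snd_lin snd_cont (erefl : ax.2 = 0) (erefl : ay.2 = 1) T v_axis Ew w0.
by [].
Qed.

Lemma g_derive2_off q e : E (polar q) -> im_norm q != 0 -> re e = 0 -> dot e e = 1 ->
  let w := polar q in let r := (im_norm q)^-1 in let t := r * dot q e in
  is_derive q e ('D_e g) ((- inv_y va w + vec q * inv_y sB w) +
    (dot q e *: (t *: (- (r *: uaa w - r ^+ 2 *: va w)) + e * inv_y sB w
       + vec q * (t *: (r *: (- r *: vaa w - (2 * r) *: sB w) - r ^+ 2 *: sB w)))
     + e * (t *: sB w))).
Proof.
move=> Eq n0 re0 ee w r t.
have vece : vec e = e by apply: quatP; rewrite /vec !qcoordE.
apply: (@near_eq_is_derive _ _ _ (fun p => dot p e *: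
   (- inv_y va (polar p) + vec p * inv_y sB (polar p)) + e * inv_y v (polar p))).
  by apply: filterS (near_off C1_0.1 Eq n0) => p [Ep p0]; have [_ ->] := g_derive_off Ep p0 re0.
have w0 : w.2 != 0 by exact: n0.
have off_w : (E `&` [set w : R * R | w.2 != 0]) w by [].
have dva := inv_y_derive w0 (d1 Eq).2.1 (d1 Eq).2.2.
have dv := inv_y_derive w0 (d0 Eq).2.1 (d0 Eq).2.2.
have dsB := inv_y_derive w0 (sph_off Eq w0).2.1 (sph_off Eq w0).2.2.
have h1 := polar_chain e (inv_y_C1 C1_1.2) off_w n0 dva.1 dva.2.
have h2 := polar_chain e (inv_y_C1 CAB.2) off_w n0 dsB.1 dsB.2.
have h3 := polar_chain e (inv_y_C1 C1_0.2) off_w n0 dv.1 dv.2.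
have h4 := qis_deriveM (vec_is_derive q e) h2.
have h5 := is_deriveD (is_deriveN h1) h4.
have h6 := qis_deriveZ (dot_is_derive q e e) h5.
have h7 := qis_deriveM (is_derive_cst e q e) h3.
have h8 := is_deriveD h6 h7.
apply: (is_derive_eq h8).
rewrite re0 !scale0r !add0r mul0r add0r ee scale1r vece -/w -/r.
have -> : r *: ua w - r ^+ 2 *: v w = sB w by exact: (sB_off w0).
rewrite (_ : dot q e / im_norm q = t); last by rewrite mulrC.
by rewrite scalerN -!addrA.
Qed.

(** In an orthonormal frame that contains [1] and the unit of [q], the second
    derivatives along these two cancel because [u] and [v] are harmonic, and
    the other two contribute the terms with a factor [1 / beta]. *)
Lemma lap1_off q : E (polar q) -> im_norm q != 0 ->
  lap1 g q = fueterA (polar q) + vec q * inv_y fueterB (polar q).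
Proof.
move=> Eq n0.
have [uJ qE] := qpoint_vec n0.
have h0 : 'D_1 ('D_1 g) q = uaa (polar q) + ((im_norm q)^-1 *: vec q) * vaa (polar q).
  by have := g_derive11 Eq uJ; rewrite /= -qE => -[].
have iU := (imag_unitP (qi : quat R)).1 qi_imag_unit.
have jU := (imag_unitP (qj : quat R)).1 qj_imag_unit.
have kU := (imag_unitP (qk : quat R)).1 qk_imag_unit.
have [_ h1] := g_derive2_off Eq n0 iU.1 iU.2.
have [_ h2] := g_derive2_off Eq n0 jU.1 jU.2.
have [_ h3] := g_derive2_off Eq n0 kU.1 kU.2.
rewrite [LHS](congr2 +%R (congr2 +%R (congr2 +%R h0 h1) h2) h3) dot_qi dot_qj dot_qk.
set w := polar q; set r := (im_norm q)^-1.
rewrite [LHS](_ : _ = uaa w + (r *: vec q) * vaa w +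
   3 *: (- inv_y va w + vec q * inv_y sB w) +
   ((r * dot q q) *: (- (r *: uaa w - r ^+ 2 *: va w)) + vec q * (inv_y sB w +
   (r * dot q q) *: (r *: (- r *: vaa w - (2 * r) *: sB w) - r ^+ 2 *: sB w) + r *: sB w))); last first.
  rewrite -sum_directions; set X := - inv_y va w + _.
  move: (X) => {}X; set X1 := _ + qi * _; set X2 := _ + qj * _; set X3 := _ + qk * _.
  move: (X1) (X2) (X3) (uaa w + _) => {}X1 {}X2 {}X3 Y.
  by apply/rowP => m; rewrite !mxE; ring.
rewrite -im_norm_sqr expr2 /r mulrA mulVf// mul1r -/r.
rewrite -scalerAl scalerAr scalerDr -addrA [3 *: (_ * _)]scalerAr.
rewrite [LHS](_ : _ = (uaa w + 3 *: (- inv_y va w) + im_norm q *: (- (r *: uaa w - r ^+ 2 *: va w))) +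
  vec q * (r *: vaa w + 3 *: inv_y sB w + (inv_y sB w +
   im_norm q *: (r *: (- r *: vaa w - (2 * r) *: sB w) - r ^+ 2 *: sB w) + r *: sB w))); last first.
  rewrite !mulrDr; move: (vec q * _) (vec q * _) => ? ?.
  by apply/rowP => m; rewrite !mxE; ring.
congr (_ + _ * _); apply/rowP => m.
  rewrite /fueterA /sphA /inv_y /= (negbTE n0) !mxE /r.
  by field.
rewrite /fueterB /inv_y !mxE /= /r.
by field.
Qed.

(** Each imaginary direction contributes [- uaa], which leaves
    [uaa - 3 uaa]. *)
Lemma lap1_axis w J : E w -> imag_unit J -> w.2 = 0 ->
  lap1 g (qpoint w.1 w.2 J) = fueterA w.
Proof.
move=> Ew uJ w0.
have vaa0 : vaa w = 0 by exact: (odd_axis vaa_odd).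
have [_ h0] := g_derive11 Ew uJ.
have any e : qpoint w.1 w.2 J = qpoint w.1 w.2 e by rewrite /qpoint w0 !scale0r.
have h e : imag_unit e -> 'D_e ('D_e g) (qpoint w.1 w.2 J) = - uaa w.
  by move=> ue; rewrite (any e); have [_] := g_derive_line2 Ew ue w0; exact.
rewrite [LHS](congr2 +%R (congr2 +%R (congr2 +%R h0 (h _ qi_imag_unit)) (h _ qj_imag_unit)) (h _ qk_imag_unit)).
rewrite vaa0 mulr0 addr0 /fueterA /sphA w0 eqxx.
by apply/rowP => m; rewrite !mxE; ring.
Qed.

Lemma lap1_induces : induces1 E fueterA fueterB (lap1 g).
Proof.
split; [exact: fueterA_even|exact: fueterB_odd|] => w J Ew uJ.
have [w0|w0] := eqVneq w.2 0.
  by rewrite lap1_axis// [fueterB w]/fueterB /sphB w0 eqxx scaler0 mulr0 addr0.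
have pE : polar (qpoint w.1 w.2 J) = (w.1, `|w.2|) := polar_qpoint _ _ uJ.
have n0 : im_norm (qpoint w.1 w.2 J) != 0 by have [_ ->] := pE; rewrite normr_eq0.
have Ep : E (polar (qpoint w.1 w.2 J)).
  by rewrite pE; case: (ger0P w.2) => _; [case: w Ew {w0 pE n0}|exact: conjE].
rewrite lap1_off// pE /inv_y /=.
(* [polar] replaces [w] by its conjugate when [w.2 < 0]: parity undoes this. *)
have -> : vec (qpoint w.1 w.2 J) = w.2 *: J.
  have [r0 _] := (imag_unitP J).1 uJ.
  by apply: quatP; rewrite /vec /qpoint !qcoordE ?r0; ring.
rewrite -scalerAl -scalerAr scalerA.
case: (ger0P w.2) => _.
  by rewrite mulfV// scale1r; case: w {Ew uJ w0 pE n0 Ep}.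
rewrite -[(w.1, - w.2)]/(conj1 w) fueterA_even// fueterB_odd//.
by rewrite mulrN scalerN invrN mulrN mulfV// scaleN1r opprK.
Qed.

Let dA w : E w -> is_derive w ax fueterA ('D_ax fueterA w) /\ is_derive w ay fueterA ('D_ay fueterA w).
Proof. by move=> Ew; split; apply: derivableP; exact: class_C1_derivable fueterA_C1 Ew. Qed.
Let dB w : E w -> is_derive w ax fueterB ('D_ax fueterB w) /\ is_derive w ay fueterB ('D_ay fueterB w).
Proof. by move=> Ew; split; apply: derivableP; exact: class_C1_derivable fueterB_C1 Ew. Qed.

Lemma fueter_axis w : E w -> w.2 = 0 ->
  [/\ 'D_ax fueterA w = (-2) *: uaaa w, 'D_ay fueterA w = 0, 'D_ax fueterB w = 0 &
      'D_ay fueterB w = - ((2 * 3^-1) *: uaaa w)].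
Proof.
move=> Ew w0; have [[h1 h2] [h3 h4]] := sph_axis Ew w0.
split.
- by have [_] := is_deriveZ (-2) h1; exact.
- by have [_] := is_deriveZ (-2) h2; rewrite scaler0; exact.
- by have [_] := is_deriveZ 2 h3; rewrite scaler0; exact.
- by have [_] := is_deriveZ 2 h4; rewrite scalerN scalerA; exact.
Qed.

(** The form that the Cauchy-Riemann-Fueter equation takes on a pair inducing a
    slice function: a Cauchy-Riemann system with a term in [1 / beta]. *)
Lemma fueter_off w : E w -> w.2 != 0 ->
  'D_ax fueterB w = - 'D_ay fueterA w /\
  'D_ax fueterA w = 'D_ay fueterB w + (2 * (w.2)^-1) *: fueterB w.
Proof.
move=> Ew w0; have [[h1 h2] [h3 h4]] := sph_off Ew w0.
have [_ e1] := is_deriveZ (-2) h1; have [_ e2] := is_deriveZ (-2) h2.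
have [_ e3] := is_deriveZ 2 h3; have [_ e4] := is_deriveZ 2 h4.
rewrite [X in X = _ /\ _]e3 [X in _ = - X /\ _]e2 [X in _ /\ X = _]e1 [X in _ /\ _ = X + _]e4.
by split; rewrite /fueterB; move: (sB w) => ?; apply/rowP => m; rewrite !mxE; ring.
Qed.

Lemma lap1_derivable q e : circ1 E q -> e = 1 \/ imag_unit e -> derivable (lap1 g) q e.
Proof.
move=> /(circ1P _ cE) Eq.
have [J uJ qE] := polar_surj q.
case=> [->|ue].
  by have [+ _] := induced_derive1 fueterA_C1 dA dB lap1_induces Eq uJ; rewrite -qE; exact.
have [n0|n0] := eqVneq (im_norm q) 0.
  have [+ _] := induced_derive_unit fueterA_C1 dA dB lap1_induces Eq ue.
  by rewrite /= n0 -qpoint_re//; exact.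
have [e0 _] := (imag_unitP e).1 ue.
by have [] := induced_derive_off fueterA_C1 fueterB_C1 dA dB lap1_induces Eq n0 e0.
Qed.

(** On the real axis the derivative of [fueterA] along [alpha], [- 2 uaaa],
    balances the three derivatives of [fueterB] along the imaginary units,
    [2 / 3 uaaa] each. Off the axis this is the system [fueter_off]. *)
Lemma dbar1_lap1 q : circ1 E q -> dbar1 (lap1 g) q = 0.
Proof.
move=> /(circ1P _ cE) Eq.
have [n0|n0] := eqVneq (im_norm q) 0.
  have h e : imag_unit e -> 'D_e (lap1 g) q = e * - ((2 * 3^-1) *: uaaa (polar q)).
    move=> ue; have [_] := induced_derive_unit fueterA_C1 dA dB lap1_induces Eq ue.
    have [_ -> _ ->] := fueter_axis Eq n0.
    by rewrite /= n0 -(qpoint_re e n0) add0r.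
  have h0 : 'D_1 (lap1 g) q = (-2) *: uaaa (polar q).
    have [_] := induced_derive1 fueterA_C1 dA dB lap1_induces Eq qi_imag_unit.
    have [-> _ -> _] := fueter_axis Eq n0.
    by rewrite /= n0 -(qpoint_re qi n0) mulr0 addr0.
  rewrite /dbar1 h0 (h _ qi_imag_unit) (h _ qj_imag_unit) (h _ qk_imag_unit) !mulrA.
  rewrite [qi * qi]qi_imag_unit [qj * qj]qj_imag_unit [qk * qk]qk_imag_unit !mulN1r.
  by apply/rowP => m; rewrite !mxE; field.
have w0 : (polar q).2 != 0 by [].
have [uJ qE] := qpoint_vec n0.
have [_ h0] := induced_derive1 fueterA_C1 dA dB lap1_induces Eq uJ.
rewrite /= -qE in h0.
set r := (im_norm q)^-1 in h0 *.
have h e : imag_unit e -> 'D_e (lap1 g) q =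
    dot q e *: (r *: 'D_ay fueterA (polar q)) + (e * (r *: fueterB (polar q)) +
     vec q * (dot q e *: (r *: (r *: 'D_ay fueterB (polar q) - r ^+ 2 *: fueterB (polar q))))).
  move=> ue; have [e0 _] := (imag_unitP e).1 ue.
  by have [_] := induced_derive_off fueterA_C1 fueterB_C1 dA dB lap1_induces Eq n0 e0; exact.
have [f1 f2] := fueter_off Eq w0.
rewrite /dbar1 h0 (h _ qi_imag_unit) (h _ qj_imag_unit) (h _ qk_imag_unit) f1 f2.
rewrite dot_qi dot_qj dot_qk -[(polar q).2]/(im_norm q) -/r.
move: ('D_ay fueterA (polar q)) ('D_ay fueterB (polar q)) (fueterB (polar q)) => Y Z W.
rewrite -(addrA (_ + _) (qi * _)) -(addrA (_ + _) (_ + _) (qk * _)) sum_directions1.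
rewrite -im_norm_sqr mulrN -scalerAl -scalerAr.
move: (vec q * Y) => x.
by apply/rowP => m; rewrite !mxE /r; field.
Qed.

Lemma g_derivable q e : circ1 E q -> e = 1 \/ imag_unit e -> derivable g q e.
Proof.
move=> /(circ1P _ cE) Eq.
have [J uJ qE] := polar_surj q.
case=> [->|ue].
  by have := g_derivable1 Eq uJ; rewrite -qE; exact.
have [n0|n0] := eqVneq (im_norm q) 0.
  have [+ _] := g_derive_line Eq ue.
  by rewrite /= n0 -qpoint_re//; exact.
have [e0 _] := (imag_unitP e).1 ue.
by have [] := g_derive_off Eq n0 e0.
Qed.

Lemma g_derivable2 q e : circ1 E q -> e = 1 \/ imag_unit e -> derivable ('D_e g) q e.
Proof.
move=> /(circ1P _ cE) Eq.
have [J uJ qE] := polar_surj q.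
case=> [->|ue].
  by have [+ _] := g_derive11 Eq uJ; rewrite -qE; exact.
have [n0|n0] := eqVneq (im_norm q) 0.
  have [+ _] := g_derive_line2 Eq ue n0.
  by rewrite /= n0 -qpoint_re//; exact.
have [e0 e1] := (imag_unitP e).1 ue.
by have [] := g_derive2_off Eq n0 e0 e1.
Qed.

End FueterOneVariable.

(** * Separating the terms of a slice function *)

Section QuatAlgebra.
Context {R : realType}.
Implicit Types (p q c : quat R).

Lemma quat_mul_eq0 q c : q * c = 0 -> c != 0 -> q = 0.
Proof.
move=> qc0 c0.
pose s := re c ^+ 2 + imi c ^+ 2 + imj c ^+ 2 + imk c ^+ 2.
pose cc : quat R := Quat (re c) (- imi c) (- imj c) (- imk c).
have cE : c * cc = s *: 1 by apply: quatP; rewrite /cc /s !qcoordE; ring.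
have : s *: q = 0 by rewrite -[q]mulr1 scalerAr -cE mulrA qc0 mul0r.
move=> /eqP; rewrite scaler_eq0 => /orP[/eqP s0|/eqP//].
have r2 := sqr_ge0 (re c).
have i2 := sqr_ge0 (imi c); have j2 := sqr_ge0 (imj c); have k2 := sqr_ge0 (imk c).
have sq0 x : x ^+ 2 = 0 -> x = 0 :> R by move=> /eqP; rewrite sqrf_eq0 => /eqP.
rewrite /s in s0.
case/eqP: c0; apply: quatP; rewrite !qcoordE; apply: sq0; lra.
Qed.

(** The quaternion [J * p * J] is the same for all imaginary units [J];
    comparing [i p i], [j p j] and [k p k] leaves no imaginary component. *)
Lemma imag_unit_sandwich p (c B : quat R) :
  (forall J, imag_unit J -> p * (J * c) = J * B) -> c != 0 ->
  imi p = 0 /\ imj p = 0 /\ imk p = 0.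
Proof.
move=> H c0.
have sw J : imag_unit J -> J * p * J * c = - B.
  by move=> uJ; rewrite -!mulrA (H J uJ) mulrA [J * J]uJ mulN1r.
have e1 : qi * p * qi - qj * p * qj = 0.
  by apply: quat_mul_eq0 c0; rewrite mulrBl !sw ?subrr//; [exact: qj_imag_unit|exact: qi_imag_unit].
have e2 : qi * p * qi - qk * p * qk = 0.
  by apply: quat_mul_eq0 c0; rewrite mulrBl !sw ?subrr//; [exact: qk_imag_unit|exact: qi_imag_unit].
have /= a1 := congr1 imi e1; have /= a2 := congr1 imj e1.
have /= b1 := congr1 imi e2; have /= b3 := congr1 imk e2.
rewrite /qi /qj /qk !qcoordE in a1 a2 b1 b3.
split; [lra|split; lra].
Qed.

Lemma imag_unit_sign (b : bool) (J : quat R) : imag_unit J -> imag_unit ((-1 : R) ^+ b *: J).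
Proof.
by case: b => uJ; rewrite ?expr0 ?expr1 ?scale1r ?scaleN1r//; exact: imag_unitN.
Qed.

Lemma prod_unit (I : Type) (r : seq I) (P : pred I) (J : I -> quat R) :
  (forall i, imag_unit (J i)) ->
  exists2 c, c * (\prod_(i <- r | P i) J i) = 1 & (\prod_(i <- r | P i) J i) * c = 1.
Proof.
move=> uJ; apply: (big_ind (fun x : quat R => exists2 c, c * x = 1 & x * c = 1)).
- by exists 1; rewrite mulr1.
- move=> x y [c c1 c2] [d d1 d2]; exists (d * c).
    by rewrite mulrA -(mulrA d) c1 mulr1.
  by rewrite mulrA -(mulrA x) d2 mulr1.
- by move=> i _; exists (- J i); rewrite ?mulNr ?mulrN [J i * J i]uJ opprK.
Qed.

End QuatAlgebra.

Section Signs.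
Context {R : realType} {n : nat}.
Implicit Types (K L S : {set 'I_n}) (k l h : 'I_n).

(** A set [S] stands for the change of sign of the coordinates in [S]; then
    [chi K] runs over the characters of the group of sign changes. *)
Definition sign S k : R := (-1) ^+ (k \in S).
Definition chi K S : R := \prod_(k in K) sign S k.

Definition toggle l S : {set 'I_n} := [set k | (k == l) (+) (k \in S)]%SET.

Lemma toggleK l : involutive (toggle l).
Proof. by move=> S; apply/setP => k; rewrite !inE addbA addbb. Qed.

Lemma sign_toggle l S k : sign (toggle l S) k = (-1) ^+ (k == l) * sign S k.
Proof. by rewrite /sign inE signr_addb. Qed.

Lemma chi_toggle l K S : chi K (toggle l S) = (-1) ^+ (l \in K) * chi K S.
Proof.
rewrite /chi; under eq_bigr do rewrite sign_toggle.
rewrite big_split /=; congr (_ * _).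
have [lK|lK] := boolP (l \in K).
  rewrite (bigD1 l)//= eqxx big1 ?mulr1// => k /andP[_ /negbTE ->].
  by rewrite expr0.
by rewrite big1// => k kK; case: eqP lK => [<-|_ _]; rewrite ?kK ?expr0.
Qed.

Lemma sign_sqr S k : sign S k * sign S k = 1.
Proof. by rewrite /sign -signr_addb addbb. Qed.

Lemma chi_sqr K S : chi K S * chi K S = 1.
Proof. by rewrite /chi -big_split big1// => k _; exact: sign_sqr. Qed.

(** If [l] is in one of [K] and [L] only, toggling [l] reverses the sign of
    each summand. *)
Lemma chi_orthogonal K L :
  \sum_(S : {set 'I_n}) chi K S * chi L S = (K == L)%:R * #|{set 'I_n}|%:R.
Proof.
have [->|KL] := eqVneq K L.
  rewrite mul1r (eq_bigr (fun=> 1)) => [|S _]; last exact: chi_sqr.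
  by rewrite sumr_const.
have [l lKL] : exists l, (l \in K) (+) (l \in L).
  have [/existsP//|/existsPn H] := boolP [exists l, (l \in K) (+) (l \in L)].
  by case/eqP: KL; apply/setP => l; have := H l; rewrite negb_add => /eqP.
rewrite mul0r; apply/eqP.
have : \sum_(S : {set 'I_n}) chi K S * chi L S = - \sum_(S : {set 'I_n}) chi K S * chi L S.
  rewrite {1}(reindex_inj (inv_inj (toggleK l)))/= -sumrN; apply: eq_bigr => S _.
  rewrite !chi_toggle mulrACA -signr_addb lKL expr1 mulN1r; exact.
by move=> /eqP; rewrite -addr_eq0 -mulr2n mulrn_eq0.
Qed.

Definition flip S (J : 'I_n -> quat R) : 'I_n -> quat R := fun l => sign S l *: J l.

Lemma prod_flip K S J : \prod_(k in K) flip S J k = chi K S *: \prod_(k in K) J k.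
Proof. exact: scaler_prod. Qed.

Lemma flip_imag_unit S J : (forall l, imag_unit (J l)) -> forall l, imag_unit (flip S J l).
Proof. by move=> uJ l; exact: imag_unit_sign. Qed.

Lemma card_set_neq0 : #|{set 'I_n}|%:R != 0 :> R.
Proof. by rewrite pnatr_eq0 -lt0n; apply/card_gt0P; exists (finset.set0 : {set _}). Qed.

(** Fourier inversion: flipping the units multiplies the product over [K] by
    [chi K S], so the weights [chi K0 S] select the term of [K0]. *)
Lemma chi_average (J : 'I_n -> quat R) (G : {set 'I_n} -> quat R) K0 :
  \sum_(S : {set 'I_n}) chi K0 S *: (\sum_(K : {set 'I_n}) (\prod_(k in K) flip S J k) * G K)
  = #|{set 'I_n}|%:R *: ((\prod_(k in K0) J k) * G K0).
Proof.
transitivity (\sum_(S : {set 'I_n}) \sum_(K : {set 'I_n})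
    chi K0 S *: ((\prod_(k in K) flip S J k) * G K)).
  by apply: eq_bigr => S _; exact: scaler_sumr.
rewrite exchange_big/= (bigD1 K0)//= [X in _ + X]big1 ?addr0.
  under eq_bigr do rewrite prod_flip -scalerAl scalerA.
  by rewrite -scaler_suml chi_orthogonal eqxx mul1r.
move=> K KK0; under eq_bigr do rewrite prod_flip -scalerAl scalerA.
by rewrite -scaler_suml chi_orthogonal eq_sym (negbTE KK0) mul0r scale0r.
Qed.

Lemma chi_setU1 h L S : h \notin L -> chi (h |: L) S = sign S h * chi L S.
Proof.
by move=> hL; rewrite /chi big_setU1.
Qed.

End Signs.

Section OrderedProducts.
Context {R : realType} {n : nat}.
Variable (h : 'I_n).
Implicit Types (K L S : {set 'I_n}) (J : 'I_n -> quat R).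

(** An ordered product is cut at the place of [h] in the enumeration of the
    indices. *)
Definition pre : seq 'I_n := take (index h (index_enum 'I_n)) (index_enum 'I_n).
Definition post : seq 'I_n := drop (index h (index_enum 'I_n)).+1 (index_enum 'I_n).

Lemma index_enum_split : index_enum 'I_n = pre ++ h :: post.
Proof.
rewrite /pre /post -[LHS](cat_take_drop (index h (index_enum 'I_n))); congr (_ ++ _).
have hi : (index h (index_enum 'I_n) < size (index_enum 'I_n))%N by rewrite index_mem mem_index_enum.
by rewrite (drop_nth h hi) nth_index// mem_index_enum.
Qed.

Lemma pre_post_notin : h \notin pre /\ h \notin post.
Proof.
have := index_enum_uniq 'I_n; rewrite index_enum_split cat_uniq /= => /and3P[_ H /andP[hp _]].
split => //; apply/negP => hpre; move: H; rewrite negb_or => /andP[/negP H _].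
exact: H.
Qed.

Definition ppre L J : quat R := \prod_(k <- pre | k \in L) J k.
Definition ppost L J : quat R := \prod_(k <- post | k \in L) J k.

Lemma prod_split L J : h \notin L -> \prod_(k in L) J k = ppre L J * ppost L J.
Proof.
move=> hL; rewrite [LHS](_ : _ = \prod_(k <- pre ++ h :: post | k \in L) J k).
  by rewrite big_cat big_cons (negbTE hL).
by rewrite -index_enum_split.
Qed.

Lemma prod_put L J q : h \notin L ->
  \prod_(k in h |: L) (put h J q) k = ppre L J * (q * ppost L J).
Proof.
move=> hL; rewrite [LHS](_ : _ = \prod_(k <- pre ++ h :: post | k \in h |: L) (put h J q) k); last first.
  by rewrite -index_enum_split.
have [h1 h2] := pre_post_notin.
have E (s : seq 'I_n) : h \notin s ->
    \prod_(k <- s | k \in h |: L) put h J q k = \prod_(k <- s | k \in L) J k.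
  move=> hs; rewrite big_seq_cond [RHS]big_seq_cond.
  have neq k : k \in s -> (k == h) = false by move=> ks; apply: contraNF hs => /eqP <-.
  apply: eq_big => k; first by have [/neq kh|//] := boolP (k \in s); rewrite in_setU1 kh.
  by move=> /andP[/neq kh _]; rewrite /put /= kh.
by rewrite big_cat big_cons setU11 /= !E// /put /= eqxx.
Qed.

Lemma prod_put_notin L J q : h \notin L ->
  \prod_(k in L) (put h J q) k = \prod_(k in L) J k.
Proof.
by move=> hL; apply: eq_bigr => k kL; rewrite /put /=; case: eqP kL hL => [->->|].
Qed.

Lemma put_id (x : 'I_n -> quat R) : put h x (x h) = x.
Proof. by apply/funext => l; rewrite /put /=; case: eqP => [->|]. Qed.

Lemma sum_setU1 (V : nmodType) (G : {set 'I_n} -> V) :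
  \sum_(K : {set 'I_n}) G K =
  \sum_(L : {set 'I_n} | h \notin L) G L + \sum_(L : {set 'I_n} | h \notin L) G (h |: L).
Proof.
rewrite (bigID (fun K : {set 'I_n} => h \notin K))/=; congr (_ + _).
rewrite (reindex_onto (fun L => h |: L) (fun K => (K :\ h)%SET))/=.
  apply: eq_bigl => L; rewrite negbK setU11 /=.
  have [hL|hL] := boolP (h \in L).
    apply/negP => /eqP LE; move: hL; rewrite -LE; by rewrite !inE eqxx.
  by rewrite setU1K// eqxx.
by move=> K; rewrite negbK => hK; rewrite finset.setD1K.
Qed.

Definition meets_pre L := has [in L] pre.

Lemma ppre_meets L J : ~~ meets_pre L -> ppre L J = 1.
Proof.
move=> nL; rewrite /ppre big_seq_cond big1// => k /andP[kp kL].
by case/hasP: nL; exists k.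
Qed.

(** When no element of [L] precedes [h], the unit [J h] is the first factor of
    the product over [h |: L] and can be taken out on the left. *)
Lemma stem_sum_split (G : {set 'I_n} -> quat R) J :
  (forall L, h \notin L -> meets_pre L -> G (h |: L) = 0) ->
  \sum_(K : {set 'I_n}) (\prod_(k in K) J k) * G K =
  \sum_(L : {set 'I_n} | h \notin L) (\prod_(k in L) J k) * G L +
  J h * \sum_(L : {set 'I_n} | h \notin L) (\prod_(k in L) J k) * G (h |: L).
Proof.
move=> G0; rewrite sum_setU1 mulr_sumr; congr (_ + _); apply: eq_bigr => L hL.
have [mL|mL] := boolP (meets_pre L); first by rewrite G0// !mulr0.
have -> : \prod_(k in h |: L) J k = ppre L J * (J h * ppost L J).
  by rewrite -prod_put// put_id.
by rewrite (prod_split J hL) ppre_meets// !mul1r mulrA.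
Qed.

End OrderedProducts.

(** * Left linear combinations of Cauchy-Riemann pairs *)

Section LeftLinear.
Context {R : realType} {V : normedModType R}.
Implicit Types (D : set V) (G : V -> quat R) (c : quat R).

Lemma mull_continuous (U : topologicalType) (G : U -> quat R) c z :
  {for z, continuous G} -> {for z, continuous (fun y => c * G y)}.
Proof.
move=> cG.
have cr : (fun y => re (G y)) @ z --> re (G z).
  exact: (@continuous_comp _ _ _ G (@re R) z cG (@re_continuous R _)).
have ci : (fun y => imi (G y)) @ z --> imi (G z).
  exact: (@continuous_comp _ _ _ G (@imi R) z cG (@imi_continuous R _)).
have cj : (fun y => imj (G y)) @ z --> imj (G z).
  exact: (@continuous_comp _ _ _ G (@imj R) z cG (@imj_continuous R _)).
have ck : (fun y => imk (G y)) @ z --> imk (G z).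
  exact: (@continuous_comp _ _ _ G (@imk R) z cG (@imk_continuous R _)).
have cl (r : R) (g : U -> R) : g @ z --> g z -> (fun y => r * g y) @ z --> r * g z.
  by move=> cg; exact: (cvgM (cvg_cst r) cg).
apply/qcontinuous_comp => m; rewrite -(inord_val m).
case: m => [[|[|[|[|m]]]] hm]; last by [].
- have -> : (fun y => (c * G y) 0 (inord (Ordinal hm))) = (fun y =>
     re c * re (G y) - imi c * imi (G y) - imj c * imj (G y) - imk c * imk (G y)).
    by apply/funext => y; exact: reM.
  exact: (cvgB (cvgB (cvgB (cl _ _ cr) (cl _ _ ci)) (cl _ _ cj)) (cl _ _ ck)).
- have -> : (fun y => (c * G y) 0 (inord (Ordinal hm))) = (fun y =>
     re c * imi (G y) + imi c * re (G y) + imj c * imk (G y) - imk c * imj (G y)).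
    by apply/funext => y; exact: imiM.
  exact: (cvgB (cvgD (cvgD (cl _ _ ci) (cl _ _ cr)) (cl _ _ ck)) (cl _ _ cj)).
- have -> : (fun y => (c * G y) 0 (inord (Ordinal hm))) = (fun y =>
     re c * imj (G y) - imi c * imk (G y) + imj c * re (G y) + imk c * imi (G y)).
    by apply/funext => y; exact: imjM.
  exact: (cvgD (cvgD (cvgB (cl _ _ cj) (cl _ _ ck)) (cl _ _ cr)) (cl _ _ ci)).
- have -> : (fun y => (c * G y) 0 (inord (Ordinal hm))) = (fun y =>
     re c * imk (G y) + imi c * imj (G y) - imj c * imi (G y) + imk c * re (G y)).
    by apply/funext => y; exact: imkM.
  exact: (cvgD (cvgB (cvgD (cl _ _ ck) (cl _ _ cj)) (cl _ _ ci)) (cl _ _ cr)).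
Qed.

Lemma mull_is_derive G c z d dG : is_derive z d G dG -> is_derive z d (fun y => c * G y) (c * dG).
Proof.
move=> H; have := qis_deriveM (is_derive_cst c z d) H.
rewrite mul0r add0r; exact.
Qed.

Lemma class_C1_build D G (dG : V -> V -> quat R) : open D ->
  (forall d z, D z -> is_derive z d G (dG d z)) ->
  (forall d z, D z -> {for z, continuous (dG d)}) -> class_C1 D G.
Proof.
move=> oD dd cd; split; [exact: oD|] => d z Dz.
split; first by case: (dd d z Dz).
apply: continuous_for_eq (cd d z Dz).
by apply: filterS (near_open oD Dz) => y Dy; case: (dd d y Dy).
Qed.

Lemma class_C1_mull D G c : class_C1 D G -> class_C1 D (fun z => c * G z).
Proof.
move=> CG; have [oD dG] := CG.
apply: (@class_C1_build _ _ (fun d z => c * 'D_d G z) oD).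
  by move=> d z Dz; apply: mull_is_derive; apply: derivableP; exact: (dG d z Dz).1.
by move=> d z Dz; apply: mull_continuous; exact: (dG d z Dz).2.
Qed.

Lemma class_C1_add D G G' : class_C1 D G -> class_C1 D G' -> class_C1 D (fun z => G z + G' z).
Proof.
move=> [oD dG] [_ dG'].
apply: (@class_C1_build _ _ (fun d z => 'D_d G z + 'D_d G' z) oD).
  move=> d z Dz; have h1 := derivableP (dG d z Dz).1; have h2 := derivableP (dG' d z Dz).1.
  exact: is_deriveD h1 h2.
move=> d z Dz; have [_ c1] := dG d z Dz; have [_ c2] := dG' d z Dz.
exact: (cvgD c1 c2).
Qed.

Lemma class_C1_zero D : open D -> class_C1 D (fun=> 0 : quat R).
Proof.
move=> oD; apply: (@class_C1_build _ _ (fun _ _ => 0) oD).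
by move=> d z _; exact: cont_cst.
Qed.

Lemma class_C1_eq D G G' : (forall z, D z -> G z = G' z) -> class_C1 D G -> class_C1 D G'.
Proof.
move=> e [oD dG]; apply: (@class_C1_build _ _ (fun d z => 'D_d G z) oD).
  move=> d z Dz; apply: (@near_eq_is_derive _ _ _ G).
    by apply: filterS (near_open oD Dz) => y Dy; exact: e.
  by apply: derivableP; exact: (dG d z Dz).1.
by move=> d z Dz; exact: (dG d z Dz).2.
Qed.

Hypothesis fV : fin_dim V.
Variables (a b : V) (D : set V).

Lemma QHol_intro u v u' v' : class_C1 D u -> class_C1 D v ->
  (forall z, D z -> [/\ is_derive z a u (u' z), is_derive z b u (- v' z),
      is_derive z a v (v' z) & is_derive z b v (u' z)]) -> QHol a b D u v u' v'.
Proof.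
move=> Cu Cv H m.
split.
- by have [_ /(_ m)] := (class_C1_comp D u fV).1 Cu.
- by have [_ /(_ m)] := (class_C1_comp D v fV).1 Cv.
- move=> z Dz; have [h1 h2 _ _] := H z Dz; split.
    exact: (qis_derive_comp _ _ _ _).1 h1 m.
  by have := (qis_derive_comp _ _ _ _).1 h2 m; rewrite mxE; exact.
- move=> z Dz; have [_ _ h3 h4] := H z Dz; split.
    exact: (qis_derive_comp _ _ _ _).1 h3 m.
  exact: (qis_derive_comp _ _ _ _).1 h4 m.
Qed.

Lemma QHol_mull c u v u' v' : QHol a b D u v u' v' ->
  QHol a b D (fun z => c * u z) (fun z => c * v z) (fun z => c * u' z) (fun z => c * v' z).
Proof.
move=> H; have [Cu Cv] := QHol_C1 fV H.
apply: QHol_intro; [exact: class_C1_mull|exact: class_C1_mull|] => z Dz.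
have [h1 h2 h3 h4] := QHol_is_derive H Dz.
split; [exact: mull_is_derive| |exact: mull_is_derive|exact: mull_is_derive].
by rewrite -mulrN; exact: mull_is_derive.
Qed.

Lemma QHol_add u v u' v' u1 v1 u1' v1' : QHol a b D u v u' v' -> QHol a b D u1 v1 u1' v1' ->
  QHol a b D (fun z => u z + u1 z) (fun z => v z + v1 z) (fun z => u' z + u1' z) (fun z => v' z + v1' z).
Proof.
move=> H H'; have [Cu Cv] := QHol_C1 fV H; have [Cu' Cv'] := QHol_C1 fV H'.
apply: QHol_intro; [exact: class_C1_add|exact: class_C1_add|] => z Dz.
have [h1 h2 h3 h4] := QHol_is_derive H Dz; have [k1 k2 k3 k4] := QHol_is_derive H' Dz.
split; [exact: is_deriveD h1 k1| |exact: is_deriveD h3 k3|exact: is_deriveD h4 k4].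
by rewrite opprD; exact: is_deriveD h2 k2.
Qed.

Lemma QHol_zero : open D -> QHol a b D (fun=> 0) (fun=> 0) (fun=> 0) (fun=> 0).
Proof.
move=> oD; apply: QHol_intro; [exact: class_C1_zero|exact: class_C1_zero|] => z _.
by rewrite oppr0; split; exact: (is_derive_cst (0 : quat R)).
Qed.

Lemma QHol_sum (I : Type) (r : seq I) (P : pred I) (c : I -> quat R) (u v u' v' : I -> V -> quat R) :
  open D -> (forall i, P i -> QHol a b D (u i) (v i) (u' i) (v' i)) ->
  QHol a b D (fun z => \sum_(i <- r | P i) c i * u i z) (fun z => \sum_(i <- r | P i) c i * v i z)
    (fun z => \sum_(i <- r | P i) c i * u' i z) (fun z => \sum_(i <- r | P i) c i * v' i z).
Proof.
move=> oD H; elim: r => [|i r IH].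
  rewrite [X in QHol _ _ _ X](_ : _ = fun=> 0); last by apply/funext => z; rewrite big_nil.
  rewrite [X in QHol _ _ _ _ X](_ : _ = fun=> 0); last by apply/funext => z; rewrite big_nil.
  rewrite [X in QHol _ _ _ _ _ X](_ : _ = fun=> 0); last by apply/funext => z; rewrite big_nil.
  rewrite [X in QHol _ _ _ _ _ _ X](_ : _ = fun=> 0); last by apply/funext => z; rewrite big_nil.
  exact: QHol_zero.
have E (w : I -> V -> quat R) : (fun z => \sum_(j <- i :: r | P j) c j * w j z) =
    if P i then (fun z => c i * w i z + \sum_(j <- r | P j) c j * w j z)
    else (fun z => \sum_(j <- r | P j) c j * w j z).
  by apply/funext => z; rewrite big_cons; case: ifP.
rewrite !E; case: ifP => Pi; last exact: IH.
by apply: QHol_add IH; apply: QHol_mull; exact: H.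
Qed.

Lemma QHol_QCR u v u' v' : QHol a b D u v u' v' -> QCR a b D u v.
Proof.
move=> H; have [Cu Cv] := QHol_C1 fV H.
split; [exact: Cu|exact: Cv| |] => z Dz; have [[_ h1] [_ h2] [_ h3] [_ h4]] := QHol_is_derive H Dz.
  by rewrite h1 h4.
by rewrite h2 h3.
Qed.

Lemma QCR_sum (I : Type) (r : seq I) (P : pred I) (c : I -> quat R) (u v : I -> V -> quat R) :
  open D -> (forall i, P i -> QCR a b D (u i) (v i)) ->
  QCR a b D (fun z => \sum_(i <- r | P i) c i * u i z) (fun z => \sum_(i <- r | P i) c i * v i z).
Proof.
move=> oD H.
exact: QHol_QCR (@QHol_sum I r P c u v (fun i => 'D_a (u i)) (fun i => 'D_a (v i)) oD
  (fun i Pi => QCR_QHol fV (H i Pi))).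
Qed.

Lemma QCR_mull c u v : QCR a b D u v -> QCR a b D (fun z => c * u z) (fun z => c * v z).
Proof. by move=> H; exact: (QHol_QCR (QHol_mull c (QCR_QHol fV H))). Qed.

Lemma QCR_eq u v u' v' : (forall z, D z -> u z = u' z) -> (forall z, D z -> v z = v' z) ->
  QCR a b D u v -> QCR a b D u' v'.
Proof.
move=> eu ev H; have [[oD _] _ _ _] := H; have [Cu Cv e1 e2] := H.
have nu z : D z -> \forall y \near z, u y = u' y.
  by move=> Dz; apply: filterS (near_open oD Dz) => y; exact: eu.
have nv z : D z -> \forall y \near z, v y = v' y.
  by move=> Dz; apply: filterS (near_open oD Dz) => y; exact: ev.
split; [exact: class_C1_eq eu Cu|exact: class_C1_eq ev Cv| |] => z Dz.
  by rewrite -(near_eq_derive _ (nu z Dz)) -(near_eq_derive _ (nv z Dz)) e1.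
by rewrite -(near_eq_derive _ (nu z Dz)) -(near_eq_derive _ (nv z Dz)) e2.
Qed.

End LeftLinear.

(** * Regularity in one variable of the stem functions *)

(* As opposed to the default element of a pointed type. *)
Local Notation point := Defs.point.

Section Slices.
Context {R : realType} {n : nat}.
Local Notation Cn := ('rV[R]_n * 'rV[R]_n)%type.
Local Notation Hn := ('I_n -> quat R).
Implicit Types (D : set Cn) (z : Cn) (x y J : Hn) (h l : 'I_n) (S L K : {set 'I_n}) (w : R * R).

Lemma Cn_eq z z' : (forall l, z.1 0 l = z'.1 0 l) -> (forall l, z.2 0 l = z'.2 0 l) -> z = z'.
Proof.
case: z z' => [a b] [a' b'] /= h1 h2; congr pair; apply/rowP => l; [exact: h1|exact: h2].
Qed.

Definition flipz S z : Cn := (z.1, \row_l (sign S l * z.2 0 l)).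

Lemma conj_invariant_flipz D S z : conj_invariant D -> D z <-> D (flipz S z).
Proof.
move=> cD; move eqm : #|S| => m; elim: m S eqm => [|m IH] S Sm.
  have -> : flipz S z = z; last by [].
  apply: Cn_eq => l //=; rewrite mxE; move/eqP: Sm; rewrite cards_eq0 => /eqP ->.
  by rewrite /sign inE expr0 mul1r.
have /card_gt0P[l lS] : (0 < #|S|)%N by rewrite Sm.
have Sl : #|(S :\ l)%SET| = m by move: Sm; rewrite (cardsD1 l S) lS add1n => -[].
have -> : flipz S z = conj_at l (flipz (S :\ l)%SET z).
  apply: Cn_eq => k //=; rewrite !mxE; case: eqP => [->|/eqP kl].
    by rewrite /sign !inE eqxx lS /= expr1 expr0 mulN1r mul1r.
  by rewrite /sign !inE kl.
by rewrite IH//; exact: cD.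
Qed.

Lemma conj_invariant_norm D z z' : conj_invariant D ->
  (forall l, z.1 0 l = z'.1 0 l) -> (forall l, `|z.2 0 l| = `|z'.2 0 l|) -> D z -> D z'.
Proof.
move=> cD h1 h2 Dz.
have -> : z' = flipz [set l | z'.2 0 l != z.2 0 l]%SET z.
  apply: Cn_eq => l /=; first by rewrite h1.
  rewrite mxE /sign inE; have := h2 l; case: eqP => [->|ne e] /=; first by rewrite expr0 mul1r.
  have /eqP := e; rewrite eqr_norm2 => /orP[/eqP e'|/eqP ->]; first by case: ne.
  by rewrite expr1 mulN1r opprK.
exact: (conj_invariant_flipz _ z cD).1.
Qed.

Lemma polar_point z J l : (forall l, imag_unit (J l)) -> polar (point z J l) = (z.1 0 l, `|z.2 0 l|).
Proof. by move=> uJ; rewrite polar_qpoint. Qed.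

(** A point of the circularization determines [z] up to conjugation of some of
    its coordinates. *)
Lemma circ_point D z J : conj_invariant D -> (forall l, imag_unit (J l)) ->
  circ D (point z J) <-> D z.
Proof.
move=> cD uJ; split=> [[z' [J' [Dz' uJ' e]]]|Dz]; last by exists z, J.
apply: (conj_invariant_norm cD _ _ Dz') => l.
  have := congr1 (fun x : Hn => polar (x l)) e.
  by rewrite /= (polar_point _ _ uJ) (polar_point _ _ uJ') => -[].
have := congr1 (fun x : Hn => polar (x l)) e.
by rewrite /= (polar_point _ _ uJ) (polar_point _ _ uJ') => -[].
Qed.

Variable h : 'I_n.

Definition zput z w : Cn :=
  (\row_l (if l == h then w.1 else z.1 0 l), \row_l (if l == h then w.2 else z.2 0 l)).

Definition zat z : R * R := (z.1 0 h, z.2 0 h).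

Lemma zput_zat z : zput z (zat z) = z.
Proof. by apply: Cn_eq => l /=; rewrite mxE; case: eqP => [->|]. Qed.

Lemma zput_conj1 z w : zput z (conj1 w) = conj_at h (zput z w).
Proof. by apply: Cn_eq => l /=; rewrite !mxE //; case: eqP. Qed.

Lemma zput_conj_at l z w : l != h -> zput (conj_at l z) w = conj_at l (zput z w).
Proof.
move=> lh; apply: Cn_eq => k /=; rewrite !mxE //.
by case: eqP => // ->; rewrite eq_sym (negbTE lh).
Qed.

Lemma point_zput z w J (J0 : quat R) : point (zput z w) (put h J J0) = put h (point z J) (qpoint w.1 w.2 J0).
Proof.
by apply/funext => l; rewrite /point /put /= !mxE; case: eqP.
Qed.

Lemma put_unit J (J0 : quat R) : (forall l, imag_unit (J l)) -> imag_unit J0 -> forall l, imag_unit (put h J J0 l).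
Proof. by move=> uJ u0 l; rewrite /put /=; case: eqP. Qed.

Definition Dsec D z : set (R * R) := [set w | D (zput z w)].

Lemma Dsec_conj1 D z : conj_invariant D -> conj1_invariant (Dsec D z).
Proof. by move=> cD w; rewrite /Dsec /= zput_conj1; exact: cD. Qed.

Lemma section_domE D z J : conj_invariant D -> (forall l, imag_unit (J l)) ->
  section_dom D h (point z J) = circ1 (Dsec D z).
Proof.
move=> cD uJ; apply/seteqP; split=> q.
  rewrite /section_dom /=; have [J0 u0 qE] := polar_surj q.
  rewrite {1}qE -[re q]/(polar q).1 -[im_norm q]/(polar q).2 -point_zput.
  move=> /(circ_point _ cD (put_unit uJ u0)) Dq.
  by apply/circ1P; first exact: Dsec_conj1.
move=> [w [J0 [Dw u0 ->]]]; rewrite /section_dom /= -point_zput.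
by apply/circ_point => //; exact: put_unit.
Qed.

Lemma circ1_inj (E E' : set (R * R)) : conj1_invariant E -> conj1_invariant E' ->
  circ1 E = circ1 E' -> E = E'.
Proof.
move=> cE cE' e.
have H (A : set (R * R)) w : conj1_invariant A -> A w <-> circ1 A (qpoint w.1 w.2 qi).
  move=> cA; rewrite circ1P// (polar_qpoint _ _ qi_imag_unit).
  by case: (ger0P w.2) => _; [case: w|exact: cA].
by apply/seteqP; split=> w /H; rewrite ?e -?e => Hw; apply/H => //; rewrite ?e -?e; exact: Hw.
Qed.

Section Pairs.
Variables (D : set Cn) (f : Hn -> quat R).
Hypothesis cD : conj_invariant D.
Hypothesis SRf : forall y, circ D y -> slice1_regular (section_dom D h y) (section h y f).

Lemma SR_pair z J : D z -> (forall l, imag_unit (J l)) ->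
  exists G : (R * R -> quat R) * (R * R -> quat R), QCR ax ay (Dsec D z) G.1 G.2 /\
    forall w (J0 : quat R), Dsec D z w -> imag_unit J0 ->
      f (point (zput z w) (put h J J0)) = G.1 w + J0 * G.2 w.
Proof.
move=> Dz uJ.
have /SRf[E [G1 [G2 [cE e [_ _ ind] [C1 C2] eqs]]]] : circ D (point z J) by apply/circ_point.
rewrite section_domE// in e.
have EE := circ1_inj (Dsec_conj1 z cD) cE e.
rewrite EE; exists (G1, G2); split.
  by split; [exact: C1|exact: C2| |] => w Ew; case: (eqs w Ew).
by move=> w J0 Ew u0; rewrite point_zput; exact: ind.
Qed.

Variables (F : {set 'I_n} -> Cn -> quat R).
Hypothesis indF : induces D F f.

Lemma flip_put S J (J0 : quat R) : flip S (put h J J0) = put h (flip S J) (sign S h *: J0).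
Proof. by apply/funext => l; rewrite /flip /put /=; case: eqP => [->|]. Qed.

Local Notation N := (#|{set 'I_n}|%:R : R).

(** The value of [f] at each choice of signs [S] is given by a Cauchy-Riemann
    pair in [z_h]; [chi_average] combines these pairs into one for the single
    term of [K]. Flipping [J h] accounts for the sign in the second sum. *)
Lemma SR_average z J : D z -> (forall l, imag_unit (J l)) ->
  exists G1 G2 : {set 'I_n} -> R * R -> quat R,
    (forall S, QCR ax ay (Dsec D z) (G1 S) (G2 S)) /\
    forall K w (J0 : quat R), Dsec D z w -> imag_unit J0 ->
      N *: ((\prod_(k in K) put h J J0 k) * F K (zput z w)) =
      \sum_S chi K S *: G1 S w + J0 * \sum_S (chi K S * sign S h) *: G2 S w.
Proof.
move=> Dz uJ.
have [G HG] := choice (fun S => SR_pair Dz (flip_imag_unit S uJ)).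
exists (fun S => (G S).1), (fun S => (G S).2); split; first by move=> S; case: (HG S).
move=> K w J0 Dw u0.
rewrite -(chi_average (put h J J0) (fun K => F K (zput z w)) K).
rewrite mulr_sumr -big_split/=; apply: eq_bigr => S _.
rewrite -indF//; last by apply: flip_imag_unit; exact: put_unit.
rewrite flip_put (HG S).2//; last exact: imag_unit_sign.
by rewrite scalerDr; congr (_ + _); rewrite -scalerAl -scalerAr scalerA.
Qed.

Lemma plus_minus_eq0 (X Y A : quat R) (J0 : quat R) : A = X + J0 * Y -> - A = X + - J0 * Y ->
  X = 0 /\ A = J0 * Y.
Proof.
move=> e1 e2; have X0 : X = 0.
  have : X + X = 0.
    have : A + - A = (X + J0 * Y) + (X + - J0 * Y) by rewrite -e1 -e2.
    by rewrite subrr mulNr addrACA subrr addr0 => ->.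
  by rewrite -mulr2n -scaler_nat => /eqP; rewrite scaler_eq0 pnatr_eq0 /= => /eqP.
by split => //; rewrite e1 X0 add0r.
Qed.

Lemma plus_minus_eq (X Y A : quat R) (J0 : quat R) : A = X + J0 * Y -> A = X + - J0 * Y ->
  A = X /\ J0 * Y = 0.
Proof.
move=> e1 e2; have Y0 : J0 * Y = 0.
  have /eqP : X + J0 * Y = X + - J0 * Y by rewrite -e1 -e2.
  rewrite (inj_eq (addrI X)) mulNr -addr_eq0 -mulr2n -scaler_nat scaler_eq0 pnatr_eq0 /=.
  by move=> /eqP.
by split => //; rewrite e1 Y0 addr0.
Qed.

(** Let [P] be the product of the units of [L] that precede [h]. Comparing
    [J0] and [- J0] in [SR_average] shows that [P * (J0 * c) = J0 * B] for all
    imaginary units [J0] at the place [h], where [c] is [F (h |: L) z] up to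
    an invertible factor. If [c] is not zero, [P] is real by
    [imag_unit_sandwich], for every choice of the units; but [P] cannot be
    real both with [i] and with [j] at a place before [h]. *)
Lemma SR_vanish z L : D z -> h \notin L -> meets_pre h L -> F (h |: L) z = 0.
Proof.
move=> Dz hL mL; apply/eqP/negPn/negP => Fn0.
have Dw : Dsec D z (zat z) by rewrite /Dsec /= zput_zat.
have real J : (forall l, imag_unit (J l)) -> ppre h L J = re (ppre h L J) *: 1.
  move=> uJ; have [G1 [G2 [_ H]]] := SR_average Dz uJ.
  pose Y := \sum_S (chi (h |: L) S * sign S h) *: G2 S (zat z).
  have e (J0 : quat R) : imag_unit J0 -> ppre h L J * (J0 * (ppost h L J * F (h |: L) z)) = J0 * (N^-1 *: Y).
    move=> u0; have e1 := H (h |: L) _ _ Dw u0; have e2 := H (h |: L) _ _ Dw (imag_unitN u0).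
    rewrite zput_zat !prod_put// in e1 e2.
    have [|_ e3] := plus_minus_eq0 e1.
      by rewrite -e2 !mulNr mulrN mulNr scalerN.
    rewrite -scalerAr -/Y -e3 scalerA mulVf ?scale1r ?card_set_neq0//.
    by rewrite !mulrA.
  have [i0 [j0 k0]] : imi (ppre h L J) = 0 /\ imj (ppre h L J) = 0 /\ imk (ppre h L J) = 0.
    apply: imag_unit_sandwich e _.
    have [c c1 _] := prod_unit (post h) (fun k => k \in L) uJ.
    apply/eqP => c0; case/eqP: Fn0.
    by rewrite -[LHS]mul1r -c1 -mulrA [_ * F _ _]c0 mulr0.
  by apply: quatP; rewrite !qcoordE ?i0 ?j0 ?k0; ring.
have /hasP[l lp lL] := mL.
have up : uniq (pre h) by apply: take_uniq; exact: index_enum_uniq.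
move: (real) => real'.
have [r1 [r2 rE]] : exists r1, exists r2, pre h = r1 ++ l :: r2.
  by case/splitPr: lp => r1 r2; exists r1, r2.
have [l1 l2] : l \notin r1 /\ l \notin r2.
  move: up; rewrite rE cat_uniq /= => /and3P[_ H /andP[lr2 _]]; split => //.
  by apply/negP => lr1; move: H; rewrite negb_or lr1.
(* With [q] at the place [l] and [i] elsewhere, [P] is [c1^-1 * q * c2^-1], so
   that [i] and [j] would be real multiples of the same quaternion. *)
pose J (q : quat R) : Hn := put l (fun=> qi) q.
have E (s : seq 'I_n) q : l \notin s -> \prod_(k <- s | k \in L) J q k = \prod_(k <- s | k \in L) qi.
  move=> ls; rewrite big_seq_cond [RHS]big_seq_cond; apply: eq_bigr => k /andP[ks _].
  by rewrite /J /put /=; case: eqP ks ls => [->->|].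
have ppreE q : ppre h L (J q) = \prod_(k <- r1 | k \in L) (qi : quat R) *
    (q * \prod_(k <- r2 | k \in L) (qi : quat R)).
  by rewrite /ppre rE big_cat big_cons lL /= !E// /J /put /= eqxx.
have uq : forall l : 'I_n, imag_unit ((fun=> qi : quat R) l) by move=> _; exact: qi_imag_unit.
have uJ q : imag_unit q -> forall l, imag_unit (J q l).
  by move=> u k; rewrite /J /put /=; case: eqP => _; [exact: u|exact: qi_imag_unit].
have [c1 c1l _] := prod_unit r1 (fun k => k \in L) uq.
have [c2 _ c2r] := prod_unit r2 (fun k => k \in L) uq.
have cancel q : q = c1 * ppre h L (J q) * c2.
  by rewrite ppreE !mulrA c1l mul1r -mulrA c2r mulr1.
have ra := real _ (uJ _ qi_imag_unit); have rb := real _ (uJ _ qj_imag_unit).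
set r := re _ in ra; set s := re _ in rb.
have qiE : qi = r *: (c1 * c2) by rewrite [LHS]cancel ra -scalerAr mulr1 -scalerAl.
have qjE : qj = s *: (c1 * c2) by rewrite [LHS]cancel rb -scalerAr mulr1 -scalerAl.
have := congr1 imi qiE; have := congr1 imj qiE; have := congr1 imi qjE; have := congr1 imj qjE.
rewrite /qi /qj !qcoordE => b2 b1 a2 a1.
have r0 : r != 0 by apply/eqP => r0; move: a1; rewrite r0 mul0r => /eqP; rewrite oner_eq0.
move/esym/eqP: a2; rewrite mulf_eq0 (negbTE r0)/= => /eqP c0.
by move: b2; rewrite c0 mulr0 => /eqP; rewrite oner_eq0.
Qed.

(** Once the signs have isolated the terms of [L] and [h |: L], it remains to
    cancel the product of the units of [L] on the left. For [h |: L] the unit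
    of [h] stands in front of it, unless the term vanishes. *)
Lemma SR_stem_pair z L : D z -> h \notin L ->
  QCR ax ay (Dsec D z) (fun w => F L (zput z w)) (fun w => F (h |: L) (zput z w)).
Proof.
move=> Dz hL.
pose J : Hn := fun=> qi.
have uJ : forall l, imag_unit (J l) by move=> l; exact: qi_imag_unit.
have [G1 [G2 [HQ H]]] := SR_average Dz uJ.
have [c c1 _] := prod_unit (index_enum 'I_n) (fun k => k \in L) uJ.
have oE : open (Dsec D z) by have [[]] := HQ finset.set0.
have e1 w : Dsec D z w -> N *: ((\prod_(k in L) J k) * F L (zput z w)) = \sum_S chi L S *: G1 S w.
  move=> Dw; have h1 := H L w _ Dw qi_imag_unit; have h2 := H L w _ Dw (imag_unitN qi_imag_unit).
  rewrite !prod_put_notin// in h1 h2.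
  by have [] := plus_minus_eq h1 h2.
have e2 w : Dsec D z w -> N *: ((\prod_(k in L) J k) * F (h |: L) (zput z w)) = \sum_S chi L S *: G2 S w.
  move=> Dw; have h1 := H (h |: L) w _ Dw qi_imag_unit.
  have h2 := H (h |: L) w _ Dw (imag_unitN qi_imag_unit).
  rewrite !prod_put// in h1 h2.
  have [|_ h3] := plus_minus_eq0 h1.
    by rewrite -h2 !mulNr mulrN mulNr scalerN.
  have {}h3 : qi * (N *: ((\prod_(k in L) J k) * F (h |: L) (zput z w))) =
      qi * \sum_S (chi (h |: L) S * sign S h) *: G2 S w.
    rewrite -h3 (prod_split _ hL); have [mL|mL] := boolP (meets_pre h L).
      by rewrite (SR_vanish (z := zput z w))// !mulr0 !scaler0 mulr0.
    by rewrite ppre_meets// !mul1r -scalerAr -mulrA.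
  have {}h3 := congr1 (fun q => - qi * q) h3.
  rewrite !mulNr !(mulrA qi qi) [qi * qi]qi_imag_unit !mulN1r !opprK in h3.
  rewrite h3; apply: eq_bigr => S _.
  by rewrite chi_setU1// mulrC mulrA sign_sqr mul1r.
have Q := QCR_mull fin_dim_plane c (QCR_mull fin_dim_plane (N^-1 *: (1 : quat R))
  (QCR_sum (P := xpredT) fin_dim_plane (index_enum {set 'I_n}) (fun S => chi L S *: (1 : quat R)) oE (fun S _ => HQ S))).
apply: QCR_eq Q => w Dw.
  rewrite (eq_bigr (fun S => chi L S *: G1 S w)) => [|S _]; last by rewrite -scalerAl mul1r.
  rewrite -e1// -scalerAl mul1r scalerA mulVf ?scale1r ?card_set_neq0//.
  by rewrite mulrA c1 mul1r.
rewrite (eq_bigr (fun S => chi L S *: G2 S w)) => [|S _]; last by rewrite -scalerAl mul1r.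
rewrite -e2// -scalerAl mul1r scalerA mulVf ?scale1r ?card_set_neq0//.
by rewrite mulrA c1 mul1r.
Qed.

End Pairs.
End Slices.

(** * The stem function of the Laplacian *)

Section Assembly.
Context {R : realType} {n : nat}.
Local Notation Cn := ('rV[R]_n * 'rV[R]_n)%type.
Local Notation Hn := ('I_n -> quat R).
Implicit Types (D : set Cn) (z : Cn) (x y : Hn) (l : 'I_n) (S L K : {set 'I_n}) (w : R * R).
Variable h : 'I_n.

Definition dir1 l : Cn := (\row_k (k == l)%:R, 0).
Definition dir2 l : Cn := (0, \row_k (k == l)%:R).
Definition height z : R := z.2 0 h.

Lemma height_lin (s : R) (d z : Cn) : height (s *: d + z) = s * height d + height z.
Proof. by rewrite /height /= !mxE. Qed.

Lemma height_continuous : continuous height.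
Proof.
move=> z; apply: (@continuous_comp _ _ _ snd (fun M : 'rV[R]_n => M 0 h)); first exact: cont_snd.
exact: coord_continuous.
Qed.

Lemma height_dir1 : height (dir1 h) = 0. Proof. by rewrite /height /= mxE. Qed.
Lemma height_dir2 : height (dir2 h) = 1. Proof. by rewrite /height /= mxE eqxx. Qed.

Lemma fin_dim_Cn : @fin_dim R Cn.
Proof.
exists ('I_n * bool)%type, ([seq (l, true) | l <- index_enum 'I_n] ++ [seq (l, false) | l <- index_enum 'I_n]).
exists (fun i => if i.2 then dir1 i.1 else dir2 i.1), (fun i (z : Cn) => if i.2 then z.1 0 i.1 else z.2 0 i.1).
split.
- move=> [l []] z.
    apply: (@continuous_comp _ _ _ fst (fun M : 'rV[R]_n => M 0 l)); first exact: cont_fst.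
    exact: coord_continuous.
  apply: (@continuous_comp _ _ _ snd (fun M : 'rV[R]_n => M 0 l)); first exact: cont_snd.
  exact: coord_continuous.
- by move=> [l []] /=; rewrite mxE.
- move=> z; rewrite big_cat !big_map /=.
  have E1 (f : 'I_n -> Cn) : (\sum_l f l).1 = \sum_l (f l).1.
    by apply: (big_morph (fun p : Cn => p.1)).
  have E2 (f : 'I_n -> Cn) : (\sum_l f l).2 = \sum_l (f l).2.
    by apply: (big_morph (fun p : Cn => p.2)).
  apply: Cn_eq => l.
    rewrite [in RHS]/= E1 E1 mxE !summxE (bigD1 l)//= big1 => [|k kl].
      rewrite !mxE eqxx mulr1 addr0 big1 ?addr0// => k _.
      by rewrite !mxE mulr0.
    by rewrite !mxE eq_sym (negbTE kl) mulr0.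
  rewrite [in RHS]/= E2 E2 mxE !summxE [X in _ = X + _]big1 => [|k _].
    rewrite add0r (bigD1 l)//= big1 => [|k kl].
      by rewrite !mxE eqxx mulr1 addr0.
    by rewrite !mxE eq_sym (negbTE kl) mulr0.
  by rewrite !mxE mulr0.
Qed.

Lemma zput_line1 z (s : R) w : zput h z (s *: ax + w) = s *: dir1 h + zput h z w.
Proof.
apply: Cn_eq => l /=; rewrite !mxE; case: eqP => _; rewrite /= ?scale_real; ring.
Qed.

Lemma zput_line2 z (s : R) w : zput h z (s *: ay + w) = s *: dir2 h + zput h z w.
Proof.
apply: Cn_eq => l /=; rewrite !mxE; case: eqP => _; rewrite /= ?scale_real; ring.
Qed.

Lemma derive_zput1 (G : Cn -> quat R) z :
  'D_ax (fun w => G (zput h z w)) = (fun w => 'D_(dir1 h) G (zput h z w)).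
Proof.
apply/funext => w; rewrite /derive.
have -> : (fun s : R => s^-1 *: (((fun w => G (zput h z w)) \o shift w) (s *: ax) - G (zput h z w)))
  = (fun s : R => s^-1 *: ((G \o shift (zput h z w)) (s *: dir1 h) - G (zput h z w))).
  by apply/funext => s /=; rewrite zput_line1.
by [].
Qed.

Lemma derive_zput2 (G : Cn -> quat R) z :
  'D_ay (fun w => G (zput h z w)) = (fun w => 'D_(dir2 h) G (zput h z w)).
Proof.
apply/funext => w; rewrite /derive.
have -> : (fun s : R => s^-1 *: (((fun w => G (zput h z w)) \o shift w) (s *: ay) - G (zput h z w)))
  = (fun s : R => s^-1 *: ((G \o shift (zput h z w)) (s *: dir2 h) - G (zput h z w))).
  by apply/funext => s /=; rewrite zput_line2.
by [].
Qed.

Lemma height_zput z w : height (zput h z w) = w.2.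
Proof. by rewrite /height /= mxE eqxx. Qed.

Lemma put_put (y : Hn) (q q' : quat R) : put h (put h y q) q' = put h y q'.
Proof. by apply/funext => l; rewrite /put /=; case: eqP. Qed.

Lemma put_at (y : Hn) (q : quat R) : put h y q h = q.
Proof. by rewrite /put /= eqxx. Qed.

Lemma section_put (f : Hn -> quat R) x (q : quat R) : section h (put h x q) f = section h x f.
Proof. by apply/funext => q'; rewrite /section (put_put x q q'). Qed.

Lemma pderive_put (e : quat R) (f : Hn -> quat R) x (q : quat R) :
  pderive h e f (put h x q) = 'D_e (section h x f) q.
Proof. by rewrite /pderive (section_put f x q) (put_at x q). Qed.

Lemma section_pderive (e : quat R) (f : Hn -> quat R) x :
  section h x (pderive h e f) = 'D_e (section h x f).
Proof. by apply/funext => q; exact: pderive_put. Qed.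

Lemma section_laplacian (f : Hn -> quat R) x : section h x (laplacian h f) = lap1 (section h x f).
Proof.
have E (e q : quat R) : pderive h e (pderive h e f) (put h x q) = 'D_e ('D_e (section h x f)) q.
  by rewrite pderive_put section_pderive.
apply/funext => q.
exact: (congr2 +%R (congr2 +%R (congr2 +%R (E 1 q) (E qi q)) (E qj q)) (E qk q)).
Qed.

Lemma dbar_dbar1 (f : Hn -> quat R) x : dbar h f x = dbar1 (section h x f) (x h).
Proof. by []. Qed.

Lemma stem_sign K l (q : quat R) :
  (-1) ^+ #|K :&: [set l]%SET| * q = if l \in K then - q else q.
Proof.
have -> : #|K :&: [set l]%SET| = (l \in K) :> nat.
  have [lK|lK] := boolP (l \in K).
    by rewrite (finset.setIidPr _) ?cards1// finset.sub1set.
  apply/eqP; rewrite cards_eq0; apply/eqP/setP => k; rewrite !inE.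
  by apply/negbTE; apply: contra lK => /andP[kK /eqP <-].
by case: (l \in K); rewrite ?expr1 ?expr0 ?mulN1r ?mul1r.
Qed.

Lemma class_C1_scale (V : normedModType R) (D : set V) (k : R) (G : V -> quat R) :
  class_C1 D G -> class_C1 D (fun z : V => k *: G z).
Proof.
move=> CG; apply: class_C1_eq (class_C1_mull (k *: (1 : quat R)) CG) => z _.
by rewrite -scalerAl mul1r.
Qed.

Variables (D : set Cn) (f : Hn -> quat R) (F : {set 'I_n} -> Cn -> quat R).
Hypothesis cD : conj_invariant D.
Hypothesis stemF : stem D F.
Hypothesis indF : induces D F f.
Hypothesis vanF : forall L z, D z -> h \notin L -> meets_pre h L -> F (h |: L) z = 0.
Variables (ua va uaa vaa uaaa vaaa : {set 'I_n} -> Cn -> quat R).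
Local Notation "G \z z" := (fun w => G (zput h z w)) (at level 40).
Hypothesis T : forall L z, D z -> h \notin L ->
  tower ax ay (Dsec h D z) (F L \z z) (F (h |: L) \z z) (ua L \z z) (va L \z z)
    (uaa L \z z) (vaa L \z z) (uaaa L \z z) (vaaa L \z z).

Let fP := @fin_dim_plane R.

(** The formulas of one variable, read in the variable [z_h] of [z] with the
    height [beta_h]. *)
Definition lapA L z : quat R := (-2) *: sphA height (va L) (uaa L) z.
Definition lapB L z : quat R := 2 *: sphB height (F (h |: L)) (ua L) z.
Definition lap_stem K z : quat R := if h \in K then lapB (K :\ h)%SET z else lapA K z.

Lemma lapA_zput L z w : lapA L (zput h z w) = fueterA (va L \z z) (uaa L \z z) w.
Proof. by rewrite /lapA /fueterA /sphA height_zput. Qed.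

Lemma lapB_zput L z w : lapB L (zput h z w) = fueterB (F (h |: L) \z z) (ua L \z z) w.
Proof. by rewrite /lapB /fueterB /sphB height_zput. Qed.

Lemma lap_stem_setU1 L z : h \notin L -> lap_stem (h |: L) z = lapB L z.
Proof. by move=> hL; rewrite /lap_stem setU11 setU1K. Qed.

Lemma lap_stem_notin L z : h \notin L -> lap_stem L z = lapA L z.
Proof. by move=> hL; rewrite /lap_stem (negbTE hL). Qed.

Lemma F_even L z w : h \notin L -> Dsec h D z w -> F L (zput h z (conj1 w)) = F L (zput h z w).
Proof. by move=> hL Dw; rewrite zput_conj1 stemF// stem_sign (negbTE hL). Qed.

Lemma F_odd L z w : Dsec h D z w -> F (h |: L) (zput h z (conj1 w)) = - F (h |: L) (zput h z w).
Proof. by move=> Dw; rewrite zput_conj1 stemF// stem_sign setU11. Qed.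

Section Fixed.
Variables (z : Cn) (J : Hn).
Hypothesis Dz : D z.
Hypothesis uJ : forall l, imag_unit (J l).
Local Notation E := (Dsec h D z).
Local Notation PJ L := (\prod_(k in L) J k).
Local Notation tot G := (fun w => \sum_(L : {set 'I_n} | h \notin L) PJ L * G L w).

Let oE : open E.
Proof. by have [[]] := QHol_C1 fP (tower0 (@T finset.set0 z Dz (negbT (finset.in_set0 h)))). Qed.

Lemma tot_tower : tower ax ay E (tot (fun L => F L \z z)) (tot (fun L => F (h |: L) \z z))
  (tot (fun L => ua L \z z)) (tot (fun L => va L \z z)) (tot (fun L => uaa L \z z))
  (tot (fun L => vaa L \z z)) (tot (fun L => uaaa L \z z)) (tot (fun L => vaaa L \z z)).
Proof.
split.
- apply: (@QHol_sum _ _ fP ax ay E _ (index_enum {set 'I_n}) (fun L => h \notin L) (fun L => PJ L)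
    (fun L => F L \z z) (fun L => F (h |: L) \z z) (fun L => ua L \z z) (fun L => va L \z z) oE) => L hL.
  exact: tower0 (T Dz hL).
- apply: (@QHol_sum _ _ fP ax ay E _ (index_enum {set 'I_n}) (fun L => h \notin L) (fun L => PJ L)
    (fun L => ua L \z z) (fun L => va L \z z) (fun L => uaa L \z z) (fun L => vaa L \z z) oE) => L hL.
  exact: tower1 (T Dz hL).
- apply: (@QHol_sum _ _ fP ax ay E _ (index_enum {set 'I_n}) (fun L => h \notin L) (fun L => PJ L)
    (fun L => uaa L \z z) (fun L => vaa L \z z) (fun L => uaaa L \z z) (fun L => vaaa L \z z) oE) => L hL.
  exact: tower2 (T Dz hL).
Qed.

Lemma tot_induces : induces1 E (tot (fun L => F L \z z)) (tot (fun L => F (h |: L) \z z))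
  (section h (point z J) f).
Proof.
split.
- by move=> w Dw; apply: eq_bigr => L hL; rewrite F_even.
- by move=> w Dw; rewrite -sumrN; apply: eq_bigr => L hL; rewrite F_odd// mulrN.
move=> w J0 Dw u0; rewrite /section -point_zput indF//; last exact: put_unit.
rewrite (stem_sum_split (h := h) (G := fun K => F K (zput h z w))) => [|L hL mL]; last exact: vanF.
rewrite put_at; congr (_ + _ * _); apply: eq_bigr => L hL; rewrite prod_put_notin//.
Qed.

Let even_tot := let: And3 e _ _ := tot_induces in e.
Let odd_tot := let: And3 _ e _ := tot_induces in e.

Lemma tot_fueterA w : fueterA (tot (fun L => va L \z z)) (tot (fun L => uaa L \z z)) w =
  \sum_(L : {set 'I_n} | h \notin L) PJ L * lapA L (zput h z w).
Proof.
rewrite /fueterA /sphA; under [RHS]eq_bigr do rewrite lapA_zput /fueterA /sphA.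
case: eqP => _; rewrite ?scalerA scaler_sumr; apply: eq_bigr => L _.
  by rewrite scalerAr.
by rewrite scalerA scalerAr.
Qed.

Lemma tot_fueterB w : fueterB (tot (fun L => F (h |: L) \z z)) (tot (fun L => ua L \z z)) w =
  \sum_(L : {set 'I_n} | h \notin L) PJ L * lapB L (zput h z w).
Proof.
rewrite /fueterB /sphB; case: (eqVneq w.2 0) => [w0|w0].
  rewrite scaler0 big1// => L _.
  by rewrite lapB_zput /fueterB /sphB w0 eqxx scaler0 mulr0.
rewrite scaler_sumr -sumrB !scaler_sumr; apply: eq_bigr => L _.
rewrite lapB_zput /fueterB /sphB (negbTE w0).
by rewrite !scalerAr -mulrBr !scalerAr.
Qed.

Lemma section_lap_induces :
  induces1 E (fueterA (tot (fun L => va L \z z)) (tot (fun L => uaa L \z z)))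
    (fueterB (tot (fun L => F (h |: L) \z z)) (tot (fun L => ua L \z z)))
    (section h (point z J) (laplacian h f)).
Proof.
rewrite section_laplacian.
exact: lap1_induces (Dsec_conj1 h z cD) tot_tower even_tot odd_tot tot_induces.
Qed.

Lemma section_lap_C1 : slice1_C1 (section_dom D h (point z J)) (section h (point z J) (laplacian h f)).
Proof.
exists E, (fueterA (tot (fun L => va L \z z)) (tot (fun L => uaa L \z z))),
  (fueterB (tot (fun L => F (h |: L) \z z)) (tot (fun L => ua L \z z))); split.
- exact: Dsec_conj1.
- exact: section_domE.
- exact: section_lap_induces.
- exact: fueterA_C1 tot_tower odd_tot.
- exact: fueterB_C1 tot_tower odd_tot.
Qed.

Let at_h : circ1 E (point z J h).
Proof. by exists (zat h z), (J h); split=> //; rewrite /Dsec /= zput_zat. Qed.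

Lemma section_derivable e : e = 1 \/ imag_unit e ->
  derivable (section h (point z J) f) (point z J h) e /\
  derivable ('D_e (section h (point z J) f)) (point z J h) e /\
  derivable (lap1 (section h (point z J) f)) (point z J h) e.
Proof.
move=> ue; split; [|split].
- exact: (g_derivable (Dsec_conj1 h z cD) tot_tower tot_induces at_h ue).
- exact: (g_derivable2 (Dsec_conj1 h z cD) tot_tower even_tot odd_tot tot_induces at_h ue).
- exact: (lap1_derivable (Dsec_conj1 h z cD) tot_tower even_tot odd_tot tot_induces at_h ue).
Qed.

Lemma section_dbar : dbar1 (lap1 (section h (point z J) f)) (point z J h) = 0.
Proof.
exact: (dbar1_lap1 (Dsec_conj1 h z cD) tot_tower even_tot odd_tot tot_induces at_h).
Qed.

(** The Laplacian inherits the vanishing that allows [stem_sum_split] to put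
    its two components together again. *)
Lemma lapB_vanish L : h \notin L -> meets_pre h L -> lapB L z = 0.
Proof.
move=> hL mL; rewrite -(zput_zat h z) lapB_zput.
have Dw : E (zat h z) by rewrite /Dsec /= zput_zat.
have v0 w : E w -> F (h |: L) (zput h z w) = 0 by move=> Ew; exact: vanF.
have [_ _ _ hb] := QHol_is_derive (tower0 (T Dz hL)) Dw.
have u0 : ua L (zput h z (zat h z)) = 0.
  have [_ <-] := hb.
  suff [] : is_derive (zat h z) ay (F (h |: L) \z z) 0 by [].
  apply: (@near_eq_is_derive _ _ _ (fun=> 0)).
  by apply: filterS (near_open oE Dw) => w Ew; rewrite v0.
by rewrite /fueterB /sphB u0 v0//; case: ifP => _; rewrite ?scaler0 ?subr0 ?scaler0.
Qed.

Lemma lap_stem_at : laplacian h f (point z J) = \sum_(K : {set 'I_n}) (\prod_(k in K) J k) * lap_stem K z.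
Proof.
rewrite (stem_sum_split (h := h) (G := fun K => lap_stem K z)) => [|L hL mL]; last first.
  by rewrite lap_stem_setU1//; exact: lapB_vanish.
have Dw : E (zat h z) by rewrite /Dsec /= zput_zat.
have [_ _ H] := section_lap_induces.
have := H (zat h z) (J h) Dw (uJ h).
rewrite tot_fueterA tot_fueterB zput_zat /section.
have -> : put h (point z J) (qpoint (zat h z).1 (zat h z).2 (J h)) = point z J.
  by rewrite -[RHS](put_id h).
move=> ->; congr (_ + _ * _); apply: eq_bigr => L hL.
  by rewrite lap_stem_notin.
by rewrite lap_stem_setU1.
Qed.

End Fixed.

Lemma scaled_derive (E : set (R * R)) (P P' Pa Pa' : R * R -> quat R) (c : R) : open E ->
  (forall w, E w -> P' w = c *: P w) -> forall w, E w ->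
  is_derive w ax P (Pa w) -> is_derive w ax P' (Pa' w) -> Pa' w = c *: Pa w.
Proof.
move=> oE e w Ew hP [_ <-].
suff [] : is_derive w ax P' (c *: Pa w) by [].
have N : \forall y \near w, c *: P y = P' y.
  by apply: filterS (near_open oE Ew) => y Ey; rewrite e.
exact: near_eq_is_derive N (is_deriveZ c hP).
Qed.

Lemma zat_conj_at l z : l != h -> zat h (conj_at l z) = zat h z.
Proof. by move=> lh; rewrite /zat /= mxE eq_sym (negbTE lh). Qed.

Lemma conj_at_zput z : conj_at h z = zput h z (conj1 (zat h z)).
Proof. by rewrite zput_conj1 zput_zat. Qed.

(** Conjugation of another coordinate [z_l] multiplies [F L] and [F (h |: L)]
    by the same constant, hence also their derivatives in [z_h]. *)
Lemma lap_conj_other L l z : D z -> h \notin L -> l != h ->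
  lapA L (conj_at l z) = (-1) ^+ (l \in L) *: lapA L z /\
  lapB L (conj_at l z) = (-1) ^+ (l \in L) *: lapB L z.
Proof.
move=> Dz hL lh; set c : R := _ ^+ _; set z' := conj_at l z.
have Dz' : D z' by exact: (cD l z).1.
have EE w : Dsec h D z' w <-> Dsec h D z w.
  rewrite /Dsec /= zput_conj_at//; split; exact: (cD l _).2 + exact: (cD l _).1.
have oE : open (Dsec h D z) by have [[]] := QHol_C1 fP (tower0 (T Dz hL)).
have sF w : Dsec h D z w -> F L (zput h z' w) = c *: F L (zput h z w).
  by move=> Dw; rewrite zput_conj_at// stemF// stem_sign /c; case: (l \in L);
    rewrite ?expr1 ?expr0 ?scaleN1r ?scale1r.
have sF' w : Dsec h D z w -> F (h |: L) (zput h z' w) = c *: F (h |: L) (zput h z w).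
  by move=> Dw; rewrite zput_conj_at// stemF// stem_sign in_setU1 (negbTE lh) /c; case: (l \in L);
    rewrite ?expr1 ?expr0 ?scaleN1r ?scale1r.
have d0 w (Dw : Dsec h D z w) := QHol_is_derive (tower0 (T Dz hL)) Dw.
have d0' w (Dw : Dsec h D z w) := QHol_is_derive (tower0 (T Dz' hL)) ((EE w).2 Dw).
have d1 w (Dw : Dsec h D z w) := QHol_is_derive (tower1 (T Dz hL)) Dw.
have d1' w (Dw : Dsec h D z w) := QHol_is_derive (tower1 (T Dz' hL)) ((EE w).2 Dw).
have sua w : Dsec h D z w -> ua L (zput h z' w) = c *: ua L (zput h z w).
  move=> Dw; have [k _ _ _] := d0 w Dw; have [k' _ _ _] := d0' w Dw.
  exact: (scaled_derive (Pa := ua L \z z) (Pa' := ua L \z z') oE sF Dw k k').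
have sva w : Dsec h D z w -> va L (zput h z' w) = c *: va L (zput h z w).
  move=> Dw; have [_ _ k _] := d0 w Dw; have [_ _ k' _] := d0' w Dw.
  exact: (scaled_derive (Pa := va L \z z) (Pa' := va L \z z') oE sF' Dw k k').
have suaa w : Dsec h D z w -> uaa L (zput h z' w) = c *: uaa L (zput h z w).
  move=> Dw; have [k _ _ _] := d1 w Dw; have [k' _ _ _] := d1' w Dw.
  exact: (scaled_derive (Pa := uaa L \z z) (Pa' := uaa L \z z') oE sua Dw k k').
have Dw : Dsec h D z (zat h z) by rewrite /Dsec /= zput_zat.
rewrite -[in LHS](zput_zat h z') -[in lapB L z'](zput_zat h z') zat_conj_at//.
rewrite -[in RHS](zput_zat h z) -[in lapB L z](zput_zat h z).
rewrite !lapA_zput !lapB_zput /fueterA /fueterB /sphA /sphB sva// suaa// sua// sF'//.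
case: ifP => _; split; rewrite ?scaler0//; apply/rowP => m; rewrite !mxE; ring.
Qed.

Lemma lap_stem_stem : stem D lap_stem.
Proof.
move=> K l z Dz; rewrite stem_sign.
have [->|lh] := eqVneq l h.
  have Dw : Dsec h D z (zat h z) by rewrite /Dsec /= zput_zat.
  have hK : h \notin (K :\ h)%SET by rewrite !inE eqxx.
  have [hinK|hnK] := boolP (h \in K).
    rewrite /lap_stem hinK conj_at_zput -[in RHS](zput_zat h z) !lapB_zput.
    have ev := fun w => @F_even (K :\ h)%SET z w hK.
    have od := @F_odd (K :\ h)%SET z.
    exact: (fueterB_odd (Dsec_conj1 h z cD) (T Dz hK) ev od Dw).
  rewrite !lap_stem_notin// conj_at_zput -[in RHS](zput_zat h z) !lapA_zput.
  exact: (fueterA_even (Dsec_conj1 h z cD) (T Dz hnK) (@F_odd K z) Dw).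
have [hinK|hnK] := boolP (h \in K).
  have hK : h \notin (K :\ h)%SET by rewrite !inE eqxx.
  rewrite /lap_stem hinK (lap_conj_other Dz hK lh).2 !inE lh /=.
  by case: (l \in K); rewrite ?expr1 ?expr0 ?scaleN1r ?scale1r.
rewrite !lap_stem_notin// (lap_conj_other Dz hnK lh).1.
by case: (l \in K); rewrite ?expr1 ?expr0 ?scaleN1r ?scale1r.
Qed.

(** The quotients by the height are studied in [D] itself, the coordinates of
    [z] other than [z_h] being parameters. *)
Lemma lap_stem_C1 K :
  (forall L, h \notin L -> tower (dir1 h) (dir2 h) D (F L) (F (h |: L)) (ua L) (va L)
     (uaa L) (vaa L) (uaaa L) (vaaa L)) -> class_C1 D (lap_stem K).
Proof.
move=> TC.
have v0 L z : h \notin L -> D z -> height z = 0 -> F (h |: L) z = 0.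
  move=> hL Dz z0; have := stemF (h |: L) h Dz.
  have -> : conj_at h z = z.
    apply: Cn_eq => l //=; rewrite mxE; case: eqP => [->|//].
    by rewrite [z.2 0 h]z0 oppr0.
  rewrite stem_sign setU11 => /eqP; rewrite -addr_eq0 -mulr2n -scaler_nat scaler_eq0 pnatr_eq0 /=.
  by move=> /eqP.
have H L (hL : h \notin L) := qsph_C1 fin_dim_Cn height_lin height_continuous height_dir1 height_dir2
  (TC L hL) (fun z => @v0 L z hL).
have [hinK|hnK] := boolP (h \in K).
  have hK : h \notin (K :\ h)%SET by rewrite !inE eqxx.
  rewrite [lap_stem K](_ : _ = lapB (K :\ h)%SET).
    by apply: class_C1_scale; exact: (H _ hK).2.
  by apply/funext => z; rewrite /lap_stem hinK.
rewrite [lap_stem K](_ : _ = lapA K).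
  by apply: class_C1_scale; exact: (H _ hnK).1.
by apply/funext => z; rewrite lap_stem_notin.
Qed.

End Assembly.

(** * The Fueter map in one of several variables *)

Section Towers.
Context {R : realType} {n : nat}.
Local Notation Cn := ('rV[R]_n * 'rV[R]_n)%type.
Local Notation Hn := ('I_n -> quat R).
Variables (h : 'I_n) (D : set Cn) (f : Hn -> quat R) (F : {set 'I_n} -> Cn -> quat R).
Hypothesis cD : conj_invariant D.
Hypothesis SRf : forall y, circ D y -> slice1_regular (section_dom D h y) (section h y f).
Hypothesis indF : induces D F f.
Implicit Types (L K : {set 'I_n}) (z : Cn).

Definition stem_da k L z : quat R := iter k (fun G : Cn -> quat R => 'D_(dir1 h) G) (F L) z.

Local Notation ud k := (fun L => stem_da k L).
Local Notation vd k := (fun L => stem_da k (h |: L)).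

Lemma stem_QCR k L z : D z -> h \notin L ->
  QCR ax ay (Dsec h D z) (fun w => stem_da k L (zput h z w)) (fun w => stem_da k (h |: L) (zput h z w)).
Proof.
move=> Dz hL; elim: k => [|k IH]; first exact: (SR_stem_pair cD SRf indF Dz hL).
have := QCR_derive fin_dim_plane IH.
by rewrite [X in QCR _ _ _ X _]derive_zput1 [X in QCR _ _ _ _ X]derive_zput1; exact.
Qed.

Lemma stem_QHol k L z : D z -> h \notin L ->
  QHol ax ay (Dsec h D z) (fun w => stem_da k L (zput h z w)) (fun w => stem_da k (h |: L) (zput h z w))
   (fun w => stem_da k.+1 L (zput h z w)) (fun w => stem_da k.+1 (h |: L) (zput h z w)).
Proof.
move=> Dz hL; have := QCR_QHol fin_dim_plane (stem_QCR k Dz hL).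
by rewrite [X in QHol _ _ _ _ _ X]derive_zput1 [X in QHol _ _ _ _ _ _ X]derive_zput1; exact.
Qed.

Lemma stem_tower L z : D z -> h \notin L ->
  tower ax ay (Dsec h D z) (fun w => F L (zput h z w)) (fun w => F (h |: L) (zput h z w))
    (fun w => ud 1 L (zput h z w)) (fun w => vd 1 L (zput h z w))
    (fun w => ud 2 L (zput h z w)) (fun w => vd 2 L (zput h z w))
    (fun w => ud 3 L (zput h z w)) (fun w => vd 3 L (zput h z w)).
Proof.
move=> Dz hL; split.
- exact: (stem_QHol 0 Dz hL).
- exact: (stem_QHol 1 Dz hL).
- exact: (stem_QHol 2 Dz hL).
Qed.

(** When [F] is of class C1 on [D], the equations in [z_h] hold as equations
    between functions of all variables. *)
Lemma stem_QCR_joint L : (forall K, class_C1 D (F K)) -> h \notin L ->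
  QCR (dir1 h) (dir2 h) D (F L) (F (h |: L)).
Proof.
have d1 (G : Cn -> quat R) z : 'D_ax (fun w => G (zput h z w)) (zat h z) = 'D_(dir1 h) G z.
  by have := congr1 (@^~ (zat h z)) (derive_zput1 h G z); rewrite /= zput_zat.
have d2 (G : Cn -> quat R) z : 'D_ay (fun w => G (zput h z w)) (zat h z) = 'D_(dir2 h) G z.
  by have := congr1 (@^~ (zat h z)) (derive_zput2 h G z); rewrite /= zput_zat.
move=> CF hL; split; [exact: CF|exact: CF| |] => z Dz;
  have Dw : Dsec h D z (zat h z) by rewrite /Dsec /= zput_zat.
  have [_ _ e _] := SR_stem_pair cD SRf indF Dz hL.
  exact: (etrans (esym (d1 (F L) z)) (etrans (e _ Dw) (d2 (F (h |: L)) z))).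
have [_ _ _ e] := SR_stem_pair cD SRf indF Dz hL.
exact: (etrans (esym (d2 (F L) z)) (etrans (e _ Dw) (congr1 -%R (d1 (F (h |: L)) z)))).
Qed.

Lemma stem_tower_joint L : (forall K, class_C1 D (F K)) -> h \notin L ->
  tower (dir1 h) (dir2 h) D (F L) (F (h |: L)) (ud 1 L) (vd 1 L) (ud 2 L) (vd 2 L) (ud 3 L) (vd 3 L).
Proof.
move=> CF hL.
have Q k : QCR (dir1 h) (dir2 h) D (stem_da k L) (stem_da k (h |: L)).
  elim: k => [|k IH]; first exact: stem_QCR_joint.
  exact: (QCR_derive (@fin_dim_Cn R n) IH).
have H k := QCR_QHol (@fin_dim_Cn R n) (Q k).
by split; [exact: (H 0%N)|exact: (H 1%N)|exact: (H 2%N)].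
Qed.

Definition fueter_stem := lap_stem h F (ud 1) (vd 1) (ud 2).

End Towers.

Theorem theorem4p10 (R : realType) (n : nat)
    (D : set ('rV[R]_n * 'rV[R]_n)) (h : 'I_n) (f : ('I_n -> quat R) -> quat R) :
  conj_invariant D ->
  SR D h f ->
  [/\ has_laplacian D h f,
      slice D (laplacian h f),
      forall y, circ D y ->
        slice1_C1 (section_dom D h y) (section h y (laplacian h f)),
      monogenic D h (laplacian h f) &
      slice_C1 D f -> axially_monogenic D h (laplacian h f)].
Proof.
move=> cD [[F [stemF indF]] SRf].
(* The construction is made for an arbitrary stem function of [f]: the last
   claim takes one of class C1, which may differ from [F]. *)
pose a k F' : {set 'I_n} -> _ -> quat R := fun L => stem_da h F' k L.
pose b k F' : {set 'I_n} -> _ -> quat R := fun L => stem_da h F' k (h |: L).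
have T F' (indF' : induces D F' f) := stem_tower cD SRf indF'.
have van F' (indF' : induces D F' f) L z := SR_vanish cD SRf indF' (z := z) (L := L).
have units : [/\ (1 : quat R) = 1 \/ imag_unit (1 : quat R), (qi : quat R) = 1 \/ imag_unit (qi : quat R),
   (qj : quat R) = 1 \/ imag_unit (qj : quat R) & (qk : quat R) = 1 \/ imag_unit (qk : quat R)].
  by split; [left|right; exact: qi_imag_unit|right; exact: qj_imag_unit|right; exact: qk_imag_unit].
have [u1 ui uj uk] := units.
have der z J (Dz : D z) (uJ : forall l, imag_unit (J l)) e (ue : e = 1 \/ imag_unit e) :=
  @section_derivable R n h D f F cD stemF indF (van F indF) (a 1%N F) (b 1%N F) (a 2 F) (b 2 F) (a 3 F) (b 3 F) (T F indF) z J Dz uJ e ue.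
have M : monogenic D h (laplacian h f).
  split=> _ [z [J [Dz uJ ->]]].
    rewrite /pderivable section_laplacian.
    by split; [exact: (der z J Dz uJ 1 u1).2.2|exact: (der z J Dz uJ qi ui).2.2|
      exact: (der z J Dz uJ qj uj).2.2|exact: (der z J Dz uJ qk uk).2.2].
  rewrite dbar_dbar1 section_laplacian.
  exact: (@section_dbar R n h D f F cD stemF indF (van F indF) (a 1%N F) (b 1%N F) (a 2 F) (b 2 F) (a 3 F) (b 3 F) (T F indF) z J Dz uJ).
have S F' (stemF' : stem D F') (indF' : induces D F' f) :
    stem D (fueter_stem h F') /\ induces D (fueter_stem h F') (laplacian h f).
  split; first exact: (@lap_stem_stem R n h D F' cD stemF' (a 1%N F') (b 1%N F') (a 2 F') (b 2 F') (a 3 F') (b 3 F') (T F' indF')).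
  move=> z J Dz uJ.
  exact: (@lap_stem_at R n h D f F' cD stemF' indF' (van F' indF') (a 1%N F') (b 1%N F') (a 2 F') (b 2 F') (a 3 F') (b 3 F') (T F' indF') z J Dz uJ).
split.
- split=> _ [z [J [Dz uJ ->]]].
    by split; [exact: (der z J Dz uJ 1 u1).1|exact: (der z J Dz uJ qi ui).1|
      exact: (der z J Dz uJ qj uj).1|exact: (der z J Dz uJ qk uk).1].
  have der2 e : e = 1 \/ imag_unit e -> pderivable h e (pderive h e f) (point z J).
    by move=> ue; rewrite /pderivable (section_pderive h e f (point z J)); exact: (der z J Dz uJ e ue).2.1.
  by split; exact: der2.
- by exists (fueter_stem h F); exact: S.
- move=> _ [z [J [Dz uJ ->]]].
  exact: (@section_lap_C1 R n h D f F cD stemF indF (van F indF) (a 1%N F) (b 1%N F) (a 2 F) (b 2 F) (a 3 F) (b 3 F) (T F indF) z J Dz uJ).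
- exact: M.
- move=> [G [stemG CG indG]]; split; first exact: M.
  have [s1 s2] := S G stemG indG.
  exists (fueter_stem h G); split; [exact: s1| |exact: s2] => K.
  apply: (@lap_stem_C1 R n h D G stemG (a 1%N G) (b 1%N G) (a 2 G) (b 2 G) (a 3 G) (b 3 G)) => L hL.
  exact: (stem_tower_joint cD SRf indG CG hL).
Qed.
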